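(* Let $m\geq2$ and let $\Delta=\mathbf A^{2m-1}$, $\Delta_{m-1}$, $\Delta_m$ be as follows: $\pi:S\to\Delta$ is the versal deformation of the $m$-tacnode $y(y+x^m)=0$, $\Delta$ having coordinates $(\alpha_0,\ldots,\alpha_{m-2},\beta_0,\ldots,\beta_{m-1})$, and $\Delta_m$ (resp. $\Delta_{m-1}$) is the closure of the locus of points of $\Delta$ whose fibre under $\pi$ has $m$ (resp. $m-1$) nodes. Let $\Lambda\subset\Delta$ be a smooth $m$-dimensional variety such that: (i) $\Lambda$ contains $\Delta_m$; (ii) the tangent space $T_{\underline0}\Lambda$ of $\Lambda$ at the origin $\underline0$ is not contained in the hyperplane $H$ defined by the equation $\beta_0=0$. Then, in a neighbourhood of the origin, $\Lambda\cap\Delta_{m-1}=\Delta_m\cup\Psi$, where $\Psi$ is a smooth curve intersecting $\Delta_m$ at $\underline0$ with multiplicity $m$.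
   Context: We work over $\mathbf C$. The family $\pi:S\to\Delta=\mathbf A^{2m-1}_{\alpha_0,\ldots,\alpha_{m-2},\beta_0,\ldots,\beta_{m-1}}$ is the second projection restricted to the subscheme $S\subset\mathbf A^2_{x,y}\times\Delta$ defined by $$y^2+yx^m+\alpha_{m-2}yx^{m-2}+\cdots+\alpha_1yx+\alpha_0y+\beta_{m-1}x^{m-1}+\cdots+\beta_1x+\beta_0=0.$$ (It is known that $\Delta_m$ is the linear subspace $\beta_0=\cdots=\beta_{m-1}=0$, of dimension $m-1$, that it is contained in $\Delta_{m-1}$, and that $\dim\Delta_{m-1}=m$.) The intersection multiplicity of $\Psi$ with $\Delta_m$ at $\underline0$ is computed in $\Lambda$, in which $\Delta_m$ is a smooth hypersurface. *)

(* Defs.v *)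
(* MathComp, with classical sets and the type R[i] of complex numbers over a
   realType R; polynomials in several variables come from multinomials. *)
From HB Require Import structures.
From mathcomp Require Import all_boot all_order all_algebra.
From mathcomp Require Import boolp classical_sets reals.
From mathcomp Require Import complex mpoly.

Set Implicit Arguments.
Unset Strict Implicit.
Unset Printing Implicit Defensive.

Import GRing.Theory.
Local Open Scope classical_set_scope.
Local Open Scope ring_scope.

(* Points of the affine space A^n over K are row vectors 'rV[K]_n, and subsets
   are classical sets.  Algebraic sets carry their reduced structure. *)

Definition zero_locus (K : closedFieldType) (n : nat)
    (F : set {mpoly K[n]}) : set 'rV[K]_n :=
  [set x | forall f, F f -> f.@[x 0] = 0].

Definition vanishing_ideal (K : closedFieldType) (n : nat)
    (X : set 'rV[K]_n) : set {mpoly K[n]} :=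
  [set f | forall x, X x -> f.@[x 0] = 0].

Definition zariski_closed (K : closedFieldType) (n : nat)
    (X : set 'rV[K]_n) : Prop :=
  exists F : set {mpoly K[n]}, X = zero_locus F.

Definition zariski_open (K : closedFieldType) (n : nat)
    (U : set 'rV[K]_n) : Prop :=
  zariski_closed (~` U).

Definition zariski_closure (K : closedFieldType) (n : nat)
    (X : set 'rV[K]_n) : set 'rV[K]_n :=
  [set x | forall Z, zariski_closed Z -> X `<=` Z -> Z x].

Definition locally_closed (K : closedFieldType) (n : nat)
    (X : set 'rV[K]_n) : Prop :=
  exists Z U, [/\ zariski_closed Z, zariski_open U & X = Z `&` U].

Definition irreducible (K : closedFieldType) (n : nat)
    (X : set 'rV[K]_n) : Prop :=
  X !=set0 /\
  forall Z1 Z2, zariski_closed Z1 -> zariski_closed Z2 ->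
    X `<=` Z1 `|` Z2 -> X `<=` Z1 \/ X `<=` Z2.

Definition irreducible_chain (K : closedFieldType) (n : nat)
    (X : set 'rV[K]_n) (d : nat) : Prop :=
  exists Z : nat -> set 'rV[K]_n,
    (forall i, (i <= d)%N -> irreducible (Z i) /\
       exists2 W, zariski_closed W & Z i = X `&` W) /\
    (forall i, (i < d)%N -> Z i `<` Z i.+1).

(* Krull dimension of the Zariski topology induced on X. *)
Definition has_dimension (K : closedFieldType) (n : nat)
    (X : set 'rV[K]_n) (d : nat) : Prop :=
  irreducible_chain X d /\ ~ irreducible_chain X d.+1.

(* Zariski tangent space, as a linear subspace of K^n. *)
Definition tangent_space (K : closedFieldType) (n : nat)
    (X : set 'rV[K]_n) (p : 'rV[K]_n) : set 'rV[K]_n :=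
  [set v | forall f, vanishing_ideal X f ->
     \sum_(i < n) (f^`M(i)).@[p 0] * v 0 i = 0].

Definition has_linear_dimension (K : closedFieldType) (n : nat)
    (V : set 'rV[K]_n) (d : nat) : Prop :=
  exists2 B : 'M[K]_(d, n), row_free B & V = [set v | (v <= B)%MS].

(* A variety is an irreducible locally closed subset of affine space. *)
Definition smooth_variety (K : closedFieldType) (n : nat)
    (X : set 'rV[K]_n) (d : nat) : Prop :=
  [/\ irreducible X, locally_closed X, has_dimension X d
    & forall p, X p -> has_linear_dimension (tangent_space X p) d].

(* The local ring of A^n at p, inside the field of rational functions. *)
Definition local_ring (K : closedFieldType) (n : nat)
    (p : 'rV[K]_n) : set {fraction {mpoly K[n]}} :=
  [set r | exists f g : {mpoly K[n]},
     g.@[p 0] != 0 /\ r = tofrac f / tofrac g].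

(* The extension of the ideal J to the local ring of A^n at p. *)
Definition local_ideal (K : closedFieldType) (n : nat)
    (p : 'rV[K]_n) (J : set {mpoly K[n]}) : set {fraction {mpoly K[n]}} :=
  [set r | exists f g : {mpoly K[n]},
     [/\ J f, g.@[p 0] != 0 & r = tofrac f / tofrac g]].

(* The quotient of the local ring of A^n at p by J has K-dimension d: some
   family b of d elements induces a basis of it. *)
Definition has_local_colength (K : closedFieldType) (n : nat)
    (p : 'rV[K]_n) (J : set {mpoly K[n]}) (d : nat) : Prop :=
  exists2 b : 'I_d -> {fraction {mpoly K[n]}},
    forall i, local_ring p (b i) &
    forall r, local_ring p r -> exists! c : 'rV[K]_d,
      local_ideal p J (r - \sum_(i < d) tofrac (c 0 i)%:MP * b i).

(* dim_K O_{L,p} / (I_X + I_Y), the ring O_{L,p} being the quotient of the local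
   ring of A^n at p by I_L.  There are no higher Tor corrections when X is a
   smooth curve and Y is a smooth hypersurface of L not containing X. *)
Definition intersection_multiplicity (K : closedFieldType) (n : nat)
    (L X Y : set 'rV[K]_n) (p : 'rV[K]_n) (d : nat) : Prop :=
  has_local_colength p
    [set f | exists a b c, [/\ vanishing_ideal L a, vanishing_ideal X b,
       vanishing_ideal Y c & f = a + b + c]] d.

(* Coordinates on the base A^(2m-1), where 2m-1 is written m.-1 + m: first
   alpha_0, ..., alpha_(m-2), then beta_0, ..., beta_(m-1). *)
Definition alpha (K : closedFieldType) (m : nat) (t : 'rV[K]_(m.-1 + m))
  (i : 'I_m.-1) : K := t 0 (lshift m i).

Definition beta (K : closedFieldType) (m : nat) (t : 'rV[K]_(m.-1 + m))
  (j : 'I_m) : K := t 0 (rshift m.-1 j).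

(* Equation of the fibre over t in the plane with coordinates x, y. *)
Definition fibre (K : closedFieldType) (m : nat)
    (t : 'rV[K]_(m.-1 + m)) : {mpoly K[2]} :=
  let x : {mpoly K[2]} := 'X_(inord 0) in
  let y : {mpoly K[2]} := 'X_(inord 1) in
  y ^+ 2 + y * x ^+ m
  + \sum_(i < m.-1) (alpha t i)%:MP * y * x ^+ i
  + \sum_(j < m) (beta t j)%:MP * x ^+ j.

(* Ordinary double point of the plane curve f = 0: f vanishes at P to order
   exactly 2, with nondegenerate quadratic part. *)
Definition is_node (K : closedFieldType) (f : {mpoly K[2]})
    (P : 'rV[K]_2) : Prop :=
  let x : 'I_2 := inord 0 in
  let y : 'I_2 := inord 1 in
  [/\ f.@[P 0] = 0, (f^`M(x)).@[P 0] = 0, (f^`M(y)).@[P 0] = 0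
    & (f^`M(x)^`M(x)).@[P 0] * (f^`M(y)^`M(y)).@[P 0]
        - (f^`M(x)^`M(y)).@[P 0] ^+ 2 != 0].

Definition has_nodes (K : closedFieldType) (f : {mpoly K[2]})
    (k : nat) : Prop :=
  exists s : seq 'rV[K]_2,
    [/\ uniq s, size s = k & forall P, is_node f P <-> P \in s].

Definition nodal_locus (K : closedFieldType) (m k : nat)
    : set 'rV[K]_(m.-1 + m) :=
  zariski_closure [set t | has_nodes (fibre t) k].
Arguments nodal_locus K m k : clear implicits.

(* Main.v *)
Require Import Defs.
From HB Require Import structures.
From mathcomp Require Import all_boot all_order all_algebra.
From mathcomp Require Import boolp classical_sets reals.
From mathcomp Require Import complex mpoly.
From mathcomp Require Import functions cardinality separable ring lra zify.
(** Write the fibre over t as y^2 + a y + b = 0 with a = x^m + sum alpha_i x^i and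
    b = sum beta_j x^j.  Its nodes are the exact double roots of D = a^2 - 4 b, and
    D determines t, since a is the polynomial square root of D.  The fibre has
    m - 1 nodes when D = q^2 r with q of degree m - 1 and r = (x - c)^2 - 4 sigma.
    Let lambda + mu = x - c and lambda mu = sigma.  The polynomials
    T_k = lambda^k + mu^k and U_k = (lambda^k - mu^k) / (lambda - mu) satisfy
    T_k T_(k+d) - r U_k U_(k+d) = 2 sigma^k T_d, so the expansions q = sum p_k U_k
    and a = sum p_k T_k (with p_m = 1 and p_(m-1) = m c) turn D = q^2 r into
    b = sum_k p_k^2 sigma^k + sum_(k, d > 0) p_k p_(k+d) sigma^k T_d.
    This is a finite map nu from the affine space of coordinates
    (sigma, p_1, ..., p_(m-2), c) onto Delta_(m-1), and it sends sigma = 0 onto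
    Delta_m.

    By (i) and (ii), Lambda is contained near 0 in the locus beta_l = beta_0 n_l,
    0 < l < m.  Pulled back by nu, these equations are linear in the sigma^k p_k
    with an invertible matrix at 0, and Cramer's rule turns them into
    sigma^k p_k = sigma^m e_k.  Off sigma = 0 this is p_k = sigma^(m-k) e_k, a
    smooth curve with parameter sigma along which alpha_(m-2) has order 1, every
    beta_j has order at least m and beta_0 has order exactly m.  As nu is finite and
    only 0 lies over 0, Nakayama's lemma makes the image Psi of this curve a
    smooth curve with parameter alpha_(m-2), on which the ideal of Delta_m is
    generated near 0 by a function of order m. *)
Set Implicit Arguments.
Unset Strict Implicit.
Unset Printing Implicit Defensive.
Import Order.TTheory GRing.Theory Num.Theory.
Local Open Scope classical_set_scope.
Local Open Scope ring_scope.

(** * Ideals *)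

(** Throughout, [n] is m - 2. The value p_(m-1) = m c is forced by the missing term x^(m-1) of a.
    The equations of the curve upstairs are only known to define it near 0, so they give no prime
    ideal at once. They are therefore solved in power series, approximated by polynomials modulo
    powers of a variable: the polynomials of infinite order along this formal arc form a prime
    ideal, and the order is a valuation from which smoothness and multiplicity are read. Psi is an
    open part of the zero locus of the preimage of this prime under the pullback by nu. That Psi
    lies in Lambda is a separate point, since the equations beta_l = beta_0 n_l are only some of
    those of Lambda. Local statements about ideals are written with a multiplier that does not
    vanish at the point, so that Cramer's rule and Nakayama's lemma stay within polynomials. The
    Nullstellensatz, used to pass from primes back to point sets, is proved over an uncountable
    field, where a counting argument is available. *)

Definition ideal (S : comNzRingType) (P : set S) : Prop :=
  [/\ P 0, forall x y : S, P x -> P y -> P (x + y)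
    & forall a x : S, P x -> P (a * x)].

Definition prime_ideal (S : comNzRingType) (P : set S) : Prop :=
  [/\ ideal P, ~ P 1 & forall x y : S, P (x * y) -> P x \/ P y].

Section Ideal.
Variables (S : comNzRingType) (P : set S).
Hypothesis idP : ideal P.
Implicit Types a x y z : S.

Lemma idl0 : P 0. Proof. by case: idP. Qed.
Lemma idlD x y : P x -> P y -> P (x + y). Proof. by case: idP => _ + _; exact. Qed.
Lemma idlMl a x : P x -> P (a * x). Proof. by case: idP => _ _; exact. Qed.
Lemma idlMr a x : P x -> P (x * a). Proof. by rewrite mulrC; exact: idlMl. Qed.
Lemma idlN x : P x -> P (- x). Proof. by rewrite -mulN1r; exact: idlMl. Qed.
Lemma idlB x y : P x -> P y -> P (x - y).
Proof. by move=> Px Py; apply: idlD => //; exact: idlN. Qed.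
Lemma idl_sum I (r : seq I) (Q : pred I) (F : I -> S) :
  (forall i, Q i -> P (F i)) -> P (\sum_(i <- r | Q i) F i).
Proof. by move=> PF; apply: (big_ind P) => //; [exact: idl0|exact: idlD]. Qed.
Lemma idlBC x y : P (x - y) -> P (y - x).
Proof. by move/idlN; rewrite opprB. Qed.
Lemma idl_subr x y : P (x - y) -> P y -> P x.
Proof. by move=> Pxy Py; rewrite -(subrK y x); exact: idlD. Qed.
Lemma idl_subl x y : P (x - y) -> P x -> P y.
Proof. by move=> /idlBC Pxy Py; exact: idl_subr Pxy Py. Qed.
Lemma idlM_congr x x' y y' : P (x - x') -> P (y - y') -> P (x * y - x' * y').
Proof.
move=> Px Py; have -> : x * y - x' * y' = y * (x - x') + x' * (y - y').
  by rewrite !mulrBr [y * x]mulrC [y * x']mulrC subrKA.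
by apply: idlD; apply: idlMl.
Qed.
Lemma idlX_congr x x' k : P (x - x') -> P (x ^+ k - x' ^+ k).
Proof.
move=> Px; elim: k => [|k IHk]; first by rewrite subrr; exact: idl0.
by rewrite !exprS; exact: idlM_congr.
Qed.
End Ideal.

Section PrimeIdeal.
Variables (S : comNzRingType) (P : set S).
Hypothesis prP : prime_ideal P.
Implicit Types x y : S.
Lemma prime_ideal_ideal : ideal P. Proof. by case: prP. Qed.
Lemma prime_idlMl x y : ~ P x -> P (x * y) -> P y.
Proof. by case: prP => _ _ H nPx /H[]. Qed.
Lemma prime_idlX x k : P (x ^+ k) -> P x.
Proof.
case: prP => _ n1 H; elim: k => [|k IHk]; first by rewrite expr0.
by rewrite exprS => /H[].
Qed.
End PrimeIdeal.

Lemma ideal_ext (S : comNzRingType) (r : nat) (h : 'I_r -> S) :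
  ideal [set f | exists c : 'I_r -> S, f = \sum_i c i * h i].
Proof.
split.
- by exists (fun=> 0); rewrite big1 // => i _; rewrite mul0r.
- move=> x y [c ->] [d ->]; exists (fun i => c i + d i).
  by rewrite -big_split; apply: eq_bigr => i _; rewrite mulrDl.
- move=> a x [c ->]; exists (fun i => a * c i).
  by rewrite mulr_sumr; apply: eq_bigr => i _; rewrite mulrA.
Qed.

Lemma ideal_ext_gen (S : comNzRingType) (r : nat) (h : 'I_r -> S) i :
  exists c : 'I_r -> S, h i = \sum_i c i * h i.
Proof.
exists (fun j => (j == i)%:R); rewrite (bigD1 i) //= eqxx mul1r big1 ?addr0 //.
by move=> j /negPf ->; rewrite mul0r.
Qed.

Lemma ideal_preim (S S' : comNzRingType) (f : {rmorphism S -> S'}) (P : set S') :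
  ideal P -> ideal (f @^-1` P).
Proof.
move=> idP; split => /=.
- by rewrite /preimage /= rmorph0; exact: idl0.
- by move=> x y; rewrite /preimage /= rmorphD; exact: idlD.
- by move=> a x; rewrite /preimage /= rmorphM; exact: idlMl.
Qed.

Lemma prime_ideal_preim (S S' : comNzRingType) (f : {rmorphism S -> S'}) (P : set S') :
  prime_ideal P -> prime_ideal (f @^-1` P).
Proof.
case=> idP n1 H; split; first exact: ideal_preim.
  by rewrite /preimage /= rmorph1.
by move=> x y; rewrite /preimage /= rmorphM => /H.
Qed.

(** Multiply the relations by the adjugate of [M]. [P] is only required to be stable under the image
    of [f], because one use takes a submodule over the smaller ring that is not an ideal of [S]. *)
Lemma det_trick (R S : comNzRingType) (f : {rmorphism R -> S}) (P : set S)
    (r : nat) (M : 'M[R]_r) (w : 'I_r -> S) :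
    P 0 -> (forall x y : S, P x -> P y -> P (x + y)) ->
    (forall (a : R) (x : S), P x -> P (f a * x)) ->
    (forall i, P (\sum_j f (M i j) * w j)) ->
  forall i, P (f (\det M) * w i).
Proof.
move=> P0 PD PM PMw i.
have -> : f (\det M) * w i =
    \sum_k f ((\adj M) i k) * (\sum_j f (M k j) * w j).
  under eq_bigr do rewrite mulr_sumr.
  rewrite exchange_big /=.
  transitivity (\sum_j f (((\det M)%:M : 'M_r) i j) * w j).
    rewrite (bigD1 i) //= mxE eqxx mulr1n big1 ?addr0 // => j ne_ji.
    by rewrite mxE eq_sym (negPf ne_ji) mulr0n rmorph0 mul0r.
  apply: eq_bigr => j _; rewrite -mul_adj_mx mxE rmorph_sum mulr_suml.
  by apply: eq_bigr => k _; rewrite rmorphM mulrA.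
by apply: (big_ind P) => // k _; exact: PM.
Qed.

Section MMap.
Variables (n : nat) (K : comNzRingType).

Lemma rmorph_mmap (S S' : comNzRingType) (f : {rmorphism K -> S})
    (g : {rmorphism S -> S'}) (f' : {rmorphism K -> S'}) (h : 'I_n -> S)
    (h' : 'I_n -> S') (p : {mpoly K[n]}) :
    (forall c, g (f c) = f' c) -> (forall i, g (h i) = h' i) ->
  g (mmap f h p) = mmap f' h' p.
Proof.
move=> gf gh; rewrite /mmap rmorph_sum; apply: eq_bigr => m _.
rewrite rmorphM gf; congr (_ * _); rewrite /mmap1 rmorph_prod.
by apply: eq_bigr => i _; rewrite rmorphXn gh.
Qed.

Lemma mmap_congr (S : comNzRingType) (P : set S) (f : {rmorphism K -> S})
    (h h' : 'I_n -> S) (p : {mpoly K[n]}) : ideal P ->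
  (forall i, P (h i - h' i)) -> P (mmap f h p - mmap f h' p).
Proof.
move=> idP Ph; rewrite /mmap -sumrB; apply: idl_sum => // m _.
rewrite -mulrBr; apply: idlMl => //; rewrite /mmap1.
elim/big_ind2 : _ => [|x x' y y' Px Py|i _].
- by rewrite subrr; exact: idl0.
- exact: idlM_congr.
- exact: idlX_congr.
Qed.

Lemma mmap_id (p : {mpoly K[n]}) : mmap (@mpolyC n K) (fun i => 'X_i) p = p.
Proof.
rewrite {2}(mpolyE p) /mmap; apply: eq_bigr => m _.
by rewrite mul_mpolyC; congr (_ *: _); rewrite mpolyXE_id.
Qed.

End MMap.

(** * The Hilbert basis theorem *)

Lemma nondecreasing_subsequence (u : nat -> nat) :
  exists phi : nat -> nat, {homo phi : i j / (i < j)%N} /\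
    {homo u \o phi : i j / (i <= j)%N}.
Proof.
have argmin N : exists k, (N <= k)%N /\ forall j, (N <= j)%N -> (u k <= u j)%N.
  have exP : exists v, `[< exists2 k, (N <= k)%N & u k = v >].
    by exists (u N); apply/asboolP; exists N.
  case: (ex_minnP exP) => v /asboolP[k Nk <-] vmin; exists k; split=> // j Nj.
  by apply: vmin; apply/asboolP; exists j.
have [g gP] := choice argmin.
(* Each index is the argmin of [u] on the tail after the previous index, so the values never
   decrease. *)
pose phi := fix F i := if i is j.+1 then g (F j).+1 else g 0%N.
exists phi; split; first by apply: homo_ltn => [|i]; [exact: ltn_trans|case: (gP (phi i).+1)].
apply: homo_leq => [//||i /=]; first by move=> ? ? ?; exact: leq_trans.
have lt_phi : (phi i < g (phi i).+1)%N by case: (gP (phi i).+1).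
case: i lt_phi => [|i] /= lt_phi.
  by case: (gP 0%N) => _; apply.
case: (gP (phi i).+1) => ge min; apply: min.
exact: leq_trans ge (ltnW lt_phi).
Qed.

Lemma dickson_pair (n : nat) (u : nat -> 'X_{1..n}) :
  exists i j, (i < j)%N /\ (u i <= u j)%MM.
Proof.
have H (s : seq 'I_n) : exists phi : nat -> nat, {homo phi : i j / (i < j)%N} /\
    {in s, forall k, {homo (fun i => u (phi i) k) : i j / (i <= j)%N}}.
  elim: s => [|k s [phi [phiS phiM]]]; first by exists id; split => // k; rewrite in_nil.
  have [psi [psiS psiM]] := nondecreasing_subsequence (fun i => u (phi i) k).
  exists (phi \o psi); split => [i j /psiS/phiS //|l].
  rewrite inE => /predU1P[-> //|/phiM uM] i j ij /=; apply: uM.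
  by have [->//|ne] := eqVneq i j; apply/ltnW/psiS; rewrite ltn_neqAle ne.
have [phi [phiS phiM]] := H (enum 'I_n).
exists (phi 0%N), (phi 1%N); split; first exact: phiS.
by apply/mnm_lepP => k; apply: phiM; rewrite ?mem_enum.
Qed.

(** Otherwise a greedy choice of elements of [L] that no earlier one divides gives a sequence
    contradicting [dickson_pair]. *)
Lemma dickson (n : nat) (L : set 'X_{1..n}) :
  exists s : seq 'X_{1..n}, (forall m, m \in s -> L m) /\
    forall m, L m -> exists2 m', m' \in s & (m' <= m)%MM.
Proof.
apply: contrapT => /forallNP noS.
have next (s : seq 'X_{1..n}) : exists m, (forall m', m' \in s -> L m') ->
    L m /\ forall m', m' \in s -> ~~ (m' <= m)%MM.
  have [sL|] := pselect (forall m', m' \in s -> L m'); last by exists 0%MM.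
  have : ~ (forall m, L m -> exists2 m', m' \in s & (m' <= m)%MM).
    by move=> H; exact: (noS s).
  move/existsNP => [m /not_implyP[Lm Nm]]; exists m => _; split=> // m' sm'.
  by apply/negP => le; apply: Nm; exists m'.
have [g gP] := choice next.
pose l := fix F i := if i is j.+1 then g (F j) :: F j else [::].
have lL i : forall m, m \in l i -> L m.
  elim: i => [//|i IHi] m; rewrite inE => /predU1P[->|/IHi //].
  by case: (gP _ IHi).
have [i [j [ij le]]] := dickson_pair (fun i => g (l i)).
have [_ nle] := gP _ (lL j).
suff /nle : g (l i) \in l j by rewrite le.
clear -ij; elim: j ij => [//|j IHj]; rewrite ltnS leq_eqVlt => /predU1P[->|/IHj].
  by rewrite /= mem_head.
by rewrite /= inE orbC => ->.
Qed.

(** The generators realize the finite basis that Dickson's lemma gives for the leading monomials of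
    [J]. Subtracting a multiple of one of them lowers the leading monomial, and the monomial order
    is well founded. *)
Theorem hilbert_basis (K : fieldType) (n : nat) (J : set {mpoly K[n]}) :
  ideal J -> exists r (h : 'I_r -> {mpoly K[n]}), (forall i, J (h i)) /\
    forall f, J f -> exists c : 'I_r -> {mpoly K[n]}, f = \sum_i c i * h i.
Proof.
move=> idJ.
have [s [sL sG]] :=
  dickson [set m | exists f : {mpoly K[n]}, [/\ J f, f != 0 & mlead f = m]].
have ltP (i : 'I_(size s)) : exists f : {mpoly K[n]},
    [/\ J f, f != 0 & mlead f = nth 0%MM s i].
  by apply: sL; exact: mem_nth.
have [h hP] := choice ltP; exists (size s), h; split; first by move=> i; case: (hP i).
pose G := [set f | exists c : 'I_(size s) -> {mpoly K[n]}, f = \sum_i c i * h i].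
have idG : ideal G := ideal_ext h.
suff main m : forall f, J f -> f != 0 -> mlead f = m -> G f.
  move=> f Jf; have [->|f0] := eqVneq f 0; first exact: (idl0 idG).
  exact: main (mlead f) f Jf f0 (erefl _).
elim/(@ltmwf n): m => m IH f Jf f0 lf.
have [m' /(nthP 0%MM)[i si <-] lem] : exists2 m', m' \in s & (m' <= m)%MM.
  by apply: sG; exists f.
pose i' := Ordinal si; have [Jh h0 lh] := hP i'.
pose c := mleadc f / mleadc (h i').
have c0 : c != 0 by rewrite mulf_neq0 ?invr_eq0 ?mleadc_eq0.
pose t := c *: 'X_[m - nth 0%MM s i] * h i'.
have Gt : G t by apply: (idlMl idG); exact: ideal_ext_gen.
have t0 : t != 0.
  by rewrite mulf_neq0 // -mleadc_eq0 mleadcZE mleadXm mcoeffX eqxx mulr1.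
have lt : mlead t = m.
  rewrite mleadM //; last by rewrite -mleadc_eq0 mleadcZE mleadXm mcoeffX eqxx mulr1.
  by rewrite mleadZ // mleadXm lh submK.
have lct : t@_m = mleadc f.
  have -> : m = (mlead (c *: 'X_[K, m - nth 0%MM s i]) + mlead (h i'))%MM.
    by rewrite mleadZ // mleadXm lh submK.
  rewrite mleadcM mleadcZE mleadXm mcoeffX eqxx mulr1.
  by rewrite divfK // mleadc_eq0.
rewrite -(subrK t f); apply: (idlD idG) => //.
have [->|ft0] := eqVneq (f - t) 0; first exact: (idl0 idG).
have Jft : J (f - t) by apply: (idlB idJ) => //; exact: (idlMl idJ).
apply: (IH (mlead (f - t))) => //.
have := mleadB_le f t; rewrite lf lt joinxx le_eqVlt => /predU1P[lft|//].
by move: ft0; rewrite -mleadc_eq0 lft mcoeffB lct lf subrr eqxx.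
Qed.

(** * The Nullstellensatz over an uncountable field *)

Section Nullstellensatz.
Variable K : closedFieldType.
Hypothesis uncountableK : ~ countable [set: K].
Variable n : nat.
Implicit Types (f h : {mpoly K[n]}).

Lemma mpoly_congr_eval (M : set {mpoly K[n]}) (x : 'rV[K]_n) f : ideal M ->
  (forall i, M ('X_i - (x 0 i)%:MP)) -> M (f - (f.@[x 0])%:MP).
Proof.
move=> idM Mx; rewrite -{1}(mmap_id f).
have -> : (f.@[x 0])%:MP = mmap (@mpolyC n K) (fun i => (x 0 i)%:MP) f.
  by rewrite /meval; apply: rmorph_mmap.
exact: mmap_congr.
Qed.

Section Maximal.
Variables (I : set {mpoly K[n]}) (h : {mpoly K[n]}).
Hypotheses (idI : ideal I) (nIh : forall k, ~ I (h ^+ k)).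

Lemma exists_maximal_avoiding :
  exists M : set {mpoly K[n]}, [/\ ideal M, I `<=` M, forall k, ~ M (h ^+ k)
    & forall x, ~ M x -> exists k u, M (h ^+ k - u * x)].
Proof.
pose Q (J : set {mpoly K[n]}) := ideal J /\ forall k, ~ J (h ^+ k).
(* Zorn's lemma is applied to the sets whose union with [I] has the property, so that the empty
   chain, whose union is empty, is covered by [I] itself. *)
have [F FQ totF|A [[idA nA] maxA]] := @Zorn_bigcup _ [set X | Q (X `|` I)].
  have idF X : F X -> ideal (X `|` I) by case/FQ.
  split; last first.
    by move=> k [[X FX Xh]|]; [case: (FQ _ FX) => _ /(_ k); apply; left|exact: nIh].
  split; first by right; exact: (idl0 idI).
  - move=> x y [[X FX Xx]|Ix] [[Y FY Yy]|Iy].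
    + wlog XY : X Y FX FY x y Xx Yy / X `<=` Y => [W|].
        have [XY|YX] := totF X Y FX FY; first exact: (W X Y).
        by rewrite addrC; exact: (W Y X).
      have [] := idlD (idF _ FY) (or_introl (XY _ Xx)) (or_introl Yy); [by left; exists Y|by right].
    + have [] := idlD (idF _ FX) (or_introl Xx) (or_intror Iy); [by left; exists X|by right].
    + have [] := idlD (idF _ FY) (or_intror Ix) (or_introl Yy); [by left; exists Y|by right].
    + by right; exact: (idlD idI).
  - move=> a x [[X FX Xx]|Ix]; last by right; exact: (idlMl idI).
    have [] := idlMl (idF _ FX) a (or_introl Xx); [by left; exists X|by right].
exists (A `|` I); split; [exact: idA|by move=> x Ix; right|exact: nA|move=> x nx].
apply: contrapT => /forallNP nk.
pose J := [set z | exists u, (A `|` I) (z - u * x)].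
have subJ : A `|` I `<=` J by move=> z Az; exists 0; rewrite mul0r subr0.
have idJ : ideal J.
  split; first by exists 0; rewrite mul0r subr0; exact: (idl0 idA).
  - move=> y z [u Ay] [v Az]; exists (u + v).
    by rewrite mulrDl opprD addrACA; exact: (idlD idA).
  - by move=> a y [u Ay]; exists (a * u); rewrite -mulrA -mulrBr; exact: (idlMl idA).
have AJ : A `<` J.
  split; first by move=> z Az; apply: subJ; left.
  move=> JA; apply: nx; left; apply: JA; exists 1.
  by rewrite mul1r subrr; exact: (idl0 idA).
apply: (maxA _ AJ); change (Q (J `|` I)); suff -> : J `|` I = J.
  by split=> // k [u Au]; case: (nk k); exists u.
by apply/setUidPl => z Iz; apply: subJ; right.
Qed.

End Maximal.

Section MaximalIsPoint.
Variables (M : set {mpoly K[n]}) (h : {mpoly K[n]}).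
Hypotheses (idM : ideal M) (nMh : forall k, ~ M (h ^+ k)).
Hypothesis maxM : forall x, ~ M x -> exists k u, M (h ^+ k - u * x).

Let prM : prime_ideal M.
Proof.
split => // [M1|x y Mxy]; first by apply: (nMh (k := 0)); rewrite expr0.
apply: contrapT => /not_orP[nx ny].
have [k [u Mu]] := maxM nx; have [l [v Mv]] := maxM ny.
apply: (nMh (k := k + l)); rewrite exprD.
apply: (idl_subr idM (idlM_congr idM Mu Mv)).
by rewrite mulrACA; exact: (idlMl idM).
Qed.

Let const_notin (c : K) : c != 0 -> ~ M c%:MP.
Proof.
move=> c0 Mc; case: prM => _ + _; apply.
have -> : 1 = (c^-1)%:MP * c%:MP :> {mpoly K[n]} by rewrite -mpolyCM mulVf.
exact: (idlMl idM).
Qed.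

(* Otherwise the uncountably many 1/(X_i - a), a in K, are all of the form u/h^k
   modulo M; infinitely many of them share k and a bound on deg u, so they are
   linearly dependent, and X_i is algebraic modulo M. *)
Lemma maximal_coordinate i : exists a : K, M ('X_i - a%:MP).
Proof.
apply: contrapT => /forallNP nM.
have inv a : exists ku : nat * {mpoly K[n]}, M (h ^+ ku.1 - ku.2 * ('X_i - a%:MP)).
  by have [k [u Mu]] := maxM (@nM a); exists (k, u).
have [ku kuP] := choice inv.
pose S (kd : nat * nat) := [set a : K | (ku a).1 = kd.1 /\ msize (ku a).2 = kd.2].
have [[k d] infS] : exists kd, infinite_set (S kd).
  apply: contrapT => /forallNP finS; apply: uncountableK.
  have -> : [set: K] = \bigcup_(kd in [set: nat * nat]) S kd.
    by apply/seteqP; split=> // a _; exists ((ku a).1, msize (ku a).2).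
  apply: bigcup_countable; first exact: countableP.
  by move=> kd _; apply: finite_set_countable; apply: contrapT; exact: finS.
(* There are [r] monomials of degree less than [d], so the [r.+1] numerators attached to distinct
   points of [S (k, d)] are linearly dependent. *)
pose r := #|{: 'X_{1..n < d}}|.
have [B BS Br] := infinite_set_fset r.+1 infS.
pose a (j : 'I_r.+1) := nth 0 (finmap.enum_fset B) j.
have ltB (j : 'I_r.+1) : (j < size (finmap.enum_fset B))%N.
  by apply: leq_trans (ltn_ord j) _.
have aS j : S (k, d) (a j) by apply: BS => /=; exact: mem_nth.
have a_inj j l : j != l -> a j - a l != 0.
  by rewrite subr_eq0 nth_uniq ?finmap.fset_uniq // => ->.
pose C : 'M[K]_(r.+1, r) := \matrix_(j, m)
  ((ku (a j)).2)@_(bmnm (enum_val (m : 'I_#|{: 'X_{1..n < d}}|))).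
have [c cC c0] : exists2 c : 'rV[K]_r.+1, c *m C = 0 & c != 0.
  have /rowV0Pn[c /sub_kermxP cC c0] : kermx C != 0; last by exists c.
  by rewrite -mxrank_eq0 mxrank_ker -lt0n subn_gt0 ltnS rank_leq_col.
have sum0 : \sum_j c 0 j *: (ku (a j)).2 = 0.
  apply/mpolyP => m; rewrite mcoeff0 linear_sum /=.
  have [ltm|gem] := ltnP (mdeg m) d.
    have /rowP/(_ (enum_rank (BMultinom ltm))) := cC; rewrite !mxE.
    by move=> H; rewrite -[RHS]H; apply: eq_bigr => j _; rewrite mxE enum_rankK mcoeffZ.
  apply: big1 => j _; rewrite mcoeffZ memN_msupp_eq0 ?mulr0 //.
  apply/negP => /msize_mdeg_lt; case: (aS j) => _ /= ->.
  by rewrite ltnNge gem.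
pose P : {poly K} := \sum_j c 0 j *: \prod_(l | l != j) ('X - (a l)%:P).
have P0 : P != 0.
  have /rV0Pn[j cj] := c0; apply/eqP => /(congr1 (horner^~ (a j))).
  rewrite /= horner0 horner_sum (bigD1 j) //= [X in _ + X]big1 => [|l lj].
    rewrite addr0 hornerZ horner_prod => /eqP; rewrite mulf_eq0 (negPf cj) /=.
    apply/negP/prodf_neq0 => l lj; rewrite hornerXsubC.
    by apply: a_inj; rewrite eq_sym.
  rewrite hornerZ horner_prod (bigD1 j) 1?eq_sym //= hornerXsubC subrr.
  by rewrite mul0r mulr0.
pose ev (p : {poly K}) : {mpoly K[n]} := (map_poly (@mpolyC n K) p).['X_i].
have MP : M (ev P).
  apply: (prime_idlMl prM (x := h ^+ k)); first exact: nMh.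
  have -> : h ^+ k * ev P =
      \sum_j c 0 j *: (h ^+ k * \prod_(l | l != j) ('X_i - (a l)%:MP)).
    rewrite /ev rmorph_sum horner_sum mulr_sumr; apply: eq_bigr => j _.
    rewrite -mul_polyC rmorphM /= map_polyC hornerM hornerC rmorph_prod horner_prod.
    rewrite mulrCA mul_mpolyC; congr (_ *: (_ * _)); apply: eq_bigr => l _.
    by rewrite rmorphB /= map_polyX map_polyC !hornerE.
  apply: (idl_subr idM) (idl0 idM); rewrite subr0.
  have -> : \sum_j c 0 j *: (h ^+ k * \prod_(l | l != j) ('X_i - (a l)%:MP)) =
     \sum_j c 0 j *: ((h ^+ k - (ku (a j)).2 * ('X_i - (a j)%:MP)) *
         \prod_(l | l != j) ('X_i - (a l)%:MP)).
    apply/eqP; rewrite -subr_eq0 -sumrB; apply/eqP.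
    transitivity ((\sum_j c 0 j *: (ku (a j)).2) * \prod_l ('X_i - (a l)%:MP) : {mpoly K[n]}).
      rewrite mulr_suml; apply: eq_bigr => j _.
      rewrite -scalerBr mulrBl opprB addrCA subrr addr0 [\prod_l _](bigD1 j) //=.
      by rewrite -scalerAl mulrA.
    by rewrite sum0 mul0r.
  apply: (idl_sum idM) => j _; rewrite -mul_mpolyC; apply: (idlMl idM).
  apply: (idlMr idM); have [/= <- _] := aS j; exact: kuP.
(* [P] splits into linear factors and [M] is prime, so some ['X_i - z] would lie in [M], against
   [nM]. *)
have [rs Prs] := closed_field_poly_normal P.
move: MP; rewrite Prs /ev -mul_polyC rmorphM rmorph_prod hornerM /= map_polyC hornerC.
move/(prime_idlMl prM (const_notin (c := lead_coef P) _)).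
rewrite lead_coef_eq0 => /(_ P0); rewrite horner_prod.
elim: rs {Prs} => [|z rs IHrs]; first by rewrite big_nil; case: prM.
rewrite big_cons => Mz; apply: IHrs; apply: (prime_idlMl prM) Mz.
by rewrite rmorphB /= map_polyX map_polyC !hornerE; exact: nM.
Qed.

End MaximalIsPoint.

(** The strong form needs no extra variable: an ideal maximal among those avoiding the powers of [h]
    is already the ideal of a point, and [h] does not vanish there. *)
Theorem nullstellensatz (I : set {mpoly K[n]}) h : ideal I ->
  (forall k, ~ I (h ^+ k)) ->
  exists x : 'rV[K]_n, (forall f, I f -> f.@[x 0] = 0) /\ h.@[x 0] != 0.
Proof.
move=> idI nIh.
have [M [idM IM nMh maxM]] := exists_maximal_avoiding idI nIh.
have [a aP] := choice (maximal_coordinate idM nMh maxM).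
pose x : 'rV[K]_n := \row_i a i.
have Mx f : M (f - (f.@[x 0])%:MP).
  by apply: mpoly_congr_eval => // i; rewrite mxE.
have M1 : ~ M 1 by rewrite -(expr0 h).
exists x; split=> [f /IM Mf|].
  apply/eqP/negPn/negP => f0; apply: M1.
  have -> : 1 = ((f.@[x 0])^-1)%:MP * (f.@[x 0])%:MP :> {mpoly K[n]}.
    by rewrite -mpolyCM mulVf.
  by apply: (idlMl idM); exact: (idl_subl idM (Mx f)).
apply/eqP => h0; apply: (nMh 1); rewrite expr1.
by apply: (idl_subr idM (Mx h)); rewrite h0 mpolyC0; exact: (idl0 idM).
Qed.

Lemma mpoly_eval_eq0 f : (forall x : 'rV[K]_n, f.@[x 0] = 0) -> f = 0.
Proof.
move=> f0; apply/eqP/negPn/negP => nf.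
have id0 : ideal [set 0 : {mpoly K[n]}].
  split=> // [x y -> ->|a x ->]; first by rewrite addr0.
  by rewrite mulr0.
have [k /eqP|x [_]] := nullstellensatz (h := f) id0.
  by rewrite expf_eq0 (negPf nf) andbF.
by rewrite f0 eqxx.
Qed.

End Nullstellensatz.

(* Cantor's nested intervals: the k-th interval misses the point numbered k. *)
Lemma real_uncountable (R : realType) : ~ countable [set: R].
Proof.
case/countable_injP => g g_inj.
have shrink (k : nat) (ab : R * R) : exists cd : R * R, ab.1 < ab.2 ->
    [/\ cd.1 < cd.2, ab.1 <= cd.1, cd.2 <= ab.2
      & forall x, g x = k -> ~~ (cd.1 <= x <= cd.2)].
  case: ab => a b /=.
  have [[x gx]|nx] := pselect (exists x, g x = k); last first.
    by exists (a, b) => ab; split=> // x gx; case: nx; exists x.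
  have uni y : g y = k -> y = x by rewrite -gx => /g_inj; apply; rewrite inE.
  have [xc|cx] := leP x ((a + a + b) / 3%:R).
    exists ((a + b + b) / 3%:R, b) => /= ab; split; [lra|lra|lra|].
    by move=> y /uni ->; apply/negP => /andP[]; lra.
  exists (a, (a + a + b) / 3%:R) => /= ab; split; [lra|lra|lra|].
  by move=> y /uni ->; apply/negP => /andP[]; lra.
have [h hP] := choice (fun kab : nat * (R * R) => shrink kab.1 kab.2).
pose I := fix F k := if k is j.+1 then h (j, F j) else (0, 1) : R * R.
have Ilt k : (I k).1 < (I k).2.
  by elim: k => [|k IHk] /=; [exact: ltr01|case: (hP (k, I k) IHk)].
have Imon i j : (i <= j)%N -> (I i).1 <= (I j).1 /\ (I j).2 <= (I i).2.
  elim: j => [|j IHj]; first by rewrite leqn0 => /eqP ->.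
  rewrite leq_eqVlt => /predU1P[-> //|/IHj[l r]].
  have [_ /= l' r' _] := hP (j, I j) (Ilt j).
  by split; [exact: le_trans l l'|exact: le_trans r' r].
have Ilr i j : (I i).1 <= (I j).2.
  have [l _] := Imon i (maxn i j) (leq_maxl i j).
  have [_ r] := Imon j (maxn i j) (leq_maxr i j).
  exact: le_trans l (le_trans (ltW (Ilt _)) r).
pose A : set R := range (fun k => (I k).1).
have supA : has_sup A.
  split; first by exists (I 0%N).1, 0%N.
  by exists (I 0%N).2 => _ [k _ <-].
have [_ _ _ /(_ (sup A) erefl)] := hP (g (sup A), I (g (sup A))) (Ilt _).
rewrite -[h _]/(I (g (sup A)).+1) => /negP; apply; apply/andP; split.
  by apply: sup_upper_bound => //; exists (g (sup A)).+1.
by apply: sup_le_ub => [|_ [k _ <-]]; [case: supA|exact: Ilr].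
Qed.

Lemma complex_uncountable (R : realType) : ~ countable [set: R[i]].
Proof.
case/countable_injP => g g_inj; apply: (@real_uncountable R).
apply/countable_injP; exists (fun x => g x%:C%C) => x y _ _ /g_inj.
by rewrite !inE => /(_ Logic.I Logic.I) [].
Qed.

(** * Zariski topology and smooth curves *)

Section LocalAlgebra.
Variables (K : fieldType) (n : nat).
Implicit Types (P I : set {mpoly K[n]}) (p : 'rV[K]_n) (f g s : {mpoly K[n]}).

Lemma meval_det p r (M : 'M[{mpoly K[n]}]_r) :
  (\det M).@[p 0] = \det (\matrix_(i, j) (M i j).@[p 0]).
Proof.
rewrite -(det_map_mx (meval (p 0))); congr (\det _).
by apply/matrixP => i j; rewrite !mxE.
Qed.

(** The hypothesis puts [P] in [I + (s)] near [p]. As [s] is not in the prime [P], the cofactor of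
    [s] is again in [P], so locally [P = I + s P], and Nakayama's lemma gives [P = I]. *)
Lemma nakayama_principal P I p s : prime_ideal P -> ideal I -> I `<=` P -> ~ P s ->
    s.@[p 0] = 0 ->
    (forall f, P f -> exists g e, g.@[p 0] != 0 /\ I (g * f - s * e)) ->
  exists d, d.@[p 0] != 0 /\ forall f, P f -> I (d * f).
Proof.
move=> prP idI IP nPs s0 div.
have idP := prime_ideal_ideal prP.
have [r [h [Ph genP]]] := hilbert_basis idP.
have step i : exists g (b : 'I_r -> {mpoly K[n]}),
    g.@[p 0] != 0 /\ I (g * h i - s * \sum_j b j * h j).
  have [g [e [g0 Ie]]] := div _ (Ph i).
  have /genP[b eb] : P e.
    apply: (prime_idlMl prP) nPs _; apply: (idl_subl idP (IP _ Ie)).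
    exact: (idlMl idP).
  by exists g, b; rewrite -eb.
have [g gP] := choice step; have [b bP] := choice gP.
pose M := \matrix_(i, j) (g i *+ (i == j) - s * b i j).
exists (\det M); split.
  rewrite meval_det (_ : matrix_of_fun _ _ = diag_mx (\row_i (g i).@[p 0])).
    by rewrite det_diag; apply/prodf_neq0 => i _; rewrite mxE; case: (bP i).
  apply/matrixP => i j; rewrite !mxE mevalB mevalM s0 mul0r subr0 mevalMn.
  by [].
move=> f /genP[c ->]; rewrite mulr_sumr; apply: (idl_sum idI) => i _.
rewrite mulrCA; apply: (idlMl idI).
apply: (@det_trick _ _ idfun I r M h) => [|x y|a x|{}i].
- exact: (idl0 idI).
- exact: (idlD idI).
- exact: (idlMl idI).
have [_] := bP i; congr (I _).
transitivity (\sum_j (g i *+ (i == j)) * h j - s * \sum_j b i j * h j).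
  congr (_ - _); rewrite (bigD1 i) //= eqxx mulr1n big1 ?addr0 // => j.
  by rewrite eq_sym => /negPf ->; rewrite mulr0n mul0r.
rewrite mulr_sumr -sumrB; apply: eq_bigr => j _.
by rewrite mxE mulrBl mulrA.
Qed.

Lemma mpoly_vanish_at p f : f.@[p 0] = 0 ->
  exists u : 'I_n -> {mpoly K[n]}, f = \sum_i u i * ('X_i - (p 0 i)%:MP).
Proof.
move=> f0; pose h i : {mpoly K[n]} := 'X_i - (p 0 i)%:MP.
have idh := ideal_ext h.
have := mmap_congr (@mpolyC n K) (h := fun i => 'X_i) (h' := fun i => (p 0 i)%:MP) f idh.
rewrite mmap_id -(rmorph_mmap (f := idfun) (g := @mpolyC n K) (h := p 0)) //.
rewrite -/(meval _ _) f0 rmorph0 subr0; apply=> i.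
exact: ideal_ext_gen.
Qed.

End LocalAlgebra.

Section ZariskiBasics.
Variables (K : closedFieldType) (n : nat).
Implicit Types (X Y : set 'rV[K]_n) (p x : 'rV[K]_n) (f g s d : {mpoly K[n]})
  (q : set {mpoly K[n]}).

Lemma vanishing_ideal_ideal X : ideal (vanishing_ideal X).
Proof.
split=> [x _|f g If Ig x Xx|f g Ig x Xx]; first by rewrite meval0.
  by rewrite mevalD If // Ig // addr0.
by rewrite mevalM Ig // mulr0.
Qed.

Lemma vanishing_ideal_anti X Y : X `<=` Y -> vanishing_ideal Y `<=` vanishing_ideal X.
Proof. by move=> XY f If x /XY; exact: If. Qed.

Lemma irreducible_vanishing_prime X : irreducible X -> prime_ideal (vanishing_ideal X).
Proof.
case=> -[x Xx] irrX; split; first exact: vanishing_ideal_ideal.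
  by move/(_ x Xx); rewrite meval1 => /eqP; rewrite oner_eq0.
move=> f g Ifg; have [||y Xy|fX|gX] := irrX (zero_locus [set f]) (zero_locus [set g]).
- by exists [set f].
- by exists [set g].
- have /eqP := Ifg y Xy; rewrite mevalM mulf_eq0 => /orP[]/eqP e.
    by left=> _ ->.
  by right=> _ ->.
- by left=> y /fX; apply.
- by right=> y /gX; apply.
Qed.

Lemma prime_vanishing_irreducible X : prime_ideal (vanishing_ideal X) -> irreducible X.
Proof.
case=> _ n1 prX; split.
  apply/set0P/eqP => X0; apply: n1 => x; by rewrite X0.
move=> _ _ [F1 ->] [F2 ->] X12; apply: contrapT => /not_orP[].
move=> /existsNP[x /not_implyP[Xx /existsNP[f /not_implyP[Ff fx]]]].
move=> /existsNP[y /not_implyP[Xy /existsNP[g /not_implyP[Gg gy]]]].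
have [|/(_ x Xx)//|/(_ y Xy)//] := prX f g.
by move=> z /X12[H|H]; rewrite mevalM; [rewrite (H f) ?mul0r|rewrite (H g) ?mulr0].
Qed.

Lemma zariski_open_basic g : zariski_open [set x : 'rV[K]_n | g.@[x 0] != 0].
Proof.
exists [set g]; apply/seteqP; split=> x /=; first by move/negP; rewrite negbK => /eqP gx _ ->.
by move=> H; apply/negP; rewrite negbK H.
Qed.

Lemma zariski_closedT : zariski_closed [set: 'rV[K]_n].
Proof. by exists set0; apply/seteqP; split=> // x _ f []. Qed.

Lemma zariski_closed1 p : zariski_closed [set p].
Proof.
exists [set f | f.@[p 0] = 0]; apply/seteqP; split=> [_ -> f //|x H].
apply/rowP => i; apply/eqP; rewrite -subr_eq0; apply/eqP.
have <- : ('X_i - (p 0 i)%:MP).@[x 0] = 0.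
  by apply: H; rewrite /= mevalB mevalXU mevalC subrr.
by rewrite mevalB mevalXU mevalC.
Qed.

Lemma zariski_openI_basic (U : set 'rV[K]_n) g : zariski_open U ->
  zariski_open (U `&` [set x | g.@[x 0] != 0]).
Proof.
case=> F UF; exists [set fg | exists2 f, F f & fg = f * g].
have inU x : U x <-> ~ zero_locus F x by rewrite -UF; split=> [Ux /(_ Ux)|/contrapT].
apply/seteqP; split=> [x nx _ [f Ff ->]|x H [/inU Ux gx]].
  rewrite mevalM; have [->|g0] := eqVneq (g.@[x 0]) 0; first by rewrite mulr0.
  have : ~ U x by move=> Ux; apply: nx.
  by rewrite inU => /contrapT ->; rewrite ?mul0r.
apply: Ux => f Ff; have /eqP := H (f * g) (ex_intro2 _ _ f Ff erefl).
by rewrite mevalM mulf_eq0 (negPf gx) orbF => /eqP.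
Qed.

Lemma linear_dimension_rank r (A : 'M[K]_(r, n)) (k : nat) :
  \rank A = k -> has_linear_dimension [set v | (v <= A)%MS] k.
Proof.
move=> <-; exists (row_base A); first exact: row_base_free.
by apply/seteqP; split=> v /=; rewrite eq_row_base.
Qed.

(** Dividing the coordinates is enough, since they generate the maximal ideal at [p]. This is how
    [s] is recognized as a uniformizer modulo [I]. *)
Lemma local_division p s (I : set {mpoly K[n]}) : ideal I ->
    (forall i, exists g e, g.@[p 0] != 0 /\ I (g * ('X_i - (p 0 i)%:MP) - s * e)) ->
  forall f, f.@[p 0] = 0 -> exists g e, g.@[p 0] != 0 /\ I (g * f - s * e).
Proof.
move=> idI /choice[g /choice[e H]] f /mpoly_vanish_at[u ->].
exists (\prod_i g i), (\sum_i u i * (\prod_(j | j != i) g j) * e i); split.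
  by rewrite rmorph_prod; apply/prodf_neq0 => i _; case: (H i).
rewrite !mulr_sumr -sumrB; apply: (idl_sum idI) => i _.
have -> : \prod_i0 g i0 * (u i * ('X_i - (p 0 i)%:MP)) -
    s * (u i * \prod_(j | j != i) g j * e i) =
    (u i * \prod_(j | j != i) g j) * (g i * ('X_i - (p 0 i)%:MP) - s * e i).
  by rewrite (bigD1 i) //=; ring.
by apply: (idlMl idI); case: (H i).
Qed.

Hypothesis uncountableK : ~ countable [set: K].

(** Apply the Nullstellensatz to [h * d]: a power of it in the prime [q] forces [h] in [q], so
    removing the zeros of [d] does not enlarge the ideal. *)
Lemma vanishing_ideal_zero_locus q d : prime_ideal q -> ~ q d ->
  vanishing_ideal (zero_locus q `&` [set x | d.@[x 0] != 0]) = q.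
Proof.
move=> prq nqd; apply/seteqP; split=> [h Ih|h qh x [+ _]]; last by apply.
apply: contrapT => nqh.
have [k qk|x [qx]] := nullstellensatz uncountableK (h := h * d) (prime_ideal_ideal prq).
  have [_ _ pr] := prq; have /pr[] := prime_idlX prq qk => //.
rewrite mevalM mulf_eq0 negb_or => /andP[hx dx]; case/eqP: hx.
by apply: Ih.
Qed.

(** At a point of [Z 0], the ideal of [Z 1] cannot contain the uniformizer, for it would then
    contain the ideal of [Z 0]. By Nakayama's lemma it is equal to [q] near that point, hence
    contained in the ideal of [Z 2]. *)
Lemma no_long_chain q X : prime_ideal q -> vanishing_ideal X = q ->
    (forall p, X p -> exists s, s.@[p 0] = 0 /\ forall f, f.@[p 0] = 0 ->
       exists g e, g.@[p 0] != 0 /\ q (g * f - s * e)) ->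
  ~ irreducible_chain X 2.
Proof.
move=> prq IX unif [Z [Zirr Zlt]].
have ZX i : (i <= 2)%N -> Z i `<=` X by case/Zirr => _ [W _ ->] x [].
pose P i := vanishing_ideal (Z i).
have ZP i : (i < 2)%N -> exists2 f, P i f & ~ P i.+1 f.
  move=> i2; have [_ [_ [F ->] ZF]] := Zirr i (ltnW i2).
  have [_ /existsNP[x /not_implyP[Zx nZx]]] := Zlt i i2.
  have Xx := ZX _ i2 _ Zx.
  have : ~ zero_locus F x by move=> Fx; apply: nZx; rewrite ZF.
  move/existsNP => [f /not_implyP[Ff fx]]; exists f => [y|]; first by rewrite ZF => -[_]; apply.
  by move/(_ x Zx).
have [[p Zp] _] := (Zirr 0 isT).1.
have Z01 := (Zlt 0 isT).1; have Z12 := (Zlt 1 isT).1.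
have pX : X p by apply: (ZX 2) => //; apply: Z12; exact: Z01.
have [s [s0 div]] := unif p pX.
have [f Pf nPf] := ZP 0 isT; have [h Ph nPh] := ZP 1 isT.
have prP : prime_ideal (P 1) by apply: irreducible_vanishing_prime; exact: (Zirr 1 isT).1.
have idP := prime_ideal_ideal prP.
have qP : q `<=` P 1 by rewrite -IX; apply: vanishing_ideal_anti; exact: ZX.
have P1p g : P 1 g -> g.@[p 0] = 0 by apply; exact: Z01.
have nPs : ~ P 1 s.
  move=> Ps; apply: nPf; have [g [e [g0 qge]]] := div f (Pf p Zp).
  apply: (prime_idlMl prP (x := g)); first by move/P1p/eqP; rewrite (negPf g0).
  by apply: (idl_subr idP (qP _ qge)); exact: (idlMr idP).
have [d [d0 dP]] := nakayama_principal prP (prime_ideal_ideal prq) qP nPs s0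
  (fun g Pg => div g (P1p g Pg)).
apply: nPh; have qh : q h.
  apply: (prime_idlMl prq) (dP h Ph).
  by rewrite -IX => /(_ p pX) /eqP; rewrite (negPf d0).
by move: qh; rewrite -IX; apply: vanishing_ideal_anti; exact: ZX.
Qed.

End ZariskiBasics.

Lemma mderivU (R : nzRingType) n (i k : 'I_n) :
  ('X_i : {mpoly R[n]})^`M(k) = (i == k)%:R.
Proof.
rewrite mderivX mnm1E; case: eqVneq => [->|_]; last by rewrite scale0r.
have -> : (U_(k) - U_(k))%MM = 0%MM :> 'X_{1..n}.
  by apply/mnmP => j; rewrite mnmBE subnn mnm0E.
by rewrite mpolyX0 scale1r.
Qed.

Lemma mderiv_sum (R : nzRingType) n (k : 'I_n) I (r : seq I) (P : pred I)
    (F : I -> {mpoly R[n]}) :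
  (\sum_(i <- r | P i) F i)^`M(k) = \sum_(i <- r | P i) (F i)^`M(k).
Proof. exact: linear_sum. Qed.

Lemma meval_sum (R : comNzRingType) n (v : 'I_n -> R) I (r : seq I) (P : pred I)
    (F : I -> {mpoly R[n]}) :
  (\sum_(i <- r | P i) F i).@[v] = \sum_(i <- r | P i) (F i).@[v].
Proof. exact: rmorph_sum. Qed.

(** * Smooth curves from a coordinate that is a local parameter *)

Section SmoothCurve.
Variables (K : closedFieldType) (n : nat).
Hypothesis uncountableK : ~ countable [set: K].
Variables (q : set {mpoly K[n.+1]}) (i0 : 'I_n.+1).
Hypotheses (prq : prime_ideal q) (nqX : ~ q 'X_i0).
Hypothesis q0 : forall f, q f -> f.@[(0 : 'rV[K]_n.+1) 0] = 0.
Let o : 'rV[K]_n.+1 := 0.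
Variables g e : 'I_n.+1 -> {mpoly K[n.+1]}.
Hypotheses (g0 : forall i, (g i).@[o 0] != 0)
  (qge : forall i, q (g i * 'X_i - 'X_i0 * e i)).

Let idq := prime_ideal_ideal prq.

(** The [E j] generate [q] near the origin ([sup]), and [Jac] is their Jacobian determinant in the
    coordinates other than [i0], a diagonal one at the origin. The curve is smooth where [Jac] and
    the multiplier of [sup] do not vanish. *)
Let E (j : 'I_n) := g (lift i0 j) * 'X_(lift i0 j) - 'X_i0 * e (lift i0 j).
Let Jac := \det (\matrix_(j < n, k < n) (E j)^`M(lift i0 k)).
Let IE := [set f | exists c : 'I_n -> {mpoly K[n.+1]}, f = \sum_j c j * E j].

Let idIE : ideal IE := ideal_ext E.

Let IEq : IE `<=` q.
Proof. by move=> _ [c ->]; apply: (idl_sum idq) => j _; apply: (idlMl idq); exact: qge. Qed.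

Let oE i : o 0 i = 0. Proof. by rewrite mxE. Qed.

Let Jac0 : Jac.@[o 0] != 0.
Proof.
rewrite meval_det (_ : matrix_of_fun _ _ = diag_mx (\row_j (g (lift i0 j)).@[o 0])).
  by rewrite det_diag; apply/prodf_neq0 => j _; rewrite mxE.
apply/matrixP => j k; rewrite !mxE mderivB !mderivM !mderivU !mevalB !mevalD !mevalM.
rewrite !mevalXU !oE !mulr0 !mul0r (negPf (neq_lift _ _)) meval0 add0r mul0r addr0 subr0.
by rewrite (inj_eq lift_inj); case: eqP => _; rewrite ?meval1 ?meval0 ?mulr1 ?mulr0.
Qed.

Let divE f : f.@[o 0] = 0 -> exists g e, g.@[o 0] != 0 /\ IE (g * f - 'X_i0 * e).
Proof.
apply: (local_division idIE) => i; rewrite oE mpolyC0 subr0.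
case: (unliftP i0 i) => [j|] ->.
  by exists (g (lift i0 j)), (e (lift i0 j)); split=> //; exact: ideal_ext_gen.
exists 1, 1; rewrite meval1 oner_neq0 mul1r mulr1 subrr; split=> //.
exact: (idl0 idIE).
Qed.

Let sup : exists d, d.@[o 0] != 0 /\ forall f, q f -> IE (d * f).
Proof.
apply: (nakayama_principal prq idIE IEq nqX); first by rewrite mevalXU oE.
by move=> f /q0/divE.
Qed.

Let Psi d := zero_locus q `&` [set x : 'rV[K]_n.+1 | (d * Jac).@[x 0] != 0].

Let E_vanish d x j : Psi d x -> (E j).@[x 0] = 0.
Proof. by case=> + _; apply; exact: qge. Qed.

(** Expand each [E k] at [p] in the differences X_i - p_i. The coefficients with [i] other than [i0]
    form a matrix whose determinant at [p] is the value of [Jac], so Cramer's rule expresses each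
    difference through the one of index [i0]. *)
Let uniformizer d p : Psi d p -> exists s, s.@[p 0] = 0 /\
  forall f, f.@[p 0] = 0 -> exists g e, g.@[p 0] != 0 /\ q (g * f - s * e).
Proof.
move=> Psip; pose s : {mpoly K[n.+1]} := 'X_i0 - (p 0 i0)%:MP.
have s0 : s.@[p 0] = 0 by rewrite mevalB mevalXU mevalC subrr.
exists s; split=> //; apply: (local_division idq) => i.
case: (unliftP i0 i) => [j|] ->; last first.
  exists 1, 1; rewrite meval1 oner_neq0 mul1r mulr1 subrr; split=> //.
  exact: (idl0 idq).
have [u uP] := choice (fun k => mpoly_vanish_at (E_vanish k Psip)).
pose w k : {mpoly K[n.+1]} := 'X_(lift i0 k) - (p 0 (lift i0 k))%:MP.
pose M := \matrix_(k, l) u k (lift i0 l).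
have detM : (\det M).@[p 0] != 0.
  have [_] := Psip; rewrite /= mevalM mulf_eq0 negb_or => /andP[_].
  rewrite !meval_det; congr (\det _ != 0); apply/matrixP => k l; rewrite !mxE.
  rewrite (uP k) mderiv_sum (bigD1 (lift i0 l)) // mevalD.
  rewrite mderivM mderivB mderivU mderivC eqxx subr0 mulr1 mevalD mevalM.
  rewrite mevalB mevalXU mevalC subrr mulr0 add0r meval_sum big1 ?addr0 // => i1 ne.
  rewrite mderivM mderivB mderivU mderivC (negPf ne) subr0 mulr0 addr0 mevalM.
  by rewrite mevalB mevalXU mevalC subrr mulr0.
pose P := [set f | exists e', q (f - s * e')].
suff [e' qe'] : P (\det M * w j) by exists (\det M), e'.
apply: (@det_trick _ _ idfun P n M w).
- by exists 0; rewrite mulr0 subrr; exact: (idl0 idq).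
- move=> x y [e1 q1] [e2 q2]; exists (e1 + e2).
  by rewrite mulrDr opprD addrACA; exact: (idlD idq).
- move=> a x [e1 q1]; exists (a * e1).
  by rewrite mulrCA -mulrBr; exact: (idlMl idq).
- move=> k; exists (- u k i0).
  have -> : \sum_l idfun (M k l) * w l - s * - u k i0 = E k; last exact: qge.
  rewrite (uP k) (bigD1_ord i0) //= addrC mulrN opprK mulrC; congr (_ + _).
  by apply: eq_bigr => l _; rewrite mxE.
Qed.

Theorem smooth_curve : exists d, d.@[o 0] != 0 /\
  let X := zero_locus q `&` [set x : 'rV[K]_n.+1 | d.@[x 0] != 0] in
  [/\ smooth_variety X 1, vanishing_ideal X = q & X o].
Proof.
have [d [d0 dq]] := sup.
have dJ0 : (d * Jac).@[o 0] != 0 by rewrite mevalM (mulf_neq0 d0 Jac0).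
exists (d * Jac); split=> //; rewrite -/(Psi d).
have nqd : ~ q (d * Jac) by move/q0/eqP; rewrite (negPf dJ0).
have IX : vanishing_ideal (Psi d) = q by exact: vanishing_ideal_zero_locus.
have Xo : Psi d o by split=> // f /q0.
have irrX : irreducible (Psi d) by apply: prime_vanishing_irreducible; rewrite IX.
split=> //; split => //.
- exists (zero_locus q), [set x : 'rV[K]_n.+1 | (d * Jac).@[x 0] != 0]; split=> //.
    by exists q.
  exact: zariski_open_basic.
- split; last by apply: (no_long_chain prq IX); exact: uniformizer.
  exists (fun i => if i is 0%N then [set o] else Psi d); split.
    case=> [|[|//]] _; split=> //.
    + split; first by exists o.
      by move=> Z1 Z2 _ _ /(_ o erefl)[H|H]; [left|right] => _ ->.
    + exists [set o]; first exact: zariski_closed1.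
      by apply/seteqP; split=> [_ ->|x [_ ->]].
    + by exists [set: 'rV[K]_n.+1]; [exact: zariski_closedT|rewrite setIT].
  case=> [|//] _; split; first by move=> _ ->.
  move=> sub; apply: nqX; rewrite -IX => x /sub ->.
  by rewrite mevalXU oE.
- move=> p Xp; pose A := \matrix_(j < n, i < n.+1) ((E j)^`M(i)).@[p 0].
  (* The tangent space is the kernel of the Jacobian matrix: for [f] in [q], [d * f] is a
     combination of the [E j], and at [p] both [f] and the [E j] vanish, so only their derivatives
     survive the product rule. *)
  have -> : tangent_space (Psi d) p = [set v | (v <= kermx A^T)%MS].
    apply/seteqP; split=> v /=.
      move=> Tv; apply/sub_kermxP/rowP => j; rewrite !mxE.
      rewrite -[RHS](Tv (E j)); last by rewrite IX; exact: qge.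
      by apply: eq_bigr => i _; rewrite !mxE mulrC.
    move=> /sub_kermxP vA f; rewrite IX => qf.
    have [c dfc] := dq f qf.
    have dp : d.@[p 0] != 0.
      by have [_] := Xp; rewrite /= mevalM mulf_eq0 negb_or => /andP[].
    have fp : f.@[p 0] = 0 by case: Xp => + _; apply.
    apply: (mulfI dp); rewrite mulr0 mulr_sumr.
    transitivity (\sum_i \sum_j (c j).@[p 0] * ((E j)^`M(i)).@[p 0] * v 0 i).
      apply: eq_bigr => i _; rewrite -mulr_suml mulrA; congr (_ * _).
      have := congr1 (fun h => (h^`M(i)).@[p 0]) dfc => /=.
      rewrite mderivM mevalD !mevalM fp mulr0 add0r => ->.
      rewrite mderiv_sum meval_sum; apply: eq_bigr => j _.
      by rewrite mderivM mevalD !mevalM (E_vanish j Xp) mulr0 add0r.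
    rewrite exchange_big big1 //= => j _.
    have /rowP/(_ j) := vA; rewrite !mxE => vAj.
    transitivity ((c j).@[p 0] * \sum_i v 0 i * A^T i j); last by rewrite vAj mulr0.
    rewrite mulr_sumr; apply: eq_bigr => i _.
    by rewrite !mxE mulrAC mulrA.
  apply: linear_dimension_rank; rewrite mxrank_ker mxrank_tr.
  suff -> : \rank A = n by rewrite subSnn.
  apply/eqP; rewrite eqn_leq rank_leq_row /=.
  (* [S] drops the column [i0], so the determinant of [A *m S] is the value of [Jac] at [p]. *)
  pose S : 'M[K]_(n.+1, n) := \matrix_(i, k) (i == lift i0 k)%:R.
  have AS : A *m S \in unitmx.
    rewrite unitmxE unitfE.
    have [_] := Xp; rewrite /= mevalM mulf_eq0 negb_or => /andP[_].
    rewrite meval_det; congr (\det _ != 0); apply/matrixP => j k; rewrite !mxE.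
    rewrite (bigD1 (lift i0 k)) //= !mxE eqxx mulr1 big1 ?addr0 // => i.
    by move/negPf => ne; rewrite !mxE ne mulr0.
  by rewrite -{1}(mxrank_unit AS) mxrankM_maxl.
Qed.

End SmoothCurve.

(** * Equations of Lambda at the origin *)

(** Take [A] of maximal rank among the matrices with rows in [L]: adding a vector of [L] cannot
    raise the rank, so it lies in the row space. *)
Lemma linear_set_rowspace (K : fieldType) (n : nat) (L : set 'rV[K]_n) :
    L 0 -> (forall a u v, L u -> L v -> L (a *: u + v)) ->
  exists A : 'M[K]_n, forall v, L v <-> (v <= A)%MS.
Proof.
move=> L0 Llin.
have sub_span r (A : 'M[K]_(r, n)) v : (forall i, L (row i A)) -> (v <= A)%MS -> L v.
  move=> LA /submxP[c ->]; rewrite mulmx_sum_row; apply: (big_ind L) => //.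
    by move=> u w Lu Lw; rewrite -(scale1r u); exact: Llin.
  by move=> i _; rewrite -[_ *: _]addr0; exact: Llin.
pose Q k := `[< exists A : 'M[K]_n, (forall i, L (row i A)) /\ \rank A = k >].
have exQ : exists k, Q k.
  exists 0%N; apply/asboolP; exists 0; split=> [i|]; last exact: mxrank0.
  by rewrite row0.
have ubQ k : Q k -> (k <= n)%N by case/asboolP => A [_ <-]; exact: rank_leq_row.
case: (ex_maxnP exQ ubQ) => k /asboolP[A [LA rA]] maxk; exists A => v; split.
  move=> Lv; have : (\rank (A + v)%MS <= \rank A)%N.
    rewrite rA; apply: maxk; apply/asboolP; exists (A + v)%MS; split=> // i.
    have /sub_addsmxP[[c d] /= ->] : (row i (A + v)%MS <= A + v)%MS by exact: row_sub.
    rewrite -(scale1r (c *m A)); apply: (Llin 1).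
      by apply: (sub_span _ A) => //; exact: submxMl.
    by rewrite [d]mx11_scalar mul_scalar_mx -[_ *: _]addr0; exact: Llin.
  have [le eqr] := mxrank_leqif_sup (addsmxSl A v).
  move=> ge; have : \rank A == \rank (A + v)%MS by rewrite eqn_leq le ge.
  by rewrite eqr; apply: submx_trans; exact: addsmxSr.
exact: sub_span.
Qed.

Section TangentEquations.
Variables (K : closedFieldType) (a b : nat).
Hypothesis uncountableK : ~ countable [set: K].
Notation N := (a + b.+1)%N.
Implicit Types (v : 'rV[K]_N) (f : {mpoly K[N]}).

Definition coordinate_plane : set 'rV[K]_N := [set v | forall j, v 0 (rshift a j) = 0].

(** Setting the last coordinates to 0 turns [f] into a polynomial that vanishes everywhere, and [f]
    is congruent to it modulo these coordinates. *)
Lemma vanishing_coordinate_plane f : vanishing_ideal coordinate_plane f ->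
  exists C : 'I_b.+1 -> {mpoly K[N]}, f = \sum_j C j * 'X_(rshift a j).
Proof.
move=> If; pose h (i : 'I_N) : {mpoly K[N]} := if fintype.split i is inl _ then 'X_i else 0.
have f0 : mmap (@mpolyC N K) h f = 0.
  apply: (mpoly_eval_eq0 uncountableK) => x.
  pose y : 'rV[K]_N := \row_i (if fintype.split i is inl _ then x 0 i else 0).
  rewrite (rmorph_mmap (g := meval (x 0)) (f' := idfun) (h' := y 0)).
  - apply: (If y) => j; rewrite mxE; case: splitP => // k /= e.
    by have := ltn_ord k; rewrite -e ltnNge leq_addr.
  - by move=> c; exact: mevalC.
  - by move=> i; rewrite /h mxE; case: splitP => _ _; [exact: mevalXU|exact: meval0].
have := mmap_congr (@mpolyC N K) (h := fun i => 'X_i) (h' := h) f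
  (ideal_ext (fun j : 'I_b.+1 => ('X_(rshift a j) : {mpoly K[N]}))).
rewrite mmap_id f0 subr0; apply=> i; rewrite /h; case: splitP => k ik.
  by exists (fun=> 0); rewrite subrr big1 // => j _; rewrite mul0r.
rewrite subr0 (_ : i = rshift a k); last exact: val_inj.
exact: (ideal_ext_gen (fun j : 'I_b.+1 => ('X_(rshift a j) : {mpoly K[N]}))).
Qed.

Variable Lam : set 'rV[K]_N.
Hypothesis plane_Lam : coordinate_plane `<=` Lam.
Hypothesis dimT : has_linear_dimension (tangent_space Lam 0) a.+1.
Variable v0 : 'rV[K]_N.
Hypotheses (Tv0 : tangent_space Lam 0 v0) (v0_neq0 : v0 0 (rshift a ord0) != 0).

Let o : 'rV[K]_N := 0.
Let I := vanishing_ideal Lam.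
Let idI : ideal I := vanishing_ideal_ideal Lam.

Let plane_ext f : I f -> exists C : 'I_b.+1 -> {mpoly K[N]},
  f = \sum_j C j * 'X_(rshift a j) /\
  forall j, (f^`M(rshift a j)).@[o 0] = (C j).@[o 0].
Proof.
move=> If; have [|C fE] := @vanishing_coordinate_plane f.
  exact: vanishing_ideal_anti If.
exists C; split=> // j; rewrite fE mderiv_sum meval_sum (bigD1 j) //= big1 ?addr0.
  by rewrite mderivM mderivU eqxx mulr1 mevalD mevalM mevalXU mxE mulr0 add0r.
move=> k kj; rewrite mderivM mderivU mevalD mevalM mevalXU mxE mulr0 add0r.
by rewrite (inj_eq (@rshift_inj _ _)) (negPf kj) mulr0 meval0.
Qed.

Let plane_tangent v : coordinate_plane v -> tangent_space Lam 0 v.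
Proof.
move=> pv f If; have [C [fE _]] := plane_ext If.
apply: big1 => i _; case: (split_ordP i) => k ->; last by rewrite pv mulr0.
rewrite [X in X * _](_ : _ = 0) ?mul0r // fE mderiv_sum meval_sum big1 // => j _.
by rewrite mderivM mderivU mevalD !mevalM mevalXU mxE mulr0 add0r eq_rlshift meval0 mulr0.
Qed.

Let tangent_lin t u v : tangent_space Lam 0 u -> tangent_space Lam 0 v ->
  tangent_space Lam 0 (t *: u + v).
Proof.
move=> Tu Tv f If; transitivity (t * (\sum_i (f^`M(i)).@[o 0] * u 0 i)
   + \sum_i (f^`M(i)).@[o 0] * v 0 i); last by rewrite Tu // Tv // mulr0 addr0.
rewrite mulr_sumr -big_split; apply: eq_bigr => i _ /=.
by rewrite !mxE mulrDr mulrCA.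
Qed.

(** The tangent space has dimension a + 1 and contains both the plane, of dimension a, and [v0],
    which is outside it. So it is their sum, and the last coordinates of its vectors are
    proportional to those of [v0]. *)
Let tangentE v l : tangent_space Lam 0 v ->
  v 0 (rshift a l) = v 0 (rshift a ord0) / v0 0 (rshift a ord0) * v0 0 (rshift a l).
Proof.
move=> Tv; have [B freeB TB] := dimT.
have TBE u : tangent_space Lam 0 u <-> (u <= B)%MS by rewrite TB.
(* [Pi] keeps the coordinates of the plane and the next one. The plane and [v0] already map onto its
   target, so by dimension [Pi] is injective on the tangent space. *)
pose Pi : 'M[K]_(N, a.+1) := \matrix_(i, j) (i == j :> nat)%:R.
have PiE (u : 'rV[K]_N) j : (u *m Pi) 0 j = u 0 (cast_ord (esym (addnS a b)) (lshift b j)).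
  rewrite mxE (bigD1 (cast_ord (esym (addnS a b)) (lshift b j))) //= big1 ?addr0.
    by rewrite mxE eqxx mulr1.
  by move=> i; rewrite mxE -val_eqE => /negPf /= ->; rewrite mulr0.
have plane_part (u : 'rV[K]_N) : exists2 w,
    coordinate_plane w & forall k, w 0 (lshift b.+1 k) = u 0 (lshift b.+1 k).
  exists (\row_i (if fintype.split i is inl _ then u 0 i else 0)) => [j|k]; rewrite mxE.
    by rewrite -[rshift a j]/(unsplit (inr j)) unsplitK.
  by rewrite -[lshift b.+1 k]/(unsplit (inl k)) unsplitK.
have unitBP : B *m Pi \in unitmx.
  rewrite -row_full_unit -sub1mx; apply/row_subP => i; set u := row i _.
  pose t := u 0 ord_max / v0 0 (rshift a ord0).
  pose y : 'rV[K]_N := \row_i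
    (if fintype.split i is inl k then u 0 (widen_ord (leqnSn a) k) else 0).
  have [w pw wE] := plane_part (y - t *: v0).
  have -> : u = (t *: v0 + w) *m Pi.
    apply/rowP => j; rewrite PiE !mxE -/(t); case: (unliftP ord_max j) => [k|] ->.
      rewrite (_ : cast_ord _ _ = lshift b.+1 k); last by apply: val_inj; exact: lift_max.
      rewrite wE !mxE -[lshift b.+1 k]/(unsplit (inl k)) unsplitK addrC subrK.
      by rewrite !mxE; congr (_ == _)%:R; apply: val_inj; exact: lift_max.
    rewrite (_ : cast_ord _ _ = rshift a ord0); last by apply: val_inj; rewrite /= addn0.
    by rewrite pw addr0 divfK // !mxE.
  have /TBE/submxP[c ->] : tangent_space Lam 0 (t *: v0 + w).
    by apply: tangent_lin => //; exact: plane_tangent.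
  by rewrite -mulmxA submxMl.
pose t := v 0 (rshift a ord0) / v0 0 (rshift a ord0).
have [w pw wE] := plane_part (t *: v0 - v).
have zPi : (t *: v0 - v - w) *m Pi = 0.
  apply/rowP => j; rewrite PiE !mxE; case: (unliftP ord_max j) => [k|] ->.
    rewrite (_ : cast_ord _ _ = lshift b.+1 k); last by apply: val_inj; exact: lift_max.
    by rewrite wE !mxE subrr.
  rewrite (_ : cast_ord _ _ = rshift a ord0); last by apply: val_inj; rewrite /= addn0.
  by rewrite pw divfK // subrr subr0.
have /TBE/submxP[c cE] : tangent_space Lam 0 (t *: v0 - v - w).
  rewrite -addrA; apply: tangent_lin => //.
  rewrite -opprD -scaleN1r -[_ *: _]addr0; apply: tangent_lin.
    by rewrite -(scale1r v); apply: tangent_lin => //; exact: plane_tangent.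
  by apply: plane_tangent => j; rewrite mxE.
have c0 : c = 0.
  by rewrite -(mulmxK unitBP c) mulmxA -cE zPi mul0mx.
move: cE; rewrite c0 mul0mx => /rowP/(_ (rshift a l)).
by rewrite !mxE pw subr0 => /subr0_eq <-.
Qed.

(** By [tangentE] some elements of the ideal of [Lam] have linear part beta_l - kappa_l beta_0.
    Containing the plane makes them combinations of the beta_j, and their coefficient matrix in the
    beta_l with l > 0 is the identity at the origin, so Cramer's rule solves for these beta_l. *)
Theorem tangent_equations : exists (D : {mpoly K[N]}) (m : 'I_b -> {mpoly K[N]}),
  D.@[o 0] != 0 /\ forall l : 'I_b, vanishing_ideal Lam
    (D * 'X_(rshift a (lift ord0 l)) - 'X_(rshift a ord0) * m l).
Proof.
pose L := [set w : 'rV[K]_N | exists2 f, I f & forall i, w 0 i = (f^`M(i)).@[o 0]].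
have [A LA] : exists A : 'M[K]_N, forall w, L w <-> (w <= A)%MS.
  apply: linear_set_rowspace => [|t u v [f If fE] [g Ig gE]].
    exists 0; first exact: (idl0 idI).
    by move=> i; rewrite mxE mderiv0 meval0.
  exists (t%:MP * f + g); first by apply: (idlD idI) => //; exact: (idlMl idI).
  by move=> i; rewrite !mxE fE gE mderivD mderiv_mulC mevalD mevalM mevalC.
have TA v : A *m v^T = 0 -> tangent_space Lam 0 v.
  move=> Av f If; pose w : 'rV[K]_N := \row_i (f^`M(i)).@[o 0].
  have /LA/submxP[c wE] : L w by exists f => // i; rewrite mxE.
  have : w *m v^T = 0 by rewrite wE -mulmxA Av mulmx0.
  move/rowP/(_ 0); rewrite !mxE => wv; rewrite -[RHS]wv.
  by apply: eq_bigr => i _; rewrite !mxE.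
pose kap l := v0 0 (rshift a l) / v0 0 (rshift a ord0).
have step l : exists C : 'I_b.+1 -> {mpoly K[N]}, I (\sum_j C j * 'X_(rshift a j)) /\
    forall j, (C j).@[o 0] = (j == lift ord0 l)%:R - kap (lift ord0 l) * (j == ord0)%:R.
  pose w : 'rV[K]_N := delta_mx 0 (rshift a (lift ord0 l))
    - kap (lift ord0 l) *: delta_mx 0 (rshift a ord0).
  (* The columns of the cokernel of [A] are tangent vectors, and [w] vanishes on tangent vectors, so
     [w] lies in the row space of [A], which consists of the linear parts of the ideal. *)
  have /LA[f If wE] : (w <= A)%MS.
    rewrite submxE; move: (cokermx A) (mulmx_coker A) => cc Acc.
    apply/eqP/rowP => k; rewrite mxE [RHS]mxE.
    have Tk : tangent_space Lam 0 (col k cc)^T.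
      by apply: TA; rewrite trmxK colE mulmxA Acc mul0mx.
    have := tangentE (lift ord0 l) Tk; rewrite !mxE => kE.
    rewrite (bigD1 (rshift a ord0)) //= (bigD1 (rshift a (lift ord0 l))) /=; last first.
      by rewrite (inj_eq (@rshift_inj _ _)) eq_sym neq_lift.
    rewrite big1 ?addr0 => [|i /andP[/negPf i0 /negPf il]].
      rewrite !mxE !eqxx /= (inj_eq (@rshift_inj _ _)) (negPf (neq_lift _ _)).
      rewrite (inj_eq (@rshift_inj _ _)) eq_sym (negPf (neq_lift _ _)) mulr0 subr0.
      by rewrite kE /kap /=; field.
    by rewrite !mxE i0 il !andbF mulr0 subrr mul0r.
  have [C [fE CE]] := plane_ext If; exists C; split; first by rewrite -fE.
  move=> j; rewrite -CE -wE !mxE !(inj_eq (@rshift_inj _ _)).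
  by rewrite eqxx /=.
have [C /all_and2[IC C0]] := choice step.
pose M := \matrix_(l, k) C l (lift ord0 k).
pose w k : {mpoly K[N]} := 'X_(rshift a (lift ord0 k)).
pose P := [set f | exists e, I (f - 'X_(rshift a ord0) * e)].
have PM k : P (\det M * w k).
  apply: (@det_trick _ _ idfun P b M w).
  - by exists 0; rewrite mulr0 subrr; exact: (idl0 idI).
  - move=> x y [e1 q1] [e2 q2]; exists (e1 + e2).
    by rewrite mulrDr opprD addrACA; exact: (idlD idI).
  - move=> c x [e1 q1]; exists (c * e1).
    by rewrite mulrCA -mulrBr; exact: (idlMl idI).
  - move=> l; exists (- C l ord0); have := IC l.
    rewrite big_ord_recl /= addrC mulrN opprK ['X_(rshift _ _) * _]mulrC.
    by congr (I (_ + _)); apply: eq_bigr => j _; rewrite mxE.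
have [m mP] := choice PM; exists (\det M), m; split=> //.
rewrite meval_det (_ : matrix_of_fun _ _ = 1%:M) ?det1 ?oner_neq0 //.
apply/matrixP => l k; rewrite !mxE C0 (inj_eq lift_inj) eq_sym.
by rewrite [_ == ord0]eq_sym (negPf (neq_lift _ _)) mulr0 subr0.
Qed.

End TangentEquations.

(** * Nodes of the fibres *)

Section Nodes.
Variables (K : numClosedFieldType) (m : nat).
Implicit Types (t : 'rV[K]_(m.-1 + m)) (p : {poly K}) (P : 'rV[K]_2).

Definition fibre_a t : {poly K} := 'X^m + \sum_(i < m.-1) alpha t i *: 'X^i.
Definition fibre_b t : {poly K} := \sum_(j < m) beta t j *: 'X^j.
Definition disc t : {poly K} := fibre_a t ^+ 2 - 4%:R *: fibre_b t.

Let ix : 'I_2 := inord 0.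
Let iy : 'I_2 := inord 1.
Let X : {mpoly K[2]} := 'X_ix.
Let Y : {mpoly K[2]} := 'X_iy.

Let emb p : {mpoly K[2]} := (map_poly (@mpolyC 2 K) p).[X].

Let emb_MXaddC p c : emb (p * 'X + c%:P) = emb p * X + c%:MP.
Proof. by rewrite /emb rmorphD rmorphM /= map_polyX map_polyC hornerMXaddC. Qed.

Let emb0 : emb 0 = 0. Proof. by rewrite /emb rmorph0 horner0. Qed.
Let embD p q : emb (p + q) = emb p + emb q.
Proof. by rewrite /emb rmorphD hornerD. Qed.
Let embZ c p : emb (c *: p) = c%:MP * emb p.
Proof. by rewrite /emb -mul_polyC rmorphM /= map_polyC hornerM hornerC. Qed.
Let embX k : emb 'X^k = X ^+ k.
Proof. by rewrite /emb rmorphXn /= map_polyX hornerXn. Qed.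

Let ixy : (iy == ix) = false. Proof. by rewrite -val_eqE /= !inordK. Qed.

Let emb_eval p P : (emb p).@[P 0] = p.[P 0 ix].
Proof.
elim/poly_ind: p => [|p c IHp]; first by rewrite emb0 meval0 horner0.
by rewrite emb_MXaddC mevalD mevalM IHp mevalXU mevalC hornerMXaddC.
Qed.

Let emb_derivx p : (emb p)^`M(ix) = emb p^`().
Proof.
elim/poly_ind: p => [|p c IHp]; first by rewrite deriv0 emb0 mderiv0.
rewrite emb_MXaddC mderivD mderivC addr0 mderivM IHp mderivU eqxx mulr1.
rewrite derivMXaddC embD -['X]expr1 addrC -[_ * 'X^1]addr0.
by rewrite -[0 in RHS](polyC0) expr1 emb_MXaddC addr0.
Qed.

Let emb_derivy p : (emb p)^`M(iy) = 0.
Proof.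
elim/poly_ind: p => [|p c IHp]; first by rewrite emb0 mderiv0.
rewrite emb_MXaddC mderivD mderivC addr0 mderivM IHp mul0r add0r mderivU.
by rewrite eq_sym ixy mulr0.
Qed.

Let fibreE t : fibre t = Y ^+ 2 + Y * emb (fibre_a t) + emb (fibre_b t).
Proof.
rewrite /fibre -/ix -/iy -/X -/Y /fibre_a /fibre_b embD embX mulrDr.
have emb_sum (I : finType) (F : I -> {poly K}) : emb (\sum_i F i) = \sum_i emb (F i).
  by rewrite /emb rmorph_sum horner_sum.
rewrite !emb_sum mulr_sumr addrA; congr (_ + _ + _ + _).
  by apply: eq_bigr => i _; rewrite embZ embX mulrA [Y * _]mulrC.
by apply: eq_bigr => i _; rewrite embZ embX.
Qed.

Let P_ext (P Q : 'rV[K]_2) : P 0 ix = Q 0 ix -> P 0 iy = Q 0 iy -> P = Q.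
Proof.
move=> ex ey; apply/rowP => i; case: (eqVneq i ix) => [-> //|ne].
rewrite (_ : i = iy) //; apply: val_inj; move: ne; rewrite -val_eqE /= !inordK //.
by case: i => [[|[|]]].
Qed.

Definition exact_double_root p x := [/\ p.[x] = 0, p^`().[x] = 0 & p^`()^`().[x] != 0].

(** Completing the square, 4 f = (2 y + a)^2 - D. A critical point has 2 y + a = 0, and there f, f_x
    and the Hessian are constant multiples of D, D' and D''. *)
Lemma is_nodeP t P : is_node (fibre t) P <->
  P 0 iy = - (fibre_a t).[P 0 ix] / 2%:R /\ exact_double_root (disc t) (P 0 ix).
Proof.
rewrite /is_node -/ix -/iy fibreE /disc.
move: (fibre_a t) (fibre_b t) => a b; set x := P 0 ix; set y := P 0 iy.
have two0 : 2%:R != 0 :> K by rewrite pnatr_eq0.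
have mY2 k : ((Y ^+ 2)^`M(k)) = Y^`M(k) * Y + Y * Y^`M(k) by rewrite expr2 mderivM.
have Yx : Y^`M(ix) = 0 by rewrite mderivU ixy.
have Yy : Y^`M(iy) = 1 by rewrite mderivU eqxx.
have Y1x : (1 : {mpoly K[2]})^`M(ix) = 0 by rewrite -mpolyC1 mderivC.
have Y1y : (1 : {mpoly K[2]})^`M(iy) = 0 by rewrite -mpolyC1 mderivC.
rewrite !mderivD !mY2 !mderivM !mderivD !mderivM !emb_derivx !emb_derivy ?Yx ?Yy.
rewrite !(mderiv0, mul0r, mulr0, mul1r, mulr1, add0r, addr0).
rewrite Y1y !(mul0r, mulr0, add0r, addr0).
rewrite !(mevalD, mevalM) ?rmorphXn /= ?meval1 !mevalXU !emb_eval -/x -/y.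
rewrite /exact_double_root.
have d1 : (a ^+ 2 - 4%:R *: b)^`() = 2%:R *: (a * a^`()) - 4%:R *: b^`().
  by rewrite expr2 derivB derivZ derivM [a^`() * a]mulrC -mulr2n scaler_nat.
have d2 : (2%:R *: (a * a^`()) - 4%:R *: b^`())^`() =
    2%:R *: (a^`() * a^`() + a * a^`()^`()) - 4%:R *: b^`()^`().
  by rewrite derivB !derivZ derivM.
rewrite d1 d2 !(horner_exp, hornerD, hornerN, hornerZ, hornerM).
move: a.[x] a^`().[x] a^`()^`().[x] b.[x] b^`().[x] b^`()^`().[x] => A A1 A2 B B1 B2.
have half : y + y + A = 0 -> y = - A / 2%:R.
  by move=> /eqP; rewrite addr_eq0 => /eqP e; rewrite -e; field.
have four0 : 4%:R != 0 :> K by rewrite pnatr_eq0.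
have nz (c u v : K) : c != 0 -> u = c * v -> (u = 0 <-> v = 0).
  move=> c0 ->; split=> [/eqP|->]; last by rewrite mulr0.
  by rewrite mulf_eq0 (negPf c0) => /eqP.
have key : y = - A / 2%:R -> [/\ (A ^+ 2 - 4%:R * B = 0 <-> y ^+ 2 + y * A + B = 0),
   (2%:R * (A * A1) - 4%:R * B1 = 0 <-> y * A1 + B1 = 0) &
   (2%:R * (A1 * A1 + A * A2) - 4%:R * B2 = 0 <->
      (y * A2 + B2) * (1 + 1) - A1 ^+ 2 = 0)].
  move=> ->; split.
  - by apply: (nz (- 4%:R)); [rewrite oppr_eq0|field].
  - by apply: (nz (- 4%:R)); [rewrite oppr_eq0|field].
  - by apply: (nz (- 2%:R)); [rewrite oppr_eq0|field].
split.
  case=> f0 fx fy /eqP H; have ye := half fy; have [k1 k2 k3] := key ye.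
  by split=> //; split; [exact/k1|exact/k2|apply/eqP => /k3].
case=> ye [h1 h2 /eqP h3]; have [k1 k2 k3] := key ye.
by split; [exact/k1|exact/k2|rewrite ye; field|apply/eqP => /k3].
Qed.

Lemma has_nodesP t k : has_nodes (fibre t) k <->
  exists s : seq K, [/\ uniq s, size s = k & forall x, exact_double_root (disc t) x <-> x \in s].
Proof.
pose pt x : 'rV[K]_2 := \row_i (if i == ix then x else - (fibre_a t).[x] / 2%:R).
have ptx x : pt x 0 ix = x by rewrite mxE eqxx.
have pty x : pt x 0 iy = - (fibre_a t).[x] / 2%:R by rewrite mxE ixy.
split=> [[s [us ss sP]]|[s [us ss sP]]].
  exists [seq P 0 ix | P <- s : seq 'rV[K]_2]; split; last 1 first.
  - move=> x; split=> [Dx|/mapP[P /sP/is_nodeP[_ DP] -> //]].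
    by rewrite -(ptx x); apply: map_f; apply/sP/is_nodeP; rewrite ptx pty.
  - rewrite map_inj_in_uniq // => P Q /sP/is_nodeP[Py _] /sP/is_nodeP[Qy _] PQ.
    by apply: P_ext => //; rewrite Py Qy PQ.
  - by rewrite size_map.
exists (map pt s); split.
- by rewrite map_inj_uniq // => x y /(congr1 (fun P : 'rV_2 => P 0 ix)); rewrite !ptx.
- by rewrite size_map.
- move=> P; split=> [/is_nodeP[Py /sP DP]|/mapP[x /sP Dx ->]].
    by apply/mapP; exists (P 0 ix) => //; apply: P_ext; rewrite ?ptx ?pty.
  by apply/is_nodeP; rewrite ptx pty.
Qed.

End Nodes.

Section DoubleRoots.
Variable K : fieldType.
Implicit Types (p q : {poly K}) (s : seq K).

(** After one division by [q], the derivative of [p] at a root of [q] is the quotient times q', and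
    q' is nonzero there because [q] is separable. So [q] divides the quotient too. *)
Lemma double_roots_factor p s : uniq s ->
    (forall x, x \in s -> p.[x] = 0 /\ p^`().[x] = 0) ->
  exists r, p = (\prod_(x <- s) ('X - x%:P)) ^+ 2 * r.
Proof.
move=> us sP; set q := \prod_(x <- s) _.
have factor p1 : (forall x, x \in s -> p1.[x] = 0) -> exists p2, p1 = p2 * q.
  move=> p1s; apply: uniq_roots_prod_XsubC; last by rewrite uniq_rootsE.
  by apply/allP => x /p1s/eqP.
have [p1 pE] := factor p (fun x xs => (sP x xs).1).
have [r p1E] : exists r, p1 = r * q.
  apply: factor => x xs; have [_] := sP x xs.
  have rqx : root q x by rewrite root_prod_XsubC.
  have qx : q.[x] = 0 by exact/eqP.
  rewrite pE derivM hornerD !hornerM qx mulr0 add0r => /eqP.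
  rewrite mulf_eq0 => /orP[/eqP //|].
  have sepq : separable_poly q by rewrite separable_prod_XsubC.
  by move: sepq; rewrite unlock => /coprimep_root/(_ rqx)/negPf ->.
by exists r; rewrite pE p1E expr2; ring.
Qed.
End DoubleRoots.

(** * Chebyshev polynomials *)

Section Chebyshev.
Variables (S : comNzRingType) (c sg : S).

(* With lambda + mu = X - c and lambda mu = sg, chebU k is
   (lambda^k - mu^k) / (lambda - mu) and chebT k is lambda^k + mu^k. *)
Fixpoint chebU k : {poly S} :=
  if k is k1.+1 then
    if k1 is k2.+1 then ('X - c%:P) * chebU k1 - sg%:P * chebU k2 else 1
  else 0.

Arguments chebU : simpl never.

Lemma chebU0E : chebU 0 = 0. Proof. by []. Qed.
Lemma chebU1E : chebU 1 = 1. Proof. by []. Qed.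

Definition chebT k : {poly S} := 2%:R * chebU k.+1 - ('X - c%:P) * chebU k.

(** This is (lambda - mu)^2, the discriminant of the quadratic with roots lambda and mu. *)
Definition cheb_r : {poly S} := ('X - c%:P) ^+ 2 - 4%:R * sg%:P.

Lemma chebU_rec k : chebU k.+2 = ('X - c%:P) * chebU k.+1 - sg%:P * chebU k.
Proof. by []. Qed.

Lemma chebT0 : chebT 0 = 2%:R.
Proof. by rewrite /chebT chebU0E chebU1E mulr0 subr0 mulr1. Qed.

Lemma chebT_U k : chebT k.+1 = chebU k.+2 - sg%:P * chebU k.
Proof. by rewrite /chebT chebU_rec; ring. Qed.

(** In terms of lambda and mu both sides are 2 (lambda mu)^k (lambda^d + mu^d). As these roots are
    not in the ring, the identity is proved by induction from the recurrence. *)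
Lemma chebT_mul k d :
  chebT k * chebT (k + d) - cheb_r * (chebU k * chebU (k + d)) =
  2%:R * sg%:P ^+ k * chebT d.
Proof.
elim: k => [|k IHk]; first by rewrite chebT0 chebU0E mul0r mulr0 subr0 expr0 mulr1.
rewrite exprS addSn.
transitivity (sg%:P * (2%:R * sg%:P ^+ k * chebT d)); last by ring.
rewrite -IHk /chebT !chebU_rec /cheb_r; ring.
Qed.

Lemma size_chebU k : (size (chebU k) <= k)%N.
Proof.
elim/ltn_ind: k => -[|[|k]] IH; first by rewrite chebU0E size_poly0.
  by rewrite chebU1E size_poly1.
rewrite chebU_rec (leq_trans (size_polyD _ _)) // geq_max size_polyN.
rewrite mulrC (leq_trans (size_polyMleq _ _)) ?size_XsubC ?addn2 ?ltnS ?IH //=.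
by rewrite mul_polyC (leq_trans (size_scale_leq _ _)) // (leq_trans (IH k _)) // ltnW.
Qed.

Lemma coef_chebU_ge k j : (k <= j)%N -> (chebU k)`_j = 0.
Proof. by move=> kj; apply: nth_default; exact: leq_trans (size_chebU k) kj. Qed.

Lemma coef_XsubC_mul (f : {poly S}) j :
  (('X - c%:P) * f)`_j = (if j is j1.+1 then f`_j1 else 0) - c * f`_j.
Proof. by rewrite mulrBl coefB coefXM coefCM; case: j. Qed.

Lemma coef_chebU_rec k j : (chebU k.+2)`_j =
  (if j is j1.+1 then (chebU k.+1)`_j1 else 0) - c * (chebU k.+1)`_j - sg * (chebU k)`_j.
Proof. by rewrite chebU_rec coefB coef_XsubC_mul coefCM. Qed.

Lemma coef_chebU0 k : (chebU k.+1)`_k = 1.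
Proof.
elim: k => [|k IHk]; first by rewrite chebU1E coef1.
rewrite coef_chebU_rec IHk (coef_chebU_ge (leqnn k.+1)).
by rewrite (coef_chebU_ge (leqnSn k)); ring.
Qed.

Lemma coef_chebU1 k : (chebU k.+2)`_k = - (k.+1%:R * c).
Proof.
elim: k => [|k IHk]; first by rewrite coef_chebU_rec chebU1E chebU0E coef1 coef0 /=; ring.
rewrite coef_chebU_rec IHk coef_chebU0 (coef_chebU_ge (leqnn k.+1)).
by rewrite -[k.+2%:R]natr1; ring.
Qed.

Lemma coef_chebU2 k :
  (chebU k.+3)`_k = ('C(k.+2, 2))%:R * c ^+ 2 - k.+1%:R * sg.
Proof.
elim: k => [|k IHk].
  by rewrite coef_chebU_rec coef_chebU1 coef_chebU0 binn; ring.
rewrite coef_chebU_rec IHk coef_chebU1 coef_chebU0 [in RHS]binS bin1 natrD.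
by rewrite -[k.+2%:R]natr1; ring.
Qed.

Lemma coef_chebT_gt k j : (k < j)%N -> (chebT k)`_j = 0.
Proof.
case: k => [|k] kj.
  by rewrite chebT0 -polyCMn coefC; case: j kj.
rewrite chebT_U coefB coefCM !coef_chebU_ge ?mulr0 ?subr0 //.
by apply: ltnW; exact: ltnW.
Qed.

Lemma coef_chebT0 k : (chebT k.+1)`_k.+1 = 1.
Proof.
by rewrite chebT_U coefB coefCM coef_chebU0 coef_chebU_ge // mulr0 subr0.
Qed.

Lemma coef_chebT1 k : (chebT k.+1)`_k = - (k.+1%:R * c).
Proof.
by rewrite chebT_U coefB coefCM coef_chebU1 coef_chebU_ge // mulr0 subr0.
Qed.

Lemma coef_chebT2 k :
  (chebT k.+2)`_k = ('C(k.+2, 2))%:R * c ^+ 2 - k.+2%:R * sg.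
Proof.
rewrite chebT_U coefB coefCM coef_chebU2 coef_chebU0 -[k.+2%:R]natr1; ring.
Qed.

End Chebyshev.
Arguments chebU : simpl never.

Lemma map_chebU (S S' : comNzRingType) (f : {rmorphism S -> S'}) c sg k :
  map_poly f (chebU c sg k) = chebU (f c) (f sg) k.
Proof.
elim/ltn_ind: k => -[|[|k]] IH; [by rewrite !chebU0E rmorph0|by rewrite !chebU1E rmorph1|].
rewrite !chebU_rec rmorphB !rmorphM /= !IH //; congr (_ * _ - _ * _).
  by rewrite rmorphB /= map_polyX map_polyC.
exact: map_polyC.
Qed.

Lemma map_chebT (S S' : comNzRingType) (f : {rmorphism S -> S'}) c sg k :
  map_poly f (chebT c sg k) = chebT (f c) (f sg) k.
Proof.
by rewrite /chebT rmorphB !rmorphM /= rmorph_nat rmorphB /= map_polyX map_polyC !map_chebU.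
Qed.

Lemma chebU_0 (S : comNzRingType) (k : nat) : chebU (0 : S) 0 k.+1 = 'X^k :> {poly S}.
Proof.
elim: k => [//|k IHk]; by rewrite chebU_rec IHk polyC0 subr0 mul0r subr0 exprS.
Qed.

Lemma chebT_0 (S : comNzRingType) (k : nat) : chebT (0 : S) 0 k.+1 = 'X^(k.+1) :> {poly S}.
Proof. by rewrite chebT_U chebU_0 polyC0 mul0r subr0. Qed.

Lemma symmetric_double_sum (S : comNzRingType) (M : nat) (F : nat -> nat -> S) :
    (forall k l, F k l = F l k) ->
  \sum_(1 <= k < M.+1) \sum_(1 <= l < M.+1) F k l =
  \sum_(1 <= k < M.+1) F k k + 2%:R * \sum_(1 <= k < M.+1) \sum_(k.+1 <= l < M.+1) F k l.
Proof.
move=> symF; elim: M => [|M IHM]; first by rewrite !big_geq // mulr0 addr0.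
rewrite !(@big_nat_recr _ _ _ M.+1 1) //= [\sum_(M.+2 <= l < M.+2) _]big_geq // addr0.
rewrite [X in X + _ = _](_ : _ = \sum_(1 <= k < M.+1) \sum_(1 <= l < M.+1) F k l +
    \sum_(1 <= k < M.+1) F k M.+1); last first.
  by rewrite -big_split; apply: eq_bigr => k _; rewrite big_nat_recr.
rewrite (eq_bigr (fun l => F l M.+1) (r := index_iota 1 M.+1) (F1 := F M.+1)); last first.
  by move=> l _; exact: symF.
rewrite IHM [X in _ = _ + 2%:R * X](_ : _ = \sum_(1 <= k < M.+1) \sum_(k.+1 <= l < M.+1) F k l +
    \sum_(1 <= k < M.+1) F k M.+1); first by ring.
rewrite -big_split; apply: eq_big_nat => k /andP[_ kM] /=.
by rewrite big_nat_recr.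
Qed.

Section ChebBasis.
Variables (S : comNzRingType) (c sg : S).

Lemma chebU_span N (q : {poly S}) : (size q <= N)%N ->
  exists p : nat -> S, q = \sum_(1 <= k < N.+1) (p k)%:P * chebU c sg k.
Proof.
elim: N q => [|N IHN] q sq.
  exists (fun=> 0); rewrite big_geq //; apply/eqP.
  by rewrite -size_poly_eq0 -leqn0.
have [|p pE] := IHN (q - (q`_N)%:P * chebU c sg N.+1).
  apply/leq_sizeP => j; rewrite leq_eqVlt coefB coefCM => /predU1P[<-|Nj].
    by rewrite coef_chebU0 mulr1 subrr.
  by rewrite coef_chebU_ge // mulr0 subr0 nth_default // (leq_trans sq).
exists (fun k => if k == N.+1 then q`_N else p k).
rewrite big_nat_recr //= eqxx -(subrK ((q`_N)%:P * chebU c sg N.+1) q) pE.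
congr (_ + _); last by rewrite -pE subrK.
by apply: eq_big_nat => k /andP[_ kN]; rewrite ltn_eqF.
Qed.

Lemma chebU_free N (p : nat -> S) :
  \sum_(1 <= k < N.+1) (p k)%:P * chebU c sg k = 0 ->
  forall k, (1 <= k <= N)%N -> p k = 0.
Proof.
elim: N => [|N IHN] s0 k /andP[k1 kN]; first by case: k k1 kN.
have pN : p N.+1 = 0.
  have := congr1 (fun q : {poly S} => q`_N) s0; rewrite /= coef0 => <-.
  rewrite big_nat_recr //= coefD coefCM coef_chebU0 mulr1 coef_sum big_nat.
  rewrite big1 ?add0r // => j /andP[_ jN].
  by rewrite coefCM coef_chebU_ge ?mulr0.
move: s0; rewrite big_nat_recr //= pN mul0r addr0 => /IHN pk.
move: kN; rewrite leq_eqVlt => /predU1P[-> //|kN]; apply: pk.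
by rewrite k1.
Qed.

End ChebBasis.

(** * The parametrization of the nodal loci *)

Section Nu.
Variable n : nat.

Section Ring.
Variables (S : comNzRingType) (x : 'I_n.+2 -> S).

(* The coordinates x are (sigma, p_1, ..., p_n, c), and a, q, b are Wa, Wq, Wb. *)
Definition Wsg := x ord0.
Definition Wc := x ord_max.
(** T_(n+2) has coefficient -(n+2) c in degree n+1, which the value at [n.+1] cancels
    ([coef_Wa_pred]). The value 0 beyond [n.+2] lets sums over [k + d] run past the top index. *)
Definition Wp k : S :=
  if k == n.+2 then 1 else if k == n.+1 then n.+2%:R * Wc else
  if (k < n.+1)%N then x (inord k) else 0.

Local Notation T := (chebT Wc Wsg).
Local Notation U := (chebU Wc Wsg).

Definition Wa : {poly S} := \sum_(1 <= k < n.+3) (Wp k)%:P * T k.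
Definition Wq : {poly S} := \sum_(1 <= k < n.+3) (Wp k)%:P * U k.
Definition WB0 : S := \sum_(1 <= k < n.+3) Wp k ^+ 2 * Wsg ^+ k.
Definition Wbd d : S := \sum_(1 <= k < n.+2) Wp k * Wp (k + d)%N * Wsg ^+ k.
Definition Wb : {poly S} := WB0%:P + \sum_(1 <= d < n.+2) (Wbd d)%:P * T d.

Definition nu (i : 'I_(n.+1 + n.+2)) : S :=
  match fintype.split i with inl j => Wa`_j | inr j => Wb`_j end.

Lemma Wp_top : Wp n.+2 = 1. Proof. by rewrite /Wp eqxx. Qed.
Lemma Wp_pred : Wp n.+1 = n.+2%:R * Wc.
Proof. by rewrite /Wp eqxx ltn_eqF. Qed.
Lemma Wp_gt k : (n.+2 < k)%N -> Wp k = 0.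
Proof.
move=> nk; have n1 : (n.+1 < k)%N := ltnW nk.
by rewrite /Wp (gtn_eqF nk) (gtn_eqF n1) ltnNge (ltnW n1).
Qed.

(** Expand the squares into double sums and apply [chebT_mul] to each pair of indices. Off-diagonal
    pairs occur twice and diagonal ones carry T_0 = 2, so every term gets the factor 4. *)
Lemma W_disc : Wa ^+ 2 - 4%:R * Wb = Wq ^+ 2 * cheb_r Wc Wsg.
Proof.
pose F k l := (Wp k * Wp l)%:P * (T k * T l - cheb_r Wc Wsg * (U k * U l)).
have FE k d : F k (k + d)%N = 2%:R * ((Wp k * Wp (k + d)%N * Wsg ^+ k)%:P * T d).
  by rewrite /F chebT_mul !polyCM polyC_exp; ring.
have symF k l : F k l = F l k by rewrite /F !polyCM; ring.
apply/eqP; rewrite subr_eq addrC -subr_eq; apply/eqP.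
transitivity (\sum_(1 <= k < n.+3) \sum_(1 <= l < n.+3) F k l).
  rewrite !expr2 /Wa /Wq !big_distrlr mulr_suml -sumrB; apply: eq_bigr => k _.
  rewrite mulr_suml -sumrB; apply: eq_bigr => l _.
  rewrite /F polyCM /=; ring.
rewrite symmetric_double_sum //.
have -> : \sum_(1 <= k < n.+3) F k k = 4%:R * WB0%:P.
  rewrite rmorph_sum mulr_sumr; apply: eq_bigr => k _.
  have := FE k 0%N; rewrite addn0 chebT0; rewrite -(expr2 (Wp k)) => ->; rewrite polyCM; ring.
suff -> : \sum_(1 <= k < n.+3) \sum_(k.+1 <= l < n.+3) F k l =
    2%:R * \sum_(1 <= d < n.+2) (Wbd d)%:P * T d by rewrite /Wb; ring.
(* Here l = k + d; the pairs added to make the range of [d] independent of [k] contribute 0 by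
   [Wp_gt]. *)
transitivity (\sum_(1 <= k < n.+3) \sum_(1 <= d < n.+2) F k (k + d)%N).
  apply: eq_big_nat => k /andP[k1 kn].
  rewrite -[k.+1]add1n big_addn [RHS](@big_cat_nat _ _ _ (n.+3 - k)) /=; last 2 first.
  - by rewrite subn_gt0.
  - by rewrite leq_subLR -[n.+3]add1n leq_add2r.
  rewrite [X in _ = _ + X]big_nat [X in _ = _ + X]big1 ?addr0 => [|d /andP[kd _]].
    by apply: eq_bigr => d _; rewrite addnC.
  by rewrite /F (@Wp_gt (k + d)%N) ?mulr0 ?polyC0 ?mul0r // -leq_subLR.
rewrite exchange_big_nat /= mulr_sumr; apply: eq_big_nat => d /andP[d1 _].
rewrite big_nat_recr //= /F (@Wp_gt (n.+2 + d)%N) ?mulr0 ?polyC0 ?mul0r ?addr0; last first.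
  by rewrite -addn1 leq_add2l.
rewrite rmorph_sum mulr_suml mulr_sumr; apply: eq_bigr => k _.
exact: FE.
Qed.

End Ring.
End Nu.

Arguments Wp : simpl never.
Section NuProperties.
Variable n : nat.

Section Ring.
Variables (S : comNzRingType) (x : 'I_n.+2 -> S).

Local Notation T := (chebT (Wc x) (Wsg x)).
Local Notation U := (chebU (Wc x) (Wsg x)).

Lemma size_Wb : (size (Wb x) <= n.+2)%N.
Proof.
apply/leq_sizeP => j nj; rewrite /Wb coefD coefC (gtn_eqF (leq_trans _ nj)) // add0r.
rewrite coef_sum big_nat big1 // => d /andP[_ dn].
by rewrite coefCM coef_chebT_gt ?mulr0 // (leq_trans dn).
Qed.

Lemma coef_Wb_lift j : (Wb x)`_j.+1 = \sum_(1 <= d < n.+2) Wbd x d * (T d)`_j.+1.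
Proof.
by rewrite coefD coefC add0r coef_sum; apply: eq_bigr => d _; rewrite coefCM.
Qed.

Lemma coef_Wb0 : (Wb x)`_0 = WB0 x + \sum_(1 <= d < n.+2) Wbd x d * (T d)`_0.
Proof.
by rewrite coefD coefC coef_sum; congr (_ + _); apply: eq_bigr => d _; rewrite coefCM.
Qed.

Lemma WaE : Wa x = T n.+2 + (n.+2%:R * Wc x)%:P * T n.+1
  + \sum_(1 <= k < n.+1) (Wp x k)%:P * T k.
Proof.
rewrite /Wa big_nat_recr //= big_nat_recr //= Wp_top Wp_pred polyC1 mul1r addrC.
by rewrite [X in _ + X]addrC addrA.
Qed.

Lemma size_Wa : (size (Wa x) <= n.+3)%N.
Proof.
apply/leq_sizeP => j nj; rewrite /Wa coef_sum big_nat big1 // => d /andP[_ dn].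
by rewrite coefCM coef_chebT_gt ?mulr0 // (leq_trans dn).
Qed.

Lemma coef_Wa_low j : (n < j)%N ->
  (\sum_(1 <= k < n.+1) (Wp x k)%:P * T k)`_j = 0.
Proof.
move=> nj; rewrite coef_sum big_nat big1 // => k /andP[_ kn].
by rewrite coefCM coef_chebT_gt ?mulr0 // (leq_trans kn).
Qed.

Lemma coef_Wa_top : (Wa x)`_n.+2 = 1.
Proof.
rewrite WaE 2!coefD coefCM coef_chebT0 (coef_chebT_gt _ _ (ltnSn _)).
by rewrite coef_Wa_low // mulr0 !addr0.
Qed.

Lemma coef_Wa_pred : (Wa x)`_n.+1 = 0.
Proof.
by rewrite WaE 2!coefD coefCM coef_chebT1 coef_chebT0 coef_Wa_low // mulr1 addr0 addNr.
Qed.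

Lemma coef_Wa_sub : (Wa x)`_n = ('C(n.+2, 2))%:R * Wc x ^+ 2 - n.+2%:R * Wsg x
   - n.+2%:R * Wc x * (n.+1%:R * Wc x) + (if n is 0 then 0 else Wp x n).
Proof.
rewrite WaE 2!coefD coefCM coef_chebT2 coef_chebT1 mulrN; congr (_ + _).
case: n x => [|k] y; first by rewrite big_geq // coef0.
rewrite big_nat_recr //= coefD coefCM coef_chebT0 mulr1 coef_sum big_nat big1 ?add0r //.
by move=> j /andP[_ jk]; rewrite coefCM coef_chebT_gt ?mulr0.
Qed.

Lemma size_Wq : (size (Wq x) <= n.+2)%N.
Proof.
apply/leq_sizeP => j nj; rewrite /Wq coef_sum big_nat big1 // => d /andP[_ dn].
by rewrite coefCM coef_chebU_ge ?mulr0 // -ltnS (leq_trans dn).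
Qed.

Lemma WqE : Wq x = U n.+2 + (n.+2%:R * Wc x)%:P * U n.+1
  + \sum_(1 <= k < n.+1) (Wp x k)%:P * U k.
Proof.
rewrite /Wq big_nat_recr //= big_nat_recr //= Wp_top Wp_pred polyC1 mul1r addrC.
by rewrite [X in _ + X]addrC addrA.
Qed.

Lemma coef_Wq_low j : (n <= j)%N ->
  (\sum_(1 <= k < n.+1) (Wp x k)%:P * U k)`_j = 0.
Proof.
move=> nj; rewrite coef_sum big_nat big1 // => k /andP[_ kn].
by rewrite coefCM coef_chebU_ge ?mulr0 // (leq_trans _ nj).
Qed.

Lemma coef_Wq_top : (Wq x)`_n.+1 = 1.
Proof.
rewrite WqE 2!coefD coefCM coef_chebU0 (coef_chebU_ge _ _ (leqnn _)).
by rewrite coef_Wq_low // mulr0 !addr0.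
Qed.

Lemma coef_Wq_pred : (Wq x)`_n = Wc x.
Proof.
rewrite WqE 2!coefD coefCM coef_chebU1 coef_chebU0 coef_Wq_low //.
by rewrite -[n.+2%:R]natr1; ring.
Qed.

Lemma nu_l j : nu x (lshift n.+2 j) = (Wa x)`_j.
Proof. by rewrite /nu -[lshift _ _]/(unsplit (inl j)) unsplitK. Qed.

Lemma nu_r j : nu x (rshift n.+1 j) = (Wb x)`_j.
Proof. by rewrite /nu -[rshift _ _]/(unsplit (inr j)) unsplitK. Qed.

End Ring.

(** Expand [q] in the triangular monic basis of the [chebU]. Its two top coefficients force p_(n+2)
    = 1 and p_(n+1) = c + (n+1) c, the values built into [Wp]. *)
Lemma W_parametrization (S : comNzRingType) (c sg : S) (q : {poly S}) :
    (size q <= n.+2)%N -> q`_n.+1 = 1 -> q`_n = c ->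
  exists x : 'I_n.+2 -> S, [/\ Wc x = c, Wsg x = sg & Wq x = q].
Proof.
move=> sq q1 qc; have [p pE] := chebU_span c sg sq.
pose x (i : 'I_n.+2) := if i == ord0 then sg else if i == ord_max then c else p i.
exists x.
have cE : Wc x = c by rewrite /Wc /x; case: eqP => [/(congr1 val) //|_]; rewrite eqxx.
have sE : Wsg x = sg by rewrite /Wsg /x eqxx.
split=> //; rewrite /Wq cE sE pE.
have p2 : p n.+2 = 1.
  move: q1; rewrite pE big_nat_recr //= coefD coefCM coef_chebU0 mulr1 coef_sum big_nat.
  rewrite big1 ?add0r // => j /andP[_ jn].
  by rewrite coefCM coef_chebU_ge ?mulr0.
have p1 : p n.+1 = n.+2%:R * c.
  move: qc; rewrite pE big_nat_recr //= big_nat_recr //= 2!coefD !coefCM coef_chebU1 coef_chebU0.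
  rewrite p2 mul1r mulr1 coef_sum big_nat big1 => [|j /andP[_ jn]]; last first.
    by rewrite coefCM coef_chebU_ge ?mulr0.
  by rewrite add0r => /eqP; rewrite subr_eq => /eqP ->; rewrite -[n.+2%:R]natr1; ring.
apply: eq_big_nat => k /andP[k0 kn]; congr (_%:P * _).
rewrite /Wp cE; case: eqP => [->|/eqP k2]; first by rewrite p2.
case: eqP => [->|/eqP k1]; first by rewrite p1.
have kn1 : (k < n.+1)%N by rewrite ltn_neqAle k1 -ltnS ltn_neqAle k2 -ltnS.
have ik : (inord k : 'I_n.+2) = k :> nat by rewrite inordK // ltnW.
rewrite kn1 /x -!val_eqE /= ik; case: eqP => [k00|_]; first by rewrite k00 in k0.
by rewrite (negPf k1).
Qed.

Lemma W_inj (S : comNzRingType) (x y : 'I_n.+2 -> S) :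
  Wc x = Wc y -> Wsg x = Wsg y -> Wq x = Wq y -> x =1 y.
Proof.
move=> ec es eq i.
have [->|i0] := eqVneq i ord0; first exact: es.
have [->|im] := eqVneq i ord_max; first exact: ec.
have i1 : (i < n.+1)%N by rewrite ltn_neqAle -ltnS ltn_ord andbT; move: im; rewrite -val_eqE.
have {i0} i0 : (0 < i)%N by rewrite lt0n; move: i0; rewrite -val_eqE.
have pi (z : 'I_n.+2 -> S) : Wp z i = z i.
  by rewrite /Wp !ltn_eqF ?i1 ?inord_val // ltnW.
rewrite -(pi x) -(pi y); apply/eqP; rewrite -subr_eq0; apply/eqP.
apply: (@chebU_free _ (Wc x) (Wsg x) n.+2 (fun k => Wp x k - Wp y k)).
  rewrite (eq_bigr (fun k => (Wp x k)%:P * chebU (Wc x) (Wsg x) k -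
     (Wp y k)%:P * chebU (Wc y) (Wsg y) k)); last first.
    by move=> k _; rewrite polyCB mulrBl ec es.
  by rewrite sumrB -/(Wq x) -/(Wq y) eq subrr.
by rewrite i0 ltnW // ltnW.
Qed.

Section Natural.
Variables (S S' : comNzRingType) (f : {rmorphism S -> S'}) (x : 'I_n.+2 -> S).

Lemma map_Wp k : f (Wp x k) = Wp (f \o x) k.
Proof.
rewrite /Wp; case: eqP => _; first exact: rmorph1.
case: eqP => _; first by rewrite rmorphM rmorph_nat.
by case: ifP => _ //; exact: rmorph0.
Qed.

Lemma map_Wa : map_poly f (Wa x) = Wa (f \o x).
Proof.
rewrite /Wa rmorph_sum; apply: eq_bigr => k _.
by rewrite rmorphM /= map_polyC map_chebT /= map_Wp.
Qed.

Lemma map_Wq : map_poly f (Wq x) = Wq (f \o x).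
Proof.
rewrite /Wq rmorph_sum; apply: eq_bigr => k _.
by rewrite rmorphM /= map_polyC map_chebU /= map_Wp.
Qed.

Lemma map_WB0 : f (WB0 x) = WB0 (f \o x).
Proof.
rewrite /WB0 rmorph_sum; apply: eq_bigr => k _.
by rewrite rmorphM !rmorphXn /= map_Wp.
Qed.

Lemma map_Wbd d : f (Wbd x d) = Wbd (f \o x) d.
Proof.
rewrite /Wbd rmorph_sum; apply: eq_bigr => k _.
by rewrite !rmorphM rmorphXn /= !map_Wp.
Qed.

Lemma map_Wb : map_poly f (Wb x) = Wb (f \o x).
Proof.
rewrite /Wb rmorphD /= map_polyC /= map_WB0; congr (_ + _); rewrite rmorph_sum.
apply: eq_bigr => k _.
by rewrite rmorphM /= map_polyC map_chebT /= map_Wbd.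
Qed.

Lemma map_nu i : f (nu x i) = nu (f \o x) i.
Proof.
rewrite /nu; case: fintype.split => j.
  by rewrite -map_Wa coef_map.
by rewrite -map_Wb coef_map.
Qed.

End Natural.

Lemma nu_ext (S : comNzRingType) (x y : 'I_n.+2 -> S) : x =1 y -> nu x =1 nu y.
Proof. by move=> /funext ->. Qed.

End NuProperties.

Lemma coefM_subtop (R : comNzRingType) (f g : {poly R}) k l :
    (size f <= k.+2)%N -> (size g <= l.+2)%N ->
  (f * g)`_(k + l).+1 = f`_k.+1 * g`_l + f`_k * g`_l.+1.
Proof.
move=> sf sg; rewrite coefM -(big_mkord xpredT (fun j => f`_j * g`_((k + l).+1 - j))).
rewrite (@big_cat_nat _ _ _ k) //=; last by rewrite -addnS -addnS leq_addr.
rewrite big_nat big1 ?add0r => [|i /andP[_ ik]]; last first.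
  rewrite [g`__]nth_default ?mulr0 // (leq_trans sg) //.
  lia.
rewrite big_ltn; last by lia.
rewrite big_ltn; last by lia.
rewrite -addnS addKn addnS subSS addKn addrCA addrA [X in _ + X]big_nat big1 ?addr0 //.
by move=> i /andP[ki _]; rewrite [f`__]nth_default ?mul0r // (leq_trans sf).
Qed.

(** From (a - a') (a + a') = 4 (b - b'): the factor a + a' has degree m, the right side has smaller
    degree, so both sides are 0. *)
Lemma poly_sqrt_unique (K : numFieldType) m (a a' b b' : {poly K}) :
    size a = m.+1 -> size a' = m.+1 -> a \is monic -> a' \is monic ->
    (size b <= m)%N -> (size b' <= m)%N ->
    a ^+ 2 - 4%:R * b = a' ^+ 2 - 4%:R * b' -> a = a' /\ b = b'.
Proof.
move=> sa sa' ma ma' sb sb' e.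
have four : 4%:R != 0 :> {poly K} by rewrite -polyC_natr polyC_eq0 pnatr_eq0.
have e2 : (a - a') * (a + a') = 4%:R * (b - b').
  have -> : (a - a') * (a + a') =
      a ^+ 2 - 4%:R * b - (a' ^+ 2 - 4%:R * b') + 4%:R * (b - b') by ring.
  by rewrite e subrr add0r.
have aa' : a = a'.
  apply/eqP; rewrite -subr_eq0; apply/negPn/negP => ne.
  have top : (a + a')`_m != 0.
    move: ma ma'; rewrite !monicE /lead_coef sa sa' /= => /eqP ma /eqP ma'.
    by rewrite coefD ma ma' -(natrD _ 1 1) pnatr_eq0.
  have m_lt : (m < size (a + a')%R)%N by rewrite ltnNge; apply: contra top => /leq_sizeP ->.
  have ne2 : a + a' != 0 by rewrite -size_poly_gt0 (leq_ltn_trans _ m_lt).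
  have : (size (4%:R * (b - b'))%R <= m)%N.
    rewrite -polyC_natr mul_polyC (leq_trans (size_scale_leq _ _)) //.
    by rewrite (leq_trans (size_polyD _ _)) // size_polyN geq_max sb.
  rewrite -e2 size_mul // -subn1 leq_subLR add1n => le.
  have : (0 < size (a - a')%R)%N by rewrite size_poly_gt0.
  move=> v0; have {}le : (size (a - a')%R + size (a + a')%R <= m.+1)%N := le.
  move: v0 m_lt le; move: (size (a - a')%R) (size (a + a')%R) => u v. lia.
split=> //; move/eqP: e; rewrite aa' (inj_eq (addrI _)) eqr_opp => /eqP.
exact: (mulfI four).
Qed.

Lemma exact_double_root_sqr (K : numClosedFieldType) (s : seq K) (r : {poly K}) (y : K) :
    uniq s -> (forall z, z \in s -> r.[z] != 0) ->
    (forall z, r.[z] = 0 -> r^`().[z] != 0) ->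
  exact_double_root ((\prod_(z <- s) ('X - z%:P)) ^+ 2 * r) y <-> y \in s.
Proof.
move=> us rs r2; set q := \prod_(z <- s) _.
have D1 : (q ^+ 2 * r)^`() = q * (2%:R *: (q^`() * r) + q * r^`()).
  rewrite derivM expr2 derivM -mul_polyC polyC_natr; ring.
have rq z : (q.[z] == 0) = (z \in s) by rewrite -[_ == 0]/(root q z) root_prod_XsubC.
split=> [[D0]|ys].
  move/eqP: D0; rewrite -rq hornerM horner_exp mulf_eq0 expf_eq0 /=.
  case/orP=> [//|/eqP ry]; rewrite D1 !(hornerM, hornerD, hornerZ) ry.
  rewrite mulr0 mulr0 add0r => /eqP; rewrite mulf_eq0 => /orP[//|].
  by rewrite mulf_eq0 => /orP[//|/eqP r'y]; have := r2 y ry; rewrite r'y eqxx.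
have qy : q.[y] = 0 by apply/eqP; rewrite rq.
split; first by rewrite hornerM horner_exp qy expr0n mul0r.
  by rewrite D1 hornerM qy mul0r.
rewrite D1 derivM hornerD !hornerM qy mul0r addr0 hornerD hornerZ !hornerM qy mul0r addr0.
have q'y : q^`().[y] != 0.
  have : separable_poly q by rewrite separable_prod_XsubC.
  by rewrite unlock => /coprimep_root; apply; rewrite root_prod_XsubC.
by rewrite !mulf_neq0 ?pnatr_eq0 // rs.
Qed.

(** * Fibres with m - 1 or m nodes are points of the parametrization *)

Section NodalLoci.
Variables (K : numClosedFieldType) (n : nat).
Notation N := (n.+1 + n.+2)%N.
Notation mm := (n.+2).
Implicit Types (t : 'rV[K]_N) (x z : 'rV[K]_n.+2).

Definition nu_point x : 'rV[K]_N := \row_i nu (x 0) i.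

Lemma coef_fibre_a t j : (@fibre_a K mm t)`_j =
  (j == n.+2)%:R + (if insub j is Some i then t 0 (lshift n.+2 i) else 0).
Proof.
rewrite /fibre_a coefD coefXn coef_sum; congr (_ + _).
case: insubP => [i ji <-|ji].
  rewrite (bigD1 i) //= coefZ coefXn eqxx mulr1 big1 ?addr0 // => k ne.
  by rewrite coefZ coefXn eq_sym; move: ne; rewrite -val_eqE => /negPf ->; rewrite mulr0.
apply: big1 => k _; rewrite coefZ coefXn; case: eqP => [e|_]; last by rewrite mulr0.
by move: ji; rewrite e ltn_ord.
Qed.

Lemma coef_fibre_b t j : (@fibre_b K mm t)`_j =
  if insub j is Some i then t 0 (rshift n.+1 i) else 0.
Proof.
rewrite /fibre_b coef_sum; case: insubP => [i ji <-|ji].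
  rewrite (bigD1 i) //= coefZ coefXn eqxx mulr1 big1 ?addr0 // => k ne.
  by rewrite coefZ coefXn eq_sym; move: ne; rewrite -val_eqE => /negPf ->; rewrite mulr0.
apply: big1 => k _; rewrite coefZ coefXn; case: eqP => [e|_]; last by rewrite mulr0.
by move: ji; rewrite e ltn_ord.
Qed.

Lemma fibre_a_nu_point x : @fibre_a K mm (nu_point x) = Wa (x 0).
Proof.
apply/polyP => j; rewrite coef_fibre_a; case: insubP => [i ji <-|ji].
  by rewrite mxE nu_l ltn_eqF ?add0r //; exact: (leq_trans (ltn_ord i)).
rewrite addr0; case: eqP => [->|/eqP ne]; first by rewrite coef_Wa_top.
have [->|ne'] := eqVneq j n.+1; first by rewrite coef_Wa_pred.
by rewrite nth_default // (leq_trans (size_Wa _)) //; lia.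
Qed.

Lemma fibre_b_nu_point x : @fibre_b K mm (nu_point x) = Wb (x 0).
Proof.
apply/polyP => j; rewrite coef_fibre_b; case: insubP => [i ji <-|ji].
  by rewrite mxE nu_r.
by rewrite nth_default // (leq_trans (size_Wb _)) // leqNgt.
Qed.

Lemma fibre_inj t t' : @fibre_a K mm t = @fibre_a K mm t' ->
  @fibre_b K mm t = @fibre_b K mm t' -> t = t'.
Proof.
move=> ea eb; apply/rowP => i; case: (split_ordP i) => k ->.
  have := congr1 (fun p : {poly K} => p`_k) ea; rewrite !coef_fibre_a valK.
  by move/addrI.
by have := congr1 (fun p : {poly K} => p`_k) eb; rewrite /= !coef_fibre_b valK.
Qed.

Lemma size_fibre_a t : size (@fibre_a K mm t) = n.+3.
Proof.
have top : (@fibre_a K mm t)`_n.+2 = 1.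
  by rewrite coef_fibre_a eqxx insubF ?addr0 // ltnNge leqnSn.
apply/eqP; rewrite eqn_leq; apply/andP; split.
  apply/leq_sizeP => j nj; rewrite coef_fibre_a gtn_eqF // add0r insubF //.
  by apply/negbTE; rewrite -leqNgt; lia.
rewrite ltnNge; apply/negP => /leq_sizeP/(_ _ (leqnn _)) /eqP.
by rewrite top oner_eq0.
Qed.

Lemma monic_fibre_a t : @fibre_a K mm t \is monic.
Proof.
rewrite monicE /lead_coef size_fibre_a coef_fibre_a eqxx insubF ?addr0 //.
by rewrite ltnNge leqnSn.
Qed.

Lemma size_fibre_b t : (size (@fibre_b K mm t) <= n.+2)%N.
Proof.
apply/leq_sizeP => j nj; rewrite coef_fibre_b insubF //.
by apply/negbTE; rewrite -leqNgt.
Qed.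

Lemma discE t : @disc K mm t = @fibre_a K mm t ^+ 2 - 4%:R * @fibre_b K mm t.
Proof. by rewrite /disc -mul_polyC polyC_natr. Qed.

Lemma disc_inj t t' : @disc K mm t = @disc K mm t' -> t = t'.
Proof.
rewrite !discE => e; have [] := poly_sqrt_unique (size_fibre_a t) (size_fibre_a t')
  (monic_fibre_a t) (monic_fibre_a t') (size_fibre_b t) (size_fibre_b t') e.
exact: fibre_inj.
Qed.

Lemma disc_nu_point x : @disc K mm (nu_point x) = Wq (x 0) ^+ 2 * cheb_r (Wc (x 0)) (Wsg (x 0)).
Proof. by rewrite discE fibre_a_nu_point fibre_b_nu_point W_disc. Qed.

(** The coefficient of x^(2m-1) in D is twice that of x^(m-1) in a, which the versal family
    lacks. *)
Lemma disc_shape t : size (@disc K mm t) = (n.+2 + n.+2).+1 /\ @disc K mm t \is monic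
  /\ (@disc K mm t)`_(n.+2 + n.+1) = 0.
Proof.
rewrite discE -polyC_natr mul_polyC; set a := @fibre_a K mm t; set b := _ *: _.
have ma : a \is monic := monic_fibre_a t.
have sb : (size b <= n.+2)%N := leq_trans (size_scale_leq _ _) (size_fibre_b t).
have sa2 : size (a ^+ 2) = (n.+2 + n.+2).+1.
  by rewrite expr2 size_mul ?monic_neq0 // !size_fibre_a; lia.
have sba : (size (- b)%R < size (a ^+ 2)%R)%N.
  by rewrite size_polyN sa2; apply: leq_ltn_trans sb _; lia.
split; first by rewrite size_polyDl.
split; first by rewrite monicE lead_coefDl // lead_coef_exp (monicP ma) expr1n.
rewrite coefB [b`__]nth_default ?subr0; last by apply: leq_trans sb _; lia.
rewrite expr2 (_ : (n.+2 + n.+1)%N = (n.+1 + n.+1).+1); last by lia.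
rewrite coefM_subtop ?size_fibre_a //.
have a1 : a`_n.+1 = 0.
  by rewrite coef_fibre_a ltn_eqF // insubF ?addr0 // ltnn.
by rewrite a1 mulr0 mul0r addr0.
Qed.

(** [r] is a monic quadratic, and the vanishing coefficient of x^(2m-1) in D ties its linear term to
    the second coefficient [c] of [q]. So [r] is (x - c)^2 - 4 sigma, with sigma read off from its
    constant term. *)
Lemma disc_factor_nu_point t (q r : {poly K}) : q \is monic -> size q = n.+2 ->
  @disc K mm t = q ^+ 2 * r -> exists x, t = nu_point x.
Proof.
move=> mq sq dE; have [sD [mD D1]] := disc_shape t.
have mr : r \is monic by rewrite -(monicMl _ (monic_exp 2 mq)) -dE.
have sr : size r = 3%N.
  move: sD; rewrite dE size_monicM ?monic_exp ?monic_neq0 // expr2.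
  by rewrite size_monicM ?monic_neq0 // sq; lia.
have r2 : r`_2 = 1 by move/monicP: mr; rewrite /lead_coef sr.
have q1 : q`_n.+1 = 1 by move/monicP: mq; rewrite /lead_coef sq.
have sub : q`_n *+ 2 + r`_1 = 0.
  have q2 : (q * q)`_(n + n).+1 = q`_n *+ 2.
    by rewrite coefM_subtop ?sq // q1 mulr1 mul1r mulr2n.
  have q22 : (q * q)`_(n + n).+2 = 1.
    have : q * q \is monic by rewrite monicMl.
    move/monicP; rewrite /lead_coef size_monicM ?monic_neq0 // sq.
    by rewrite (_ : _.-1.-1 = (n + n).+2) //; lia.
  transitivity ((@disc K mm t)`_(n.+2 + n.+1)); last exact: D1.
  rewrite dE expr2 (_ : (n.+2 + n.+1)%N = ((n + n).+1 + 1).+1); last by lia.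
  rewrite coefM_subtop ?sr //; last by rewrite size_monicM ?monic_neq0 // sq; lia.
  by rewrite q2 q22 r2 mulr1 mul1r addrC.
pose c := q`_n; pose sg := (c ^+ 2 - r`_0) / 4%:R.
have rE : r = cheb_r c sg.
  apply/polyP => j; rewrite /cheb_r -polyC_natr -polyCM.
  have -> : ('X - c%:P) ^+ 2 - (4%:R * sg)%:P = 'X^2 - (c *+ 2) *: 'X + (r`_0)%:P.
    have -> : 4%:R * sg = c ^+ 2 - r`_0 by rewrite /sg; field.
    rewrite polyCB polyC_exp -mul_polyC polyCMn; ring.
  have r1 : r`_1 = - (c *+ 2) by apply/eqP; rewrite -addr_eq0 addrC sub.
  rewrite coefD coefB coefXn coefZ coefX coefC.
  case: j => [|[|[|j]]] //=.
  - by rewrite mulr0 !subrr add0r.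
  - by rewrite mulr1 add0r addr0.
  - by rewrite mulr0 subr0 addr0.
  - by rewrite nth_default ?sr // mulr0 subrr add0r.
have [y [yc ys yq]] := @W_parametrization n K c sg q (eq_leq sq) q1 erefl.
exists (\row_i y i); apply: disc_inj; rewrite disc_nu_point dE rE.
have -> : (\row_i y i) 0 = y by apply/funext => i; rewrite mxE.
by rewrite yc ys yq.
Qed.

Lemma has_nodes_nu_point t : has_nodes (@fibre K mm t) n.+1 -> exists x, t = nu_point x.
Proof.
move=> /has_nodesP[s [us ss sP]].
have [r rE] := double_roots_factor us
  (fun (y : K) ys => let: And3 a b _ := (sP y).2 ys in conj a b).
apply: (disc_factor_nu_point _ _ rE); first exact: monic_prod_XsubC.
by rewrite size_prod_XsubC ss.
Qed.

Lemma has_nodes_top_nu_point t : has_nodes (@fibre K mm t) n.+2 -> exists x, t = nu_point x.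
Proof.
move=> /has_nodesP[s [us ss sP]].
have [r rE] := double_roots_factor us
  (fun (y : K) ys => let: And3 a b _ := (sP y).2 ys in conj a b).
case: s ss rE {us sP} => [//|y s] [ss]; rewrite big_cons => rE.
apply: (@disc_factor_nu_point t (\prod_(z <- s) ('X - z%:P)) (('X - y%:P) ^+ 2 * r)).
- exact: monic_prod_XsubC.
- by rewrite size_prod_XsubC ss.
- by rewrite rE; ring.
Qed.

(** With m double roots D is the square of a monic polynomial of degree m, and uniqueness of the
    polynomial square root gives b = 0. *)
Lemma has_nodes_plane t : has_nodes (@fibre K mm t) n.+2 -> @coordinate_plane K n.+1 n.+1 t.
Proof.
move=> /has_nodesP[s [us ss sP]].
have [r rE] := double_roots_factor us
  (fun (y : K) ys => let: And3 a b _ := (sP y).2 ys in conj a b).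
set q := \prod_(x <- s) _ in rE.
have mq : q \is monic by exact: monic_prod_XsubC.
have sq : size q = n.+3 by rewrite size_prod_XsubC ss.
have [sD [mD _]] := disc_shape t.
have mr : r \is monic by rewrite -(monicMl _ (monic_exp 2 mq)) -rE.
have sr : size r = 1%N.
  move: sD; rewrite rE size_monicM ?monic_exp ?monic_neq0 // expr2.
  rewrite size_monicM ?monic_neq0 // sq; move: (size r) => u; clear; lia.
have r1 : r = 1.
  have [r0 _ rC] := size_poly1P _ (introT eqP sr).
  by move: mr; rewrite rC monicE lead_coefC => /eqP ->.
have [] := @poly_sqrt_unique K n.+2 (@fibre_a K mm t) q (@fibre_b K mm t) 0
  (size_fibre_a t) sq (monic_fibre_a t) mq (size_fibre_b t).
- by rewrite size_poly0.
- by rewrite -discE rE r1 mulr1 mulr0 subr0.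
by move=> _ b0 j; have := coef_fibre_b t j; rewrite b0 coef0 valK => <-.
Qed.

End NodalLoci.

Lemma meval_prod (R : comNzRingType) n (v : 'I_n -> R) I (r : seq I) (P : pred I)
    (F : I -> {mpoly R[n]}) :
  (\prod_(i <- r | P i) F i).@[v] = \prod_(i <- r | P i) (F i).@[v].
Proof. exact: rmorph_prod. Qed.

Lemma mevalXn (R : comNzRingType) n (v : 'I_n -> R) (f : {mpoly R[n]}) k :
  (f ^+ k).@[v] = f.@[v] ^+ k.
Proof. exact: rmorphXn. Qed.

Notation nu_pullback K n := (mmap (@mpolyC n.+2 K) (nu (fun i => 'X_i : {mpoly K[n.+2]}))).

(** * Root coordinates: density of nodal fibres and finiteness of the parametrization *)

Section RootSpace.
Variables (K : numClosedFieldType) (n : nat).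
Hypothesis uncountableK : ~ countable [set: K].
Notation N := (n.+1 + n.+2)%N.
Notation mm := (n.+2).
Notation A := {mpoly K[n.+2]}.
Implicit Types (t : 'rV[K]_N) (x z : 'rV[K]_n.+2).

(* The coordinates on A are now the roots rho of q and a square root tau of sigma,
   in terms of which D splits; theta expresses x by them. *)
Let rho (i : 'I_n.+1) : A := 'X_(lift ord_max i).
Let tau : A := 'X_ord_max.
Let rs : seq A := [seq rho i | i <- enum 'I_n.+1].

Lemma nu_pullback_eval f x : (nu_pullback K n f).@[x 0] = f.@[(nu_point x) 0].
Proof.
rewrite (rmorph_mmap (g := meval (x 0)) (f' := idfun) (h' := (nu_point x) 0)) //.
  by move=> c; exact: mevalC.
move=> i; rewrite mxE (map_nu (meval (x 0))); apply: nu_ext => j.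
exact: mevalXU.
Qed.

Lemma exists_theta : exists theta : 'I_n.+2 -> A,
  [/\ Wc theta = - \sum_i rho i, Wsg theta = tau ^+ 2
    & Wq theta = \prod_i ('X - (rho i)%:P)].
Proof.
have srs : size rs = n.+1 by rewrite size_map size_enum_ord.
have qE : \prod_(i < n.+1) ('X - (rho i)%:P) = \prod_(p <- rs) ('X - p%:P).
  by rewrite big_map big_enum.
have sE : \sum_(i < n.+1) rho i = \sum_(p <- rs) p by rewrite big_map big_enum.
rewrite qE sE; apply: W_parametrization.
- by rewrite size_prod_XsubC srs.
- have := monic_prod_XsubC rs xpredT id => /monicP.
  by rewrite /lead_coef size_prod_XsubC srs.
- by have := @coefPn_prod_XsubC _ rs; rewrite srs; apply.
Qed.

Variable theta : 'I_n.+2 -> A.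
Hypotheses (thc : Wc theta = - \sum_i rho i) (ths : Wsg theta = tau ^+ 2)
  (thq : Wq theta = \prod_i ('X - (rho i)%:P)).

Let th z : 'rV[K]_n.+2 := \row_i (theta i).@[z 0].
Let zr z (i : 'I_n.+1) : K := z 0 (lift ord_max i).

Let thE z : (th z) 0 = meval (z 0) \o theta.
Proof. by apply/funext => i; rewrite mxE. Qed.

Let th_c z : Wc ((th z) 0) = - \sum_i zr z i.
Proof.
rewrite thE -[Wc _]/((Wc theta).@[z 0]) thc mevalN meval_sum.
by congr (- _); apply: eq_bigr => i _; rewrite mevalXU.
Qed.

Let th_s z : Wsg ((th z) 0) = z 0 ord_max ^+ 2.
Proof. by rewrite thE -[Wsg _]/((Wsg theta).@[z 0]) ths mevalXn /= mevalXU. Qed.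

Let th_q z : Wq ((th z) 0) = \prod_i ('X - (zr z i)%:P).
Proof.
rewrite thE -(map_Wq (meval (z 0)) theta) thq rmorph_prod; apply: eq_bigr => i _.
by rewrite rmorphB /= map_polyX map_polyC /= mevalXU.
Qed.

Let coef_Wq_sum (s : seq K) : size s = n.+1 ->
  (\prod_(y <- s) ('X - y%:P))`_n = - \sum_(y <- s) y.
Proof. by move=> ss; have := @coefPn_prod_XsubC _ s; rewrite ss; apply. Qed.

Let seq_roots (s : seq K) (tt : K) : size s = n.+1 ->
  exists z, z 0 ord_max = tt /\ forall i, zr z i = s`_i.
Proof.
move=> ss; exists (\row_i (if unlift ord_max i is Some j then s`_j else tt)).
by split=> [|i]; rewrite /zr !mxE ?unlift_none ?liftK.
Qed.

Let big_roots (T : Type) (idx : T) (op : Monoid.com_law idx) z (s : seq K) (F : K -> T) :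
  size s = n.+1 -> (forall i, zr z i = s`_i) ->
  \big[op/idx]_i F (zr z i) = \big[op/idx]_(y <- s) F y.
Proof.
move=> ss zs; rewrite [RHS](big_nth 0) big_mkord ss; apply: eq_bigr => i _.
by rewrite zs.
Qed.

Let th_surj x : exists z, th z = x.
Proof.
have [s sE] := closed_field_poly_normal (Wq (x 0)).
have mq : lead_coef (Wq (x 0)) = 1.
  rewrite /lead_coef; have -> : size (Wq (x 0)) = n.+2.
    apply/eqP; rewrite eqn_leq size_Wq ltnNge; apply/negP => /leq_sizeP/(_ _ (leqnn _))/eqP.
    by rewrite coef_Wq_top oner_eq0.
  by rewrite coef_Wq_top.
have ss : size s = n.+1.
  have := coef_Wq_top (x 0); rewrite sE mq scale1r => top.
  have /eqP := size_prod_XsubC s id.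
  have : (n.+1 < size (\prod_(y <- s) ('X - y%:P))%R)%N.
    by rewrite ltnNge; apply/negP => /leq_sizeP/(_ _ (leqnn _))/eqP; rewrite top oner_eq0.
  rewrite size_prod_XsubC ltnS leq_eqVlt => /predU1P[-> //|lt _].
  have := size_Wq (x 0); rewrite sE mq scale1r size_prod_XsubC ltnS => le.
  by apply/eqP; rewrite eqn_leq le ltnW.
have [z [zt zs]] := seq_roots (sqrtC (Wsg (x 0))) ss.
exists z; apply/rowP; apply: W_inj.
- rewrite th_c (big_roots _ id ss zs) -coef_Wq_sum // -coef_Wq_pred sE mq scale1r.
  by [].
- by rewrite th_s zt sqrtCK.
- by rewrite th_q (big_roots _ (fun y => 'X - y%:P) ss zs) sE mq scale1r.
Qed.

(* f \o nu \o theta vanishes wherever D is nonzero, hence everywhere. *)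
Let density (f : {mpoly K[N]}) (D : A) : D != 0 ->
  (forall z, D.@[z 0] != 0 -> f.@[(nu_point (th z)) 0] = 0) -> forall x, f.@[(nu_point x) 0] = 0.
Proof.
move=> D0 fD x; have [z <-] := th_surj x.
pose F : A := mmap (@mpolyC n.+2 K) theta (nu_pullback K n f).
have FE (y : 'rV[K]_n.+2) : F.@[y 0] = f.@[(nu_point (th y)) 0].
  rewrite -nu_pullback_eval (rmorph_mmap (g := meval (y 0)) (f' := idfun) (h' := (th y) 0)) //.
    by move=> c; exact: mevalC.
  by move=> i; rewrite mxE.
have FD : F * D = 0.
  apply: (mpoly_eval_eq0 uncountableK) => y; rewrite mevalM FE.
  by have [->|/fD ->] := eqVneq D.@[y 0] 0; rewrite ?mulr0 ?mul0r.
by move/eqP: FD; rewrite mulf_eq0 (negPf D0) orbF => /eqP F0; rewrite -FE F0 meval0.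
Qed.

Let zr_distinct : A := \prod_i \prod_(j | j != i) (rho i - rho j).

Let zr_distinctP z : zr_distinct.@[z 0] != 0 -> uniq [seq zr z i | i <- enum 'I_n.+1].
Proof.
rewrite meval_prod => /prodf_neq0 H; rewrite map_inj_uniq ?enum_uniq // => i j e.
apply/eqP/negPn/negP => ij; have := H i isT; rewrite meval_prod => /prodf_neq0/(_ j).
by rewrite eq_sym ij mevalB !mevalXU -/(zr z i) -/(zr z j) e subrr eqxx => /(_ isT).
Qed.

Let mpoly_neq0 (f : A) z : f.@[z 0] != 0 -> f != 0.
Proof. by apply: contra => /eqP ->; rewrite meval0. Qed.

Let zr_distinct_neq0 : zr_distinct != 0.
Proof.
apply/prodf_neq0 => i _; apply/prodf_neq0 => j ji.
apply: (@mpoly_neq0 _ (delta_mx 0 (lift ord_max i))).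
rewrite mevalB !mevalXU !mxE !eqxx /= (inj_eq lift_inj) (negPf ji) subr0.
exact: oner_neq0.
Qed.

Let cpoly : A := - \sum_i rho i.

(** The three conditions say that the roots of q are distinct, that none is a root of r, and that r
    has no double root. The double roots of D are then exactly those of q. *)
Let generic_nodes z : zr_distinct.@[z 0] != 0 ->
  (\prod_i ((rho i - cpoly) ^+ 2 - 4%:R * tau ^+ 2)).@[z 0] != 0 -> tau.@[z 0] != 0 ->
  has_nodes (@fibre K mm (nu_point (th z))) n.+1.
Proof.
move=> z1 z2 z3; apply/has_nodesP; exists [seq zr z i | i <- enum 'I_n.+1].
have rE y : (cheb_r (Wc ((th z) 0)) (Wsg ((th z) 0))).[y] =
    (y - cpoly.@[z 0]) ^+ 2 - 4%:R * tau.@[z 0] ^+ 2.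
  rewrite /cheb_r -polyC_natr -polyCM hornerD hornerN hornerC horner_exp hornerXsubC.
  rewrite th_c th_s mevalXU mevalN meval_sum.
  by congr ((_ - - _) ^+ 2 - _); apply: eq_bigr => i _; rewrite mevalXU.
split; [exact: zr_distinctP|by rewrite size_map size_enum_ord|move=> y].
rewrite disc_nu_point th_q -[X in X ^+ 2](big_map (zr z) xpredT (fun y => 'X - y%:P)).
rewrite [X in \prod_(_ <- X) _](_ : _ = [seq zr z i | i <- enum 'I_n.+1]); last first.
  by rewrite enumT.
apply: exact_double_root_sqr; first exact: zr_distinctP.
  move=> w /mapP[i _ ->]; rewrite rE.
  move: z2; rewrite meval_prod => /prodf_neq0/(_ i isT).
  by rewrite mevalB mevalXn mevalB mevalM mevalXn [(rho i).@[_]]mevalXU rmorph_nat.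
move=> w; rewrite rE => rw; rewrite /cheb_r -polyC_natr -polyCM derivB derivC subr0.
rewrite expr2 derivM derivXsubC mul1r mulr1 hornerD !hornerXsubC -mulr2n mulrn_eq0 /=.
apply/eqP => wc; move/eqP: rw.
have -> : cpoly.@[z 0] = Wc ((th z) 0).
  by rewrite th_c mevalN meval_sum; congr (- _); apply: eq_bigr => i _; rewrite mevalXU.
by rewrite wc expr0n sub0r oppr_eq0 mulf_eq0 pnatr_eq0 expf_eq0 (negPf z3).
Qed.

Let generic_neq0 : \prod_i ((rho i - cpoly) ^+ 2 - 4%:R * tau ^+ 2) != 0.
Proof.
apply/prodf_neq0 => i _; apply: (@mpoly_neq0 _ (delta_mx 0 ord_max)).
have rho0 j : (rho j).@[(delta_mx 0 ord_max : 'rV[K]_n.+2) 0] = 0.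
  by rewrite mevalXU mxE eqxx /= eq_sym (negPf (neq_lift _ _)).
rewrite mevalB mevalXn mevalB mevalN meval_sum big1 // mevalM mevalXn.
rewrite rho0 oppr0 subr0 expr0n sub0r oppr_eq0 mevalXU mxE !eqxx expr1n mulr1.
by rewrite rmorph_nat pnatr_eq0.
Qed.

Lemma nu_point_nodal x : nodal_locus K mm n.+1 (nu_point x).
Proof.
move=> _ [F ->] sub f Ff; move: x.
pose D := zr_distinct * \prod_i ((rho i - cpoly) ^+ 2 - 4%:R * tau ^+ 2) * tau.
apply: (@density f D).
  apply: mulf_neq0 (mulf_neq0 zr_distinct_neq0 generic_neq0) _.
  by apply: (@mpoly_neq0 _ (delta_mx 0 ord_max)); rewrite mevalXU mxE !eqxx oner_neq0.
move=> z; rewrite !mevalM !mulf_eq0 !negb_or => /andP[/andP[z1 z2] z3].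
by apply: sub Ff; exact: generic_nodes.
Qed.

Let th0 z : 'rV[K]_n.+2 := \row_i (if i == ord_max then 0 else z 0 i).

Let zr_th0 z i : zr (th0 z) i = zr z i.
Proof. by rewrite /zr mxE eq_sym (negPf (neq_lift _ _)). Qed.

(** When b = 0, D = a^2 and the m roots of a have sum 0. Take m - 1 of them as roots of q; the last
    one is then c, so [t] comes from a point with tau = 0. The density argument is repeated inside
    this hyperplane, where generic points have m nodes. *)
Lemma plane_nodal t : @coordinate_plane K n.+1 n.+1 t -> nodal_locus K mm n.+2 t.
Proof.
move=> pt _ [F ->] sub f Ff.
have [s sE] := closed_field_poly_normal (@fibre_a K mm t).
rewrite (monicP (monic_fibre_a t)) scale1r in sE.
have ss : size s = n.+2 by have := size_fibre_a t; rewrite sE size_prod_XsubC => -[].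
have ssum : \sum_(y <- s) y = 0.
  have := @coefPn_prod_XsubC _ s; rewrite ss -sE /= coef_fibre_a ltn_eqF // insubF ?ltnn //.
  by rewrite addr0 => /(_ isT) /esym/eqP; rewrite oppr_eq0 => /eqP.
case: s ss sE ssum => [//|y0 s] [ss] sE ssum.
have [z [zt zs]] := seq_roots 0 ss.
have tE : t = nu_point (th (th0 z)).
  apply: disc_inj; rewrite disc_nu_point discE.
  have -> : @fibre_b K mm t = 0.
    apply/polyP => j; rewrite coef_fibre_b coef0; case: insubP => // i _ _; exact: pt.
  rewrite mulr0 subr0 th_s mxE eqxx /cheb_r expr0n polyC0 mulr0 subr0 -exprMn; congr (_ ^+ 2).
  rewrite sE big_cons mulrC th_q; congr (_ * _).
    rewrite -(big_roots _ (fun y => 'X - y%:P) ss zs).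
    by apply: eq_bigr => i _; rewrite zr_th0.
  congr ('X - _%:P); rewrite th_c (eq_bigr (zr z)) => [|i _]; last exact: zr_th0.
  rewrite (big_roots _ id ss zs); apply/eqP; rewrite -addr_eq0.
  by rewrite big_cons in ssum; rewrite ssum.
(* Where [D] does not vanish, the m - 1 roots of q are distinct and differ from c, so a has m
   distinct roots. *)
pose D := zr_distinct * \prod_i (rho i - cpoly).
pose h (i : 'I_n.+2) : A := if i == ord_max then 0 else 'X_i.
pose G : A := mmap (@mpolyC n.+2 K) h (mmap (@mpolyC n.+2 K) theta (nu_pullback K n f)).
have GE (w : 'rV[K]_n.+2) : G.@[w 0] = f.@[(nu_point (th (th0 w))) 0].
  rewrite -nu_pullback_eval (rmorph_mmap (g := meval (w 0)) (f' := idfun) (h' := (th0 w) 0)) //.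
  - rewrite -[mmap _ _ _]/(meval _ _).
    rewrite (rmorph_mmap (g := meval ((th0 w) 0)) (f' := idfun) (h' := (th (th0 w)) 0)) //.
      by move=> c; exact: mevalC.
    by move=> i; rewrite mxE.
  - by move=> c; exact: mevalC.
  - by move=> i; rewrite mxE /h; case: eqP => _; [exact: meval0|exact: mevalXU].
have D0 : D != 0.
  rewrite mulf_neq0 //; apply/prodf_neq0 => i _.
  apply: (@mpoly_neq0 _ (delta_mx 0 (lift ord_max i))).
  rewrite mevalB mevalN meval_sum mevalXU mxE !eqxx /= (bigD1 i) //= big1 => [|j ji].
    by rewrite mevalXU mxE !eqxx addr0 opprK -(natrD _ 1 1) pnatr_eq0.
  by rewrite mevalXU mxE (inj_eq lift_inj) (negPf ji) andbF.
suff GD : G * D = 0.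
  by move/eqP: GD; rewrite mulf_eq0 (negPf D0) orbF tE -GE => /eqP ->; rewrite meval0.
apply: (mpoly_eval_eq0 uncountableK) => w; rewrite mevalM GE.
have [->|] := eqVneq D.@[w 0] 0; first by rewrite mulr0.
rewrite mevalM mulf_eq0 negb_or => /andP[w1 w2].
suff ndl : has_nodes (@fibre K mm (nu_point (th (th0 w)))) n.+2.
  by rewrite (sub _ ndl) ?mul0r.
pose c := Wc ((th w) 0).
have cE : cpoly.@[w 0] = c.
  by rewrite /c th_c mevalN meval_sum; congr (- _); apply: eq_bigr => i _; rewrite mevalXU.
have cu : uniq (c :: [seq zr w i | i <- enum 'I_n.+1]).
  rewrite /= zr_distinctP // andbT; apply/negP => /mapP[i _ ci].
  move: w2; rewrite meval_prod => /prodf_neq0/(_ i isT).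
  by rewrite mevalB cE mevalXU -/(zr w i) ci subrr eqxx.
apply/has_nodesP; exists (c :: [seq zr w i | i <- enum 'I_n.+1]); split=> //.
  by rewrite /= size_map size_enum_ord.
move=> y; rewrite disc_nu_point th_s mxE eqxx /cheb_r expr0n polyC0 mulr0 subr0.
have -> : Wq ((th (th0 w)) 0) = \prod_(y <- [seq zr w i | i <- enum 'I_n.+1]) ('X - y%:P).
  by rewrite th_q big_map big_enum; apply: eq_bigr => i _; rewrite zr_th0.
have -> : Wc ((th (th0 w)) 0) = c.
  by rewrite /c !th_c; congr (- _); apply: eq_bigr => i _; rewrite zr_th0.
rewrite -exprMn mulrC -(big_cons _ _ c _ xpredT (fun y => 'X - y%:P)) -[_ ^+ 2]mulr1.
apply: exact_double_root_sqr => // [v _|v]; rewrite hornerC; first exact: oner_neq0.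
by move/eqP; rewrite oner_eq0.
Qed.

Notation pullth := (mmap (@mpolyC n.+2 K) (nu theta)).
Notation int := (integralOver (pullth : {mpoly K[N]} -> A)).

Let mmapXU (S : comNzRingType) (f : {rmorphism K -> S}) k (h : 'I_k -> S) (i : 'I_k) :
  mmap f h 'X_i = h i.
Proof. by rewrite mmapX mmap1U. Qed.

Let int_const (k : K) : int k%:MP.
Proof. by rewrite -(mmapC (nu theta) (@mpolyC n.+2 K)); exact: integral_id. Qed.

Let int_Wa j : int (Wa theta)`_j.
Proof.
have [jn|] := ltnP j n.+1.
  rewrite -[j]/(val (Ordinal jn)) -nu_l -(mmapXU (@mpolyC n.+2 K) (nu theta)).
  exact: integral_id.
rewrite leq_eqVlt => /predU1P[<-|]; first by rewrite coef_Wa_pred; exact: integral0.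
rewrite leq_eqVlt => /predU1P[<-|nj]; first by rewrite coef_Wa_top; exact: integral1.
by rewrite nth_default ?(leq_trans (size_Wa _)) //; exact: integral0.
Qed.

Let int_Wb j : int (Wb theta)`_j.
Proof.
have [jn|nj] := ltnP j n.+2.
  rewrite -[j]/(val (Ordinal jn)) -nu_r -(mmapXU (@mpolyC n.+2 K) (nu theta)).
  exact: integral_id.
by rewrite nth_default ?(leq_trans (size_Wb _)) //; exact: integral0.
Qed.

Let sqr_disc : cheb_r (Wc theta) (Wsg theta) =
  ('X - (Wc theta + 2%:R * tau)%:P) * ('X - (Wc theta - 2%:R * tau)%:P).
Proof. by rewrite /cheb_r ths !(polyCD, polyCN, polyCM, polyC_exp, polyC_natr); ring. Qed.

Let D : {poly A} := Wa theta ^+ 2 - 4%:R * Wb theta.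

(** [D] is monic and its coefficients are polynomials in the alpha and beta. All its roots, the
    [rho i] and c + 2 tau, c - 2 tau, are therefore integral, and they generate the ring of root
    coordinates. *)
Let int_root (u : A) : root D u -> int u.
Proof.
move=> rDu; apply: (integral_root_monic _ rDu).
  rewrite /D W_disc sqr_disc thq; apply: rpredM; last by apply: rpredM; exact: monicXsubC.
  by apply: monic_exp; exact: monic_prod_XsubC.
apply/integral_poly => j; rewrite coefB expr2 coefM -polyC_natr coefCM.
apply: integral_sub; last first.
  apply: integral_mul; last exact: int_Wb.
  by rewrite -mpolyC_nat; exact: int_const.
by apply: (big_ind int) => [|v w|k _];
  [exact: integral0|exact: integral_add|exact: integral_mul (int_Wa _) (int_Wa _)].
Qed.

Let int_rho i : int (rho i).
Proof.
apply: int_root; rewrite /D W_disc thq rootM; apply/orP; left.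
rewrite expr2 rootM; apply/orP; left; rewrite (bigD1 i) //= rootM; apply/orP; left.
by rewrite root_XsubC.
Qed.

Let int_tau : int tau.
Proof.
have int4 : int (4%:R^-1)%:MP := int_const _.
have iu : int (Wc theta + 2%:R * tau).
  apply: int_root; rewrite /D W_disc sqr_disc rootM; apply/orP; right.
  by rewrite rootM; apply/orP; left; rewrite root_XsubC.
have iv : int (Wc theta - 2%:R * tau).
  apply: int_root; rewrite /D W_disc sqr_disc rootM; apply/orP; right.
  by rewrite rootM; apply/orP; right; rewrite root_XsubC.
have -> : tau = (4%:R^-1)%:MP * (Wc theta + 2%:R * tau - (Wc theta - 2%:R * tau)).
  transitivity ((4%:R^-1)%:MP * (4%:R)%:MP * tau : A).
    by rewrite -mpolyCM mulVf ?pnatr_eq0 // mpolyC1 mul1r.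
  rewrite mpolyC_nat; ring.
by apply: integral_mul => //; exact: integral_sub.
Qed.

Let int_all (w : A) : int w.
Proof.
rewrite -(mmap_id w) /mmap; apply: (big_ind int) => [|u v|m _].
- exact: integral0.
- exact: integral_add.
apply: integral_mul; first exact: int_const.
apply: (big_ind int) => [|u v|i _]; [exact: integral1|exact: integral_mul|].
have int_X : int 'X_i by case: (unliftP ord_max i) => [k|] ->; [exact: int_rho|exact: int_tau].
by elim: (m i) => [|k IHk]; [rewrite expr0; exact: integral1|rewrite exprS; exact: integral_mul].
Qed.

(** The integral equation of [theta i] transfers to ['X_i] because every point [x] is some [th z],
    so the equation for ['X_i] holds at every point. *)
Lemma coordinate_integral (i : 'I_n.+2) : exists2 chi : {poly {mpoly K[N]}},
  chi \is monic & (map_poly (nu_pullback K n) chi).['X_i] = 0.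
Proof.
have [chi mchi /eqP rchi] := int_all (theta i); exists chi => //.
apply: (mpoly_eval_eq0 uncountableK) => x; have [z <-] := th_surj x.
have pe (f : {mpoly K[N]}) : (nu_pullback K n f).@[(th z) 0] = (pullth f).@[z 0].
  rewrite nu_pullback_eval.
  rewrite (rmorph_mmap (g := meval (z 0)) (f' := idfun) (h' := (nu_point (th z)) 0)) //.
    by move=> c; exact: mevalC.
  by move=> k; rewrite mxE (map_nu (meval (z 0))) thE.
have Xe : ('X_i : A).@[(th z) 0] = (theta i).@[z 0] by rewrite mevalXU mxE.
have mape : map_poly (meval ((th z) 0)) (map_poly (nu_pullback K n) chi) =
    map_poly (meval (z 0)) (map_poly pullth chi).
  apply/polyP => j.
  rewrite [LHS](coef_map (meval ((th z) 0))).
  rewrite [RHS](coef_map (meval (z 0))).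
  exact: (etrans (congr1 (meval ((th z) 0)) (coef_map (nu_pullback K n) chi j))
    (etrans (pe chi`_j) (congr1 (meval (z 0)) (esym (coef_map pullth chi j))))).
rewrite -(horner_map (meval ((th z) 0))) mape.
rewrite -[X in _.[X]]/(('X_i : A).@[(th z) 0]) Xe.
apply: etrans (horner_map (meval (z 0)) (map_poly pullth chi) (theta i)) _.
by rewrite rchi; exact: meval0.
Qed.

End RootSpace.

(** * Descent along a finite map *)

Section FiniteMap.
Variables (K : closedFieldType) (N k : nat).
Hypothesis uncountableK : ~ countable [set: K].
Notation B := {mpoly K[N]}.
Notation A := {mpoly K[k]}.
Variables (phi : {rmorphism B -> A}) (pt : 'rV[K]_k -> 'rV[K]_N).
Hypothesis phi_const : forall c : K, phi c%:MP = c%:MP.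
Hypothesis phi_eval : forall (f : B) (x : 'rV[K]_k), (phi f).@[x 0] = f.@[(pt x) 0].
Hypothesis integralX : forall i : 'I_k, exists2 chi : {poly B},
  chi \is monic & (map_poly phi chi).['X_i] = 0.

(** The monomials with all exponents at most D generate. Having 1 among them and the others vanish
    at 0 is what [local_isomorphism] relies on. *)
Lemma finite_generators : exists (r : nat) (w : 'I_r -> A) (i0 : 'I_r),
  [/\ w i0 = 1, forall i, i != i0 -> (w i).@[(0 : 'rV[K]_k) 0] = 0
    & forall a, exists b : 'I_r -> B, a = \sum_i phi (b i) * w i].
Proof.
have [D powD] : exists D, forall i : 'I_k, exists b : 'I_D.+1 -> B,
    ('X_i : A) ^+ D.+1 = \sum_j phi (b j) * 'X_i ^+ j.
  have powd (i : 'I_k) : exists d, forall D, (d <= D)%N -> exists b : 'I_D.+1 -> B,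
      ('X_i : A) ^+ D.+1 = \sum_j phi (b j) * 'X_i ^+ j.
    have [chi mchi rchi] := integralX i; exists (size chi) => D leD.
    (* Multiplying by a power of X brings the integral equations of all coordinates to the common
       degree D + 1. *)
    pose psi := chi * 'X^(D.+2 - size chi).
    have mpsi : psi \is monic by apply: rpredM => //; exact: monicXn.
    have spsi : size psi = D.+2.
      by rewrite size_monicM ?monic_neq0 ?monicXn // size_polyXn addnS subnKC // ltnW // ltnS ltnW.
    have rpsi : (map_poly phi psi).['X_i] = 0.
      by rewrite rmorphM hornerM rchi mul0r.
    exists (fun j : 'I_D.+1 => - psi`_j).
    move: rpsi; rewrite (horner_coef_wide _ (n := D.+2)); last first.
      by rewrite size_map_poly_id0 ?spsi // (monicP mpsi) rmorph1 oner_neq0.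
    rewrite big_ord_recr /= [(map_poly phi psi)`_D.+1]coef_map.
    have -> : psi`_D.+1 = 1 by move/monicP: mpsi; rewrite /lead_coef spsi.
    rewrite -[X in _ + X * _]/(phi 1) rmorph1 mul1r => /eqP; rewrite addrC addr_eq0 => /eqP ->.
    by rewrite -sumrN; apply: eq_bigr => j _; rewrite coef_map rmorphN mulNr.
  have [d dP] := choice powd.
  by exists (\max_i d i)%N => i; apply: dP; exact: leq_bigmax.
pose E := {ffun 'I_k -> 'I_D.+1}.
pose w (e : E) : A := \prod_i 'X_i ^+ e i.
pose S := [set a : A | exists b : E -> B, a = \sum_e phi (b e) * w e].
have S0 : S 0 by exists (fun=> 0); rewrite big1 // => e _; rewrite rmorph0 mul0r.
have SD a a' : S a -> S a' -> S (a + a').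
  move=> [b ->] [b' ->]; exists (fun e => b e + b' e); rewrite -big_split.
  by apply: eq_bigr => e _; rewrite rmorphD mulrDl.
have SZ c a : S a -> S (phi c * a).
  move=> [b ->]; exists (fun e => c * b e); rewrite mulr_sumr.
  by apply: eq_bigr => e _; rewrite rmorphM mulrA.
have Sw e : S (w e).
  exists (fun e' => (e' == e)%:R); rewrite (bigD1 e) //= eqxx rmorph1 mul1r.
  by rewrite big1 ?addr0 // => e' /negPf ->; rewrite rmorph0 mul0r.
have wD1 e i : w e = 'X_i ^+ e i * \prod_(j | j != i) 'X_j ^+ e j.
  by rewrite /w (bigD1 i).
pose upd (e : E) i (l : 'I_D.+1) : E := [ffun j => if j == i then l else e j].
have w_upd e i l : w (upd e i l) = 'X_i ^+ l * \prod_(j | j != i) 'X_j ^+ e j.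
  rewrite (wD1 _ i) ffunE eqxx; congr (_ * _); apply: eq_bigr => j /negPf ji.
  by rewrite ffunE ji.
have Ssum (I : Type) (s : seq I) (F : I -> A) : (forall i, S (F i)) -> S (\sum_(i <- s) F i).
  by move=> SF; apply: (big_ind S) => // i _.
have SX i a : S a -> S ('X_i * a).
  move=> [b ->]; rewrite mulr_sumr; apply: (Ssum) => e; rewrite mulrCA; apply: (SZ).
  rewrite (wD1 e i) mulrA -exprS.
  have [lt|ge] := ltnP (e i) D.
    have -> : (e i).+1 = nat_of_ord (inord (e i).+1 : 'I_D.+1) by rewrite inordK.
    by rewrite -w_upd.
  have -> : e i = D :> nat by apply/eqP; rewrite eqn_leq ge -ltnS ltn_ord.
  have [bi ->] := powD i; rewrite mulr_suml; apply: (Ssum) => j.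
  by rewrite -mulrA; apply: (SZ); rewrite -w_upd.
have SXn i l a : S a -> S ('X_i ^+ l * a).
  by move=> Sa; elim: l => [|l IHl]; rewrite ?mul1r // exprS -mulrA; exact: SX.
pose e0 : E := [ffun=> ord0].
have we0 : w e0 = 1 by rewrite /w big1 // => i _; rewrite ffunE expr0.
have Sall a : S a.
  rewrite -(mmap_id a); apply: (Ssum) => m; rewrite -phi_const; apply: (SZ).
  rewrite /mmap1 -[X in S X]mulr1; elim: (index_enum _) => [|i s IHs].
    by rewrite big_nil mul1r -we0.
  by rewrite big_cons -mulrA; exact: SXn.
exists #|E|, (w \o enum_val), (enum_rank e0); split=> [|i ne|a].
- by rewrite /= enum_rankK.
- have /ffunP : enum_val i <> e0 by move=> e; rewrite -e enum_valK eqxx in ne.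
  move=> /= ne'; have [j ej] : exists j, (enum_val i : E) j != ord0.
    apply: contrapT => /forallNP H; apply: ne' => j; rewrite ffunE.
    by apply/eqP/negPn/negP; exact: H.
  rewrite (wD1 _ j) mevalM (rmorphXn (meval _)) /= mevalXU mxE expr0n.
  by move: ej; rewrite -val_eqE /= => /negPf ->; rewrite mul0r.
- have [b ->] := Sall a; exists (b \o enum_val).
  rewrite (reindex_onto enum_val enum_rank) //= => [|e _]; rewrite ?enum_rankK //.
  by apply: eq_bigl => i; rewrite enum_valK eqxx.
Qed.

(* The determinant trick turns 1 \in P + m_y A into an element of 1 + m_y. *)
Lemma finite_fibre (P : set A) (y : 'rV[K]_N) : ideal P ->
    (forall x : 'rV[K]_k, (forall f, P f -> f.@[x 0] = 0) -> pt x <> y) ->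
  exists G : B, G.@[y 0] = 1 /\ P (phi G).
Proof.
move=> idP nox; have [r [w [i0 [w0 _ gen]]]] := finite_generators.
pose my j : B := 'X_j - (y 0 j)%:MP.
pose I := [set a : A | exists p (u : 'I_N -> A), P p /\ a = p + \sum_j phi (my j) * u j].
have idI : ideal I.
  split.
  - exists 0, (fun=> 0); split; first exact: idl0.
    by rewrite add0r big1 // => j _; rewrite mulr0.
  - move=> _ _ [p [u [Pp ->]]] [p' [u' [Pp' ->]]]; exists (p + p'), (fun j => u j + u' j).
    split; first exact: idlD.
    by rewrite addrACA -big_split; congr (_ + _); apply: eq_bigr => j _; rewrite mulrDr.
  - move=> a _ [p [u [Pp ->]]]; exists (a * p), (fun j => a * u j); split; first exact: idlMl.
    by rewrite mulrDr mulr_sumr; congr (_ + _); apply: eq_bigr => j _; rewrite mulrCA.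
have [p [u [Pp I1]]] : I 1.
  apply: contrapT => nI.
  have [|x [Ix _]] := nullstellensatz uncountableK (h := 1) idI.
    by move=> l; rewrite expr1n.
  apply: (nox x) => [f Pf|].
    by apply: Ix; exists f, (fun=> 0); split=> //; rewrite big1 ?addr0 // => j _; rewrite mulr0.
  apply/rowP => j; apply/eqP; rewrite -subr_eq0; apply/eqP.
  have <- : (phi (my j)).@[x 0] = 0.
    apply: Ix; exists 0, (fun l => (l == j)%:R); split; first exact: idl0.
    by rewrite add0r (bigD1 j) //= eqxx mulr1 big1 ?addr0 // => l /negPf ->; rewrite mulr0.
  by rewrite phi_eval mevalB mevalXU mevalC.
have [b bE] := choice (fun ji : 'I_N * 'I_r => gen (u ji.1 * w ji.2)).
(* By [I1], one minus the sum of the [phi (my j) * u j] is [p]. So [M] describes multiplication by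
   [p] on the generators, and it is the identity at [y]. *)
pose M := \matrix_(i, l) ((i == l)%:R - \sum_j my j * b (j, i) l).
exists (\det M); split.
  rewrite meval_det (_ : matrix_of_fun _ _ = 1%:M) ?det1 //.
  apply/matrixP => i l; rewrite !mxE mevalB meval_sum big1 => [|j _].
    by rewrite subr0; case: eqP => _; rewrite ?meval1 ?meval0.
  by rewrite mevalM mevalB mevalXU mevalC subrr mul0r.
rewrite -(mulr1 (phi _)) -w0; apply: (@det_trick _ _ phi P r M w).
- exact: idl0.
- exact: idlD.
- by move=> a x; exact: idlMl.
move=> i; have -> : \sum_l phi (M i l) * w l = p * w i; last exact: idlMr.
transitivity (w i - \sum_j phi (my j) * (u j * w i)).
  under eq_bigr do rewrite mxE rmorphB mulrBl; rewrite sumrB; congr (_ - _).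
    rewrite (bigD1 i) //= eqxx rmorph1 mul1r big1 ?addr0 // => l.
    by rewrite eq_sym => /negPf ->; rewrite rmorph0 mul0r.
  transitivity (\sum_l \sum_j phi (my j) * (phi (b (j, i) l) * w l)).
    apply: eq_bigr => l _; rewrite rmorph_sum mulr_suml.
    by apply: eq_bigr => j _; rewrite rmorphM mulrA.
  rewrite exchange_big; apply: eq_bigr => j _.
  by rewrite -mulr_sumr (bE (j, i)).
rewrite -{1}(mul1r (w i)) I1 mulrDl -addrA mulr_suml -sumrB big1 ?addr0 // => j _.
by rewrite mulrA subrr.
Qed.

Hypothesis pt0 : forall x, pt x = 0 <-> x = 0.

(** The origin is the only point over the origin and [g] does not vanish there, so the ideal
    generated by [g] has no zero in that fibre and [finite_fibre] applies. Denominators upstairs can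
    thus be replaced by ones from [B]. *)
Lemma norm_multiple (g : A) : g.@[(0 : 'rV[K]_k) 0] != 0 ->
  exists (G : B) (g' : A), G.@[(0 : 'rV[K]_N) 0] = 1 /\ phi G = g' * g.
Proof.
move=> g0; have [||G [G0 [c cE]]] := @finite_fibre [set f | exists c, f = c * g] 0.
- split; first by exists 0; rewrite mul0r.
    by move=> _ _ [c ->] [d ->]; exists (c + d); rewrite mulrDl.
  by move=> a _ [c ->]; exists (a * c); rewrite mulrA.
- move=> x gx ptx; have x0 := (pt0 x).1 ptx; move: g0; rewrite -x0 gx ?eqxx //.
  by exists 1; rewrite mul1r.
by exists G, c.
Qed.

Variables (p : set A) (s : B).
Hypotheses (prp : prime_ideal p) (s0 : s.@[(0 : 'rV[K]_N) 0] = 0).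
Hypothesis div : forall a, a.@[(0 : 'rV[K]_k) 0] = 0 ->
  exists g v, g.@[(0 : 'rV[K]_k) 0] != 0 /\ p (g * a - phi s * v).
Let idp := prime_ideal_ideal prp.

Let divB a : a.@[(0 : 'rV[K]_k) 0] = 0 ->
  exists (G : B) (v : A), G.@[(0 : 'rV[K]_N) 0] = 1 /\ p (phi G * a - phi s * v).
Proof.
move=> /div[g [v [g0 pg]]]; have [G [g' [G0 GE]]] := norm_multiple g0.
exists G, (g' * v); split=> //; rewrite GE mulrCA -mulrA -mulrBr.
exact: idlMl.
Qed.

(** Generators other than 1 vanish at 0, so by [divB] they lie in [phi s * A] modulo [p], up to a
    multiplier from [B]. Near 0, then, A modulo [p] is the image of B plus s A, and Nakayama's lemma
    over B leaves the image of B alone. *)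
Lemma local_isomorphism : exists d : B, d.@[(0 : 'rV[K]_N) 0] = 1 /\
  forall a, exists e, p (phi d * a - phi e).
Proof.
have [r [w [i0 [w0 wi gen]]]] := finite_generators.
have rows i : exists (G : B) (b : 'I_r -> B), G.@[(0 : 'rV[K]_N) 0] = 1 /\
    exists e, p (phi G * w i - phi s * \sum_l phi (b l) * w l - phi e).
  have [->|ne] := eqVneq i i0.
    exists 1, (fun=> 0); rewrite meval1; split=> //; exists 1.
    rewrite w0 rmorph1 mul1r big1 ?mulr0 ?subr0 ?subrr; first exact: idl0.
    by move=> l _; rewrite rmorph0 mul0r.
  have [G [v [G0 pG]]] := divB (wi i ne); have [b bE] := gen v.
  by exists G, b; split=> //; exists 0; rewrite rmorph0 subr0 -bE.
have [G /choice[b H]] := choice rows.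
pose M := \matrix_(i, l) (G i *+ (i == l) - s * b i l).
pose P := [set a : A | exists e, p (a - phi e)].
have P0 : P 0 by exists 0; rewrite rmorph0 subrr; exact: idl0.
have PD a a' : P a -> P a' -> P (a + a').
  move=> [e pe] [e' pe']; exists (e + e'); rewrite rmorphD opprD addrACA.
  exact: idlD.
have PM c a : P a -> P (phi c * a).
  by move=> [e pe]; exists (c * e); rewrite rmorphM -mulrBr; exact: idlMl.
exists (\det M); split.
  rewrite meval_det (_ : matrix_of_fun _ _ = 1%:M) ?det1 //.
  apply/matrixP => i l; rewrite !mxE mevalB mevalM s0 mul0r subr0 mevalMn.
  by case: (H i) => -> _.
have detw i : P (phi (\det M) * w i).
  apply: (@det_trick _ _ phi P r M w) => // {}i.
  have [_ Pi] := H i; have {Pi} : P (phi (G i) * w i - phi s * \sum_l phi (b i l) * w l) := Pi.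
  congr (P _).
  transitivity (\sum_l (phi (G i) *+ (i == l)) * w l - phi s * \sum_l phi (b i l) * w l).
    congr (_ - _); rewrite (bigD1 i) //= eqxx mulr1n big1 ?addr0 // => l.
    by rewrite eq_sym => /negPf ->; rewrite mulr0n mul0r.
  rewrite mulr_sumr -sumrB; apply: eq_bigr => l _.
  by rewrite mxE rmorphB rmorphMn rmorphM mulrBl mulrA.
move=> a; have [c ->] := gen a; rewrite mulr_sumr.
apply: (big_ind P) => // i _; rewrite mulrCA; exact: PM.
Qed.

(** Division by [s] upstairs gives a quotient in [A], which [local_isomorphism] replaces by one from
    [B]. *)
Lemma local_division_descent (f : B) : f.@[(0 : 'rV[K]_N) 0] = 0 ->
  exists g e : B, g.@[(0 : 'rV[K]_N) 0] != 0 /\ p (phi (g * f - s * e)).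
Proof.
move=> f0; have [d [d0 dP]] := local_isomorphism.
have [|G [v [G0 pG]]] := @divB (phi f); first by rewrite phi_eval (pt0 0).2.
have [e pe] := dP v; exists (d * G), e; split.
  by rewrite mevalM d0 G0 mulr1 oner_neq0.
have -> : phi (d * G * f - s * e) =
    phi d * (phi G * phi f - phi s * v) + phi s * (phi d * v - phi e).
  by rewrite rmorphB !rmorphM; ring.
by apply: (idlD idp); apply: (idlMl idp).
Qed.

End FiniteMap.

(** * Formal arcs *)

Section Arc.
Variables (K : fieldType) (k : nat) (y : nat -> 'I_k -> {poly K}).
Hypothesis y_pos : forall l i, 'X %| y l i.
Hypothesis y_step : forall l i, 'X^l %| y l.+1 i - y l i.
Notation A := {mpoly K[k]}.

(* w has order at least l along the arc, of which y l is the l-th approximation. *)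
Definition arcV l : set A := [set w | 'X^l %| mmap (@polyC K) (y l) w].

Definition arc_ideal : set A := [set w | forall l, arcV l w].

Lemma ideal_dvdp (u : {poly K}) : ideal [set v | u %| v].
Proof.
split=> /= [|v w|a v]; [exact: dvdp0|exact: dvdp_add|].
by move=> uv; rewrite /= dvdp_mull.
Qed.

Lemma dvdXn_weak (a b : nat) (u : {poly K}) : (a <= b)%N -> 'X^b %| u -> 'X^a %| u.
Proof. by move=> ab; apply: dvdp_trans; exact: dvdp_exp2l. Qed.

Lemma dvdXn_cancel (a l : nat) (u v : {poly K}) :
  ~~ ('X^(a.+1) %| u) -> 'X^(a + l) %| u * v -> 'X^l %| v.
Proof.
elim: a u => [|a IHa] u nu uv.
  rewrite -(@Gauss_dvdpr _ _ u) //.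
  by apply: coprimep_expl; rewrite coprimep_sym coprimepX -dvdp_XsubCl subr0.
have [u0|u0] := boolP ('X %| u); last first.
  rewrite -(@Gauss_dvdpr _ _ u) //; first exact: dvdXn_weak (leq_addl _ _) uv.
  by apply: coprimep_expl; rewrite coprimep_sym coprimepX -dvdp_XsubCl subr0.
have /dvdpP[u' uE] := u0; apply: (IHa u').
  by apply: contra nu => H; rewrite uE exprSr dvdp_mul2r // polyX_eq0.
move: uv; rewrite uE mulrAC addSn exprSr dvdp_mul2r //.
by rewrite polyX_eq0.
Qed.

Lemma y_congr l l' i : (l <= l')%N -> 'X^l %| y l' i - y l i.
Proof.
elim: l' => [|l' IH]; first by rewrite leqn0 => /eqP ->; rewrite subrr dvdp0.
rewrite leq_eqVlt => /predU1P[<-|ll']; first by rewrite subrr dvdp0.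
rewrite -(subrKA (y l' i)) dvdp_add ?IH //.
by apply: dvdXn_weak (y_step _ _).
Qed.

Lemma arcVE l l' w : (l <= l')%N -> arcV l w <-> 'X^l %| mmap (@polyC K) (y l') w.
Proof.
move=> ll'.
have H : 'X^l %| mmap (@polyC K) (y l') w - mmap (@polyC K) (y l) w.
  by apply: (mmap_congr _ _ (ideal_dvdp _)) => i; exact: y_congr.
split=> wl; last by have := dvdp_sub wl H; rewrite subKr.
by rewrite -(subrK (mmap (@polyC K) (y l) w) (mmap (@polyC K) (y l') w)) dvdp_add.
Qed.

Lemma arcV_ideal l : ideal (arcV l).
Proof. exact: (ideal_preim (mmap (@polyC K) (y l)) (ideal_dvdp _)). Qed.

Lemma arcV0 w : arcV 0 w.
Proof. by rewrite /arcV /= expr0 dvd1p. Qed.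

Lemma arcV_weak a b w : (a <= b)%N -> arcV b w -> arcV a w.
Proof. by move=> ab wb; apply/(arcVE _ ab); exact: dvdXn_weak ab wb. Qed.

Lemma arcVM a b u w : arcV a u -> arcV b w -> arcV (a + b) (u * w).
Proof.
move=> /(arcVE _ (leq_addr b a)) ua /(arcVE _ (leq_addl a b)) wb.
by rewrite /arcV /= rmorphM exprD dvdp_mul.
Qed.

(** Additivity of the order along the arc, stated with bounds because the order may be infinite: the
    first hypothesis says that [u] has order at most [a]. *)
Lemma arcV_cancel a l u w : ~ arcV a.+1 u -> arcV (a + l) (u * w) -> arcV l w.
Proof.
move=> nu uw; apply/(arcVE _ (leq_addl a.+1 l)).
apply: (@dvdXn_cancel a l (mmap (@polyC K) (y (a.+1 + l)) u)).
  by apply/negP => /(arcVE _ (leq_addr l a.+1)).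
rewrite -rmorphM; apply/(arcVE _ _) => //.
Qed.

Lemma arcV1 w : arcV 1 w <-> w.@[(0 : 'rV[K]_k) 0] = 0.
Proof.
rewrite /arcV /= expr1 -['X]subr0 dvdp_XsubCl rootE.
rewrite -[_.[0]]/(horner_eval 0 (mmap (@polyC K) (y 1) w)).
rewrite (rmorph_mmap (g := horner_eval 0) (f' := idfun) (h' := (0 : 'rV[K]_k) 0)).
- by split=> /eqP.
- by move=> c; exact: hornerC.
- move=> i; rewrite mxE; apply/eqP; rewrite -[_ == 0]/(root (y 1 i) 0).
  by rewrite -dvdp_XsubCl subr0.
Qed.

Lemma arcV_unit l u w : u.@[(0 : 'rV[K]_k) 0] != 0 -> arcV l (u * w) -> arcV l w.
Proof. by move=> /eqP u0; apply: (@arcV_cancel 0) => /arcV1. Qed.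

Lemma arc_ideal_prime : prime_ideal arc_ideal.
Proof.
split.
- split=> [l|u w pu pw l|a u pu l]; first exact: (idl0 (arcV_ideal l)).
    exact: (idlD (arcV_ideal l)).
  exact: (idlMl (arcV_ideal l)).
- by move=> /(_ 1%N) /arcV1 /eqP; rewrite meval1 oner_eq0.
- move=> u w puw; have [pu|/existsNP[[|l] nu]] := pselect (arc_ideal u); first by left.
    by case: nu; exact: arcV0.
  by right=> l'; apply: arcV_cancel nu _; exact: puw.
Qed.

End Arc.

(** The arc is the limit of the iteration that replaces y_j by y_j M_j(y) + X L_j(y). It is
    contracting: M_j vanishes at 0, so M_j(y) is divisible by X, and each round gains one power of
    X. *)
Lemma arc_exists (K : fieldType) (k : nat) (M L : 'I_k -> {mpoly K[k.+1]}) :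
    (forall j, (M j).@[(0 : 'rV[K]_k.+1) 0] = 0) ->
  exists y : nat -> 'I_k.+1 -> {poly K},
  [/\ forall l, y l ord0 = 'X, forall l i, 'X %| y l i,
      forall l i, 'X^l %| y l.+1 i - y l i
    & forall l j, arcV y l ('X_(lift ord0 j) - ('X_(lift ord0 j) * M j + 'X_ord0 * L j))].
Proof.
move=> M0.
pose y := fix F l : 'I_k.+1 -> {poly K} := if l is l'.+1 then
    fun i => if unlift ord0 i is Some j then
      F l' i * mmap (@polyC K) (F l') (M j) + 'X * mmap (@polyC K) (F l') (L j) else 'X
  else fun i => if unlift ord0 i is Some j then 0 else 'X.
have y0 l : y l ord0 = 'X by case: l => [|l] /=; rewrite unlift_none.
have yS l j : y l.+1 (lift ord0 j) = y l (lift ord0 j) * mmap (@polyC K) (y l) (M j)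
    + 'X * mmap (@polyC K) (y l) (L j) by rewrite /= liftK.
have ypos l i : 'X %| y l i.
  case: (unliftP ord0 i) => [j|] ->; last by rewrite y0.
  elim: l => [|l IHl]; first by rewrite /= liftK dvdp0.
  by rewrite yS dvdp_add // ?dvdp_mulr.
have Mpos l j : 'X %| mmap (@polyC K) (y l) (M j).
  rewrite -['X]subr0 dvdp_XsubCl rootE.
  rewrite -[_.[0]]/(horner_eval 0 (mmap (@polyC K) (y l) (M j))).
  rewrite (rmorph_mmap (g := horner_eval 0) (f' := idfun) (h' := (0 : 'rV[K]_k.+1) 0)).
  - by rewrite -[mmap _ _ _]/(meval _ _) M0.
  - by move=> c; exact: hornerC.
  - move=> i; rewrite mxE; apply/eqP; rewrite -[_ == 0]/(root (y l i) 0).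
    by rewrite -dvdp_XsubCl subr0.
have step l i : 'X^(l.+1) %| y l.+1 i - y l i.
  case: (unliftP ord0 i) => [j|] ->; last by rewrite !y0 subrr dvdp0.
  elim: l j => [|l IHl] j; first by rewrite dvdp_sub // ypos.
  have cong w : 'X^(l.+1) %| mmap (@polyC K) (y l.+1) w - mmap (@polyC K) (y l) w.
    apply: (mmap_congr _ _ (ideal_dvdp _)) => i'.
    by case: (unliftP ord0 i') => [j'|] ->; [exact: IHl|rewrite !y0 subrr; exact: dvdp0].
  rewrite yS [X in _ - X]yS opprD addrACA -mulrBr.
  have -> : y l.+1 (lift ord0 j) * mmap (@polyC K) (y l.+1) (M j) -
      y l (lift ord0 j) * mmap (@polyC K) (y l) (M j) =
      mmap (@polyC K) (y l.+1) (M j) * (y l.+1 (lift ord0 j) - y l (lift ord0 j)) +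
      y l (lift ord0 j) * (mmap (@polyC K) (y l.+1) (M j) - mmap (@polyC K) (y l) (M j)).
    by ring.
  by rewrite [in 'X^_]exprS !dvdp_add // dvdp_mul.
exists y; split=> // l i; first exact: dvdXn_weak (leqnSn l) (step l i).
rewrite /arcV /= rmorphB rmorphD !rmorphM /= !mmapX !mmap1U y0 -yS.
by rewrite -dvdpNr opprB; exact: dvdXn_weak (leqnSn l) (step l _).
Qed.

(** * The residual curve upstairs *)

Section ResidualCurve.
Variables (K : numClosedFieldType) (n : nat).
Notation N := (n.+1 + n.+2)%N.
Notation B := {mpoly K[N]}.
Notation A := {mpoly K[n.+2]}.
Notation X := (fun i => 'X_i : A).
Variable phi : {rmorphism B -> A}.
Hypothesis phiX : forall i, phi 'X_i = nu X i.
Variables (dl : B) (nl : 'I_n.+1 -> B).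
Hypothesis phi_dl0 : (phi dl).@[(0 : 'rV[K]_n.+2) 0] != 0.
Let o : 'rV[K]_n.+2 := 0.

Definition lam_eq (l : 'I_n.+1) : B :=
  dl * 'X_(rshift n.+1 (lift ord0 l)) - 'X_(rshift n.+1 ord0) * nl l.

Let T d := chebT (Wc X) (Wsg X) d.
Let sg : A := 'X_ord0.
Let p k := Wp X k.

(** Coefficients of the pulled-back equations as linear forms in the sg^k p_k. In each product p_k
    p_(k+d) one factor is the unknown and the other stays in the coefficient. *)
Let Q : 'M[A]_n.+1 := \matrix_(l, k) (\sum_(1 <= d < n.+2)
    (phi dl * (T d)`_l.+1 - phi (nl l) * (T d)`_0) * p (k.+1 + d)%N - phi (nl l) * p k.+1).

Let big1_ord (R : nmodType) (F : nat -> R) :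
  \sum_(1 <= k < n.+2) F k = \sum_(k < n.+1) F k.+1.
Proof. by rewrite big_add1 /= big_mkord. Qed.

Let Wbd_ord d : Wbd X d = \sum_(k < n.+1) p k.+1 * p (k.+1 + d)%N * sg ^+ k.+1.
Proof. exact: (big1_ord (fun k => p k * p (k + d)%N * sg ^+ k)). Qed.

Let WB0_ord : WB0 X = \sum_(k < n.+1) p k.+1 ^+ 2 * sg ^+ k.+1 + sg ^+ n.+2.
Proof.
rewrite /WB0 big_nat_recr //= Wp_top expr1n mul1r; congr (_ + _).
exact: (big1_ord (fun k => p k ^+ 2 * sg ^+ k)).
Qed.

(** The inhomogeneous term comes from the last summand of [WB0], where p_(n+2) = 1 leaves sg^(n+2)
    alone. *)
Lemma phi_lam_eq l :
  phi (lam_eq l) = \sum_k Q l k * (sg ^+ k.+1 * p k.+1) - phi (nl l) * sg ^+ n.+2.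
Proof.
rewrite /lam_eq rmorphB !rmorphM !phiX !nu_r lift0 coef_Wb_lift coef_Wb0 WB0_ord.
rewrite [_ * phi (nl l)]mulrC !mulrDr opprD addrA addrAC -addrA -opprD addrC.
rewrite [X in _ = X - _](_ : _ =
   (phi dl * \sum_(1 <= d < n.+2) Wbd X d * (T d)`_l.+1
   - phi (nl l) * \sum_(1 <= d < n.+2) Wbd X d * (T d)`_0)
   - phi (nl l) * \sum_(k < n.+1) p k.+1 ^+ 2 * sg ^+ k.+1); first by ring.
rewrite !mulr_sumr -sumrB -[X in _ = X - _](_ : \sum_(1 <= d < n.+2) \sum_(k < n.+1)
  (phi dl * (T d)`_l.+1 - phi (nl l) * (T d)`_0) * p (k.+1 + d)%N * (sg ^+ k.+1 * p k.+1) = _).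
  rewrite exchange_big -sumrB; apply: eq_bigr => k _; rewrite mxE mulrBl mulr_suml.
  by congr (_ - _); ring.
apply: eq_bigr => d _; rewrite Wbd_ord !mulr_suml !mulr_sumr -sumrB.
by apply: eq_bigr => k _; ring.
Qed.

(** Cramer's rule for the system of [phi_lam_eq], divided by sg^(k+1). This division removes the
    locus sigma = 0 lying over Delta_m and leaves the residual curve. *)
Definition curve_eq (k : 'I_n.+1) : A :=
  \det Q * p k.+1 - sg ^+ (n.+1 - k) * \sum_l (\adj Q) k l * phi (nl l).

Let sg_top (k : 'I_n.+1) : sg ^+ n.+2 = sg ^+ k.+1 * sg ^+ (n.+1 - k).
Proof. by rewrite -exprD addSn subnKC // ltnW. Qed.

Lemma curve_eq_lam k : \sum_l (\adj Q) k l * phi (lam_eq l) = sg ^+ k.+1 * curve_eq k.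
Proof.
transitivity (\sum_j (\sum_l (\adj Q) k l * Q l j) * (sg ^+ j.+1 * p j.+1) -
    (\sum_l (\adj Q) k l * phi (nl l)) * sg ^+ n.+2).
  under [X in X - _]eq_bigr do rewrite mulr_suml.
  rewrite exchange_big mulr_suml -sumrB; apply: eq_bigr => l _.
  rewrite phi_lam_eq mulrBr mulr_sumr mulrA; congr (_ - _).
  by apply: eq_bigr => j _; exact: mulrA.
rewrite (bigD1 k) //= [X in _ + X - _]big1 => [|j jk]; last first.
  have := congr1 (fun M : 'M_n.+1 => M k j) (mul_adj_mx Q).
  by rewrite !mxE => ->; rewrite eq_sym (negPf jk) mulr0n mul0r.
have := congr1 (fun M : 'M_n.+1 => M k k) (mul_adj_mx Q).
rewrite !mxE eqxx mulr1n => ->; rewrite /curve_eq addr0 mulrBr; congr (_ - _).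
  by ring.
by rewrite (sg_top k); ring.
Qed.

Lemma lam_curve_eq l : \det Q * phi (lam_eq l) = \sum_k Q l k * sg ^+ k.+1 * curve_eq k.
Proof.
rewrite phi_lam_eq mulrBr mulr_sumr.
have -> : \det Q * (phi (nl l) * sg ^+ n.+2) =
    \sum_k Q l k * (\sum_j (\adj Q) k j * phi (nl j)) * sg ^+ n.+2.
  rewrite mulrA -mulr_suml; congr (_ * _).
  transitivity (\sum_j (\sum_k Q l k * (\adj Q) k j) * phi (nl j)).
    rewrite (bigD1 l) //= [X in _ = _ + X]big1 => [|j jl].
      have := congr1 (fun M : 'M_n.+1 => M l l) (mul_mx_adj Q).
      by rewrite !mxE eqxx mulr1n addr0 => ->.
    have := congr1 (fun M : 'M_n.+1 => M l j) (mul_mx_adj Q).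
    by rewrite !mxE => ->; rewrite eq_sym (negPf jl) mulr0n mul0r.
  under eq_bigr do rewrite mulr_suml.
  rewrite exchange_big; apply: eq_bigr => k _; rewrite mulr_sumr.
  by apply: eq_bigr => j _; rewrite mulrA.
rewrite -sumrB; apply: eq_bigr => k _; rewrite /curve_eq.
by rewrite (sg_top k); ring.
Qed.

Let X0 : meval (o 0) \o X =1 fun=> 0.
Proof. by move=> i /=; rewrite mevalXU mxE. Qed.

Let p_eval k : (p k).@[o 0] = (k == n.+2)%:R.
Proof.
rewrite (map_Wp (meval (o 0))) /Wp /Wc; case: eqP => // _.
by rewrite !X0 mulr0; case: eqP => // _; case: ifP.
Qed.

Let T_eval d j : ((T d.+1)`_j).@[o 0] = (j == d.+1)%:R.
Proof.
have mapT : map_poly (meval (o 0)) (T d.+1) = 'X^(d.+1).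
  apply: etrans (map_chebT (meval (o 0)) _ _ _) _; rewrite -(chebT_0 K d).
  by congr chebT; [exact: (X0 ord_max)|exact: (X0 ord0)].
by rewrite -[_.@[_]](coef_map (meval (o 0))) mapT coefXn.
Qed.

(** At the origin T_d is x^d and only p_(n+2) is nonzero among the p_k with k > 0. So d = l + 1 and
    k + 1 + d = n + 2, which is the antidiagonal. *)
Let Q_eval l k : (Q l k).@[o 0] = (phi dl).@[o 0] *+ (k == rev_ord l).
Proof.
rewrite mxE mevalB mevalM p_eval eqSS ltn_eqF // mulr0 subr0.
rewrite big1_ord meval_sum (bigD1 l) //= big1 => [|d dl_].
  rewrite mevalM p_eval mevalB !mevalM !T_eval eqxx mulr1 mulr0 subr0 addr0 mulr_natr.
  congr (_ *+ nat_of_bool _); rewrite -val_eqE /=.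
  by apply/eqP/eqP; have := ltn_ord l; have := ltn_ord k; lia.
rewrite mevalM mevalB !mevalM !T_eval eqSS eq_sym; move: dl_; rewrite -val_eqE => /negPf /= ->.
by rewrite !mulr0 subr0 mul0r.
Qed.

Lemma detQ_neq0 : (\det Q).@[o 0] != 0.
Proof.
rewrite meval_det; set M := \matrix_(i, j) _.
have ME i j : M i j = (phi dl).@[o 0] *+ (j == rev_ord i) by rewrite [LHS]mxE Q_eval.
have MM : M *m M = ((phi dl).@[o 0] ^+ 2)%:M.
  apply/matrixP => i j; rewrite mxE [RHS]mxE (bigD1 (rev_ord i)) //= !ME eqxx mulr1n.
  rewrite big1 ?addr0 => [|k ne]; last by rewrite !ME (negPf ne) mulr0n mul0r.
  by rewrite rev_ordK expr2 mulrnAr eq_sym.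
have : \det (M *m M) != 0 by rewrite MM det_scalar expf_neq0 // expf_neq0.
by rewrite det_mulmx mulf_eq0 negb_or => /andP[].
Qed.

Let IE := [set f : A | exists c : 'I_n.+1 -> A, f = \sum_k c k * curve_eq k].
Let idIE : ideal IE := ideal_ext curve_eq.

Let u (k : 'I_n.+1) : K := if k == ord_max then n.+2%:R else 1.

Let u_neq0 k : u k != 0.
Proof. by rewrite /u; case: ifP => _; [rewrite pnatr_eq0|exact: oner_neq0]. Qed.

Let p_coord (k : 'I_n.+1) : p k.+1 = (u k)%:MP * 'X_(lift ord0 k).
Proof.
rewrite /p /Wp eqSS ltn_eqF // eqSS /u -[k == ord_max]val_eqE /=.
case: eqP => [kn|/eqP kn].
  rewrite mpolyC_nat /Wc (_ : lift ord0 k = ord_max) //.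
  by apply: val_inj; rewrite /= kn.
have kn' : (k.+1 < n.+1)%N by rewrite ltnS ltn_neqAle kn -ltnS ltn_ord.
rewrite kn' mpolyC1 mul1r (_ : inord k.+1 = lift ord0 k) //.
by apply: val_inj; rewrite /= inordK // ltnW.
Qed.

Let curve_arc : exists y : nat -> 'I_n.+2 -> {poly K},
  [/\ forall l, y l ord0 = 'X, forall l i, 'X %| y l i,
      forall l i, 'X^l %| y l.+1 i - y l i
    & forall l k, arcV y l (curve_eq k)].
Proof.
pose d0 := (\det Q).@[o 0]; have d00 : d0 != 0 := detQ_neq0.
pose Nk k := \sum_l (\adj Q) k l * phi (nl l).
(* The equation [curve_eq k = 0] in fixed-point form: det Q is split into its value at 0 and a part
   vanishing there. One factor sg is kept out of [L] for the ['X_ord0] of [arc_exists], hence the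
   exponent n - k. *)
pose M (k : 'I_n.+1) : A := 1 - (d0^-1)%:MP * \det Q.
pose L (k : 'I_n.+1) : A := ((d0 * u k)^-1)%:MP * (sg ^+ (n - k) * Nk k).
have [|y [y0 ypos ystep yF]] := @arc_exists K n.+1 M L.
  by move=> j; rewrite mevalB mevalM meval1 mevalC mulVf // subrr.
exists y; split=> // l k.
have -> : curve_eq k = (d0 * u k)%:MP *
    ('X_(lift ord0 k) - ('X_(lift ord0 k) * M k + 'X_ord0 * L k)).
  rewrite /curve_eq p_coord subSn; last by rewrite -ltnS.
  have dd : d0%:MP * (d0^-1)%:MP = 1 :> A by rewrite -mpolyCM divff // mpolyC1.
  have du : (d0 * u k)%:MP * ((d0 * u k)^-1)%:MP = 1 :> A.
    by rewrite -mpolyCM divff ?mpolyC1 // (mulf_neq0 d00 (u_neq0 k)).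
  rewrite /M /L -/(Nk k).
  transitivity ((d0%:MP * (d0^-1)%:MP) * (\det Q * ((u k)%:MP * 'X_(lift ord0 k)))
    - ((d0 * u k)%:MP * ((d0 * u k)^-1)%:MP) * (sg ^+ (n - k).+1 * Nk k)).
    by rewrite dd du !mul1r.
  rewrite mpolyCM exprS /sg; ring.
exact: (idlMl (arcV_ideal y l)).
Qed.

Let p_sg i : exists g e, g.@[o 0] != 0 /\ IE (g * ('X_i - (o 0 i)%:MP) - sg * e).
Proof.
rewrite mxE mpolyC0 subr0; case: (unliftP ord0 i) => [k|] ->; last first.
  exists 1, 1; rewrite meval1 oner_neq0 mul1r mulr1 subrr; split=> //; exact: (idl0 idIE).
exists (\det Q * (u k)%:MP), (sg ^+ (n - k) * \sum_l (\adj Q) k l * phi (nl l)).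
split; first by rewrite mevalM mevalC mulf_neq0 // detQ_neq0.
rewrite (_ : _ - _ = curve_eq k); first exact: ideal_ext_gen.
rewrite /curve_eq p_coord subSn; last by rewrite -ltnS.
by rewrite exprS; ring.
Qed.

Let div_sg := local_division idIE p_sg.

Section AlongArc.
Variable y : nat -> 'I_n.+2 -> {poly K}.
Hypotheses (y0 : forall l, y l ord0 = 'X) (y_pos : forall l i, 'X %| y l i)
  (y_step : forall l i, 'X^l %| y l.+1 i - y l i)
  (y_curve : forall l k, arcV y l (curve_eq k)).
Notation V := (arcV y).
Notation pp := (arc_ideal y).

Let prp : prime_ideal pp := arc_ideal_prime y_pos y_step.
Let idV l : ideal (V l) := arcV_ideal y l.
Let idp : ideal pp := prime_ideal_ideal prp.

Let IEp : IE `<=` pp.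
Proof.
by move=> _ [c ->] l; apply: (idl_sum (idV l)) => k _; apply: (idlMl (idV l)).
Qed.

Let sgX l j : V l (sg ^+ j) <-> (l <= j)%N.
Proof.
rewrite /arcV /= rmorphXn /= mmapX mmap1U y0; split=> [|lj]; last exact: dvdp_exp2l.
by move/dvdp_leq; rewrite monic_neq0 ?monicXn // !size_polyXn ltnS; apply.
Qed.

Lemma lam_eq_arc l : pp (phi (lam_eq l)).
Proof.
apply: (prime_idlMl prp (x := \det Q)).
  by move=> /(_ 1%N)/(arcV1 y_pos) /eqP; rewrite (negPf detQ_neq0).
rewrite lam_curve_eq => j; apply: (idl_sum (idV j)) => k _.
exact: (idlMl (idV j)).
Qed.

(** Read from the curve equation, where det Q is a unit. Every sg^k p_k thus has order at least n +
    2 along the arc. *)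
Let Vp (k : 'I_n.+1) : V (n.+1 - k) (p k.+1).
Proof.
apply: (arcV_unit y_pos y_step detQ_neq0).
apply: (idl_subr (idV _) (y_curve _ k)); apply: (idlMr (idV _)).
exact/sgX.
Qed.

Let VM a b c f g : (c <= a + b)%N -> V a f -> V b g -> V c (f * g).
Proof. by move=> cab Va Vb; apply: (arcV_weak y_step cab); exact: arcVM. Qed.

Let Vbd d : (0 < d)%N -> V n.+2 (Wbd X d).
Proof.
move=> d0; rewrite Wbd_ord; apply: (idl_sum (idV _)) => k _.
apply: (VM (a := n.+1 - k) (b := k.+1)); [by have := ltn_ord k; lia| |exact/sgX].
exact: (idlMr (idV _)).
Qed.

(** In p_k^2 sg^k the extra factor p_k has positive order, which pushes the term beyond n + 2; only
    the top term remains. *)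
Let VB0 : V n.+3 (WB0 X - sg ^+ n.+2).
Proof.
rewrite WB0_ord addrK; apply: (idl_sum (idV _)) => k _.
have kn := ltn_ord k.
apply: (VM (a := (n.+1 - k) + (n.+1 - k)) (b := k.+1)); [lia| |exact/sgX].
by rewrite expr2; apply: (arcVM y_step).
Qed.

Let VT d : (0 < d)%N -> V 1 (T d)`_0.
Proof. by case: d => // d _; apply/(arcV1 y_pos); rewrite T_eval. Qed.

Lemma beta_order j : V n.+2 (phi 'X_(rshift n.+1 j)).
Proof.
rewrite phiX nu_r /Wb coefD coef_sum coefC; apply: (idlD (idV _)); last first.
  rewrite big_nat; apply: (idl_sum (idV _)) => d /andP[d0 _].
  by rewrite coefCM; apply: (idlMr (idV _)); exact: Vbd.
case: eqP => _; last exact: (idl0 (idV _)).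
apply: (idl_subr (idV _) (arcV_weak y_step (leqnSn _) VB0)).
exact/sgX.
Qed.

Lemma beta0_order : ~ V n.+3 (phi 'X_(rshift n.+1 ord0)).
Proof.
rewrite phiX nu_r coef_Wb0 => Vb.
have : V n.+3 (sg ^+ n.+2); last by move/sgX; rewrite ltnn.
apply: (idl_subl (idV _) VB0); apply: (idl_subr (idV n.+3) _ Vb).
rewrite opprD addrA subrr sub0r; apply: (idlN (idV _)).
rewrite big_nat; apply: (idl_sum (idV _)) => d /andP[d0 _].
(* The constant coefficient of T_d vanishes at the origin for d > 0 and supplies the one order
   needed beyond that of [Wbd]. *)
by apply: (VM (a := n.+2) (b := 1)); [rewrite addn1|exact: Vbd|exact: VT].
Qed.

Definition alpha_last : B := 'X_(lshift n.+2 ord_max).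

(** Apart from -(n+2) sg, the coefficient of x^n in a consists of multiples of c^2 and of p_n, all
    of order at least 2 by [Vp]. *)
Let alphaE : exists w, V 2 w /\ phi alpha_last = w - n.+2%:R * sg.
Proof.
rewrite phiX nu_l coef_Wa_sub.
exists ('C(n.+2, 2)%:R * Wc X ^+ 2 - n.+2%:R * Wc X * (n.+1%:R * Wc X)
  + (if n is 0 then 0 else Wp X n)); split; last by rewrite -[Wsg X]/sg; ring.
have Vc2 : V 2 (Wc X ^+ 2).
  by rewrite expr2; apply: (VM (a := 1) (b := 1)) => //;
    apply/(arcV1 y_pos); rewrite mevalXU mxE.
apply: (idlD (idV 2)).
  apply: (idlB (idV 2)); first exact: (idlMl (idV 2)).
  by rewrite mulrACA -expr2; exact: (idlMl (idV 2)).
have low j : j = n -> V 2 (if j is 0 then 0 else p j).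
  case: j => [|j] e; first exact: (idl0 (idV 2)).
  have jn : (j < n.+1)%N by rewrite -e; exact: ltnW.
  by apply: arcV_weak (Vp (Ordinal jn)) => //=; rewrite -e; lia.
exact: low.
Qed.

Lemma alpha_order1 : V 1 (phi alpha_last).
Proof.
have [w [Vw ->]] := alphaE; apply: (idlB (idV 1)); first exact: (arcV_weak y_step _ Vw).
by apply: (idlMl (idV 1)); have /sgX := leqnn 1; rewrite expr1.
Qed.

Lemma alpha_order2 : ~ V 2 (phi alpha_last).
Proof.
have [w [Vw ->]] := alphaE => Vs.
have : V 2 (n.+2%:R * sg) by rewrite -(subKr w (n.+2%:R * sg)); exact: (idlB (idV 2)).
rewrite -mpolyC_nat => /(arcV_unit y_pos y_step); rewrite mevalC pnatr_eq0 => /(_ isT).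
by rewrite -(expr1 sg) => /sgX.
Qed.

(** [sg] is a uniformizer by the curve equations, and [alpha_last], being of order exactly 1, is a
    unit times [sg] on the arc. *)
Lemma curve_division a : a.@[o 0] = 0 ->
  exists g v, g.@[o 0] != 0 /\ pp (g * a - phi alpha_last * v).
Proof.
move=> /div_sg[d [v [d0 /IEp dv]]].
have [e [w [e0 /IEp ew]]] := div_sg ((arcV1 y_pos _).1 alpha_order1).
have w0 : w.@[o 0] != 0.
  apply/eqP => /(arcV1 y_pos) Vw; apply: alpha_order2.
  apply: (arcV_unit y_pos y_step e0); apply: (idl_subr (idV 2) (ew 2)).
  by apply: (VM (a := 1) (b := 1)) => //; have /sgX := leqnn 1; rewrite expr1.
exists (w * d), (e * v); split; first by rewrite mevalM mulf_neq0.
have -> : w * d * a - phi alpha_last * (e * v) =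
    w * (d * a - sg * v) - v * (e * phi alpha_last - sg * w) by ring.
by apply: (idlB idp); apply: (idlMl idp).
Qed.

(** Near the origin the arc ideal is generated by the curve equations. At a point with nonzero sigma
    these follow from the equations of [lam_eq], because [curve_eq_lam] can be divided by a power of
    sg. *)
Lemma curve_nakayama : exists d, d.@[o 0] != 0 /\ forall x : 'rV[K]_n.+2,
  (forall l, (phi (lam_eq l)).@[x 0] = 0) -> x 0 ord0 != 0 -> d.@[x 0] != 0 ->
  forall f, pp f -> f.@[x 0] = 0.
Proof.
have [||f pf|d [d0 dp]] := nakayama_principal (p := o) (s := sg) prp idIE IEp.
- by move=> /(_ 2); rewrite -(expr1 sg) => /sgX.
- by rewrite mevalXU mxE.
- by apply: div_sg; exact/(arcV1 y_pos)/(pf 1).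
exists d; split=> // x Gx x0 dx f /dp[c dfE].
apply: (mulfI dx); rewrite mulr0 -mevalM dfE meval_sum big1 // => k _.
rewrite mevalM; suff -> : (curve_eq k).@[x 0] = 0 by rewrite mulr0.
have sx : (sg ^+ k.+1).@[x 0] != 0 by rewrite rmorphXn /= mevalXU expf_neq0.
apply: (mulfI sx); rewrite mulr0 -mevalM -curve_eq_lam meval_sum big1 // => l _.
by rewrite mevalM Gx mulr0.
Qed.

End AlongArc.

Theorem residual_arc : exists y : nat -> 'I_n.+2 -> {poly K},
  [/\ forall l i, 'X %| y l i, forall l i, 'X^l %| y l.+1 i - y l i
    & [/\ forall l, arc_ideal y (phi (lam_eq l)),
       forall j, arcV y n.+2 (phi 'X_(rshift n.+1 j)) /\ ~ arcV y n.+3 (phi 'X_(rshift n.+1 ord0)),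
       arcV y 1 (phi 'X_(lshift n.+2 ord_max)) /\ ~ arcV y 2 (phi 'X_(lshift n.+2 ord_max)),
       forall a, a.@[o 0] = 0 -> exists g v, g.@[o 0] != 0 /\
         arc_ideal y (g * a - phi 'X_(lshift n.+2 ord_max) * v)
     & exists d, d.@[o 0] != 0 /\ forall x : 'rV[K]_n.+2,
         (forall l, (phi (lam_eq l)).@[x 0] = 0) -> x 0 ord0 != 0 -> d.@[x 0] != 0 ->
         forall f, arc_ideal y f -> f.@[x 0] = 0]].
Proof.
have [y [y0 ypos ystep yc]] := curve_arc; exists y; split=> //; split.
- exact: lam_eq_arc.
- by move=> j; split; [exact: beta_order|exact: beta0_order].
- by split; [exact: alpha_order1|exact: alpha_order2].
- exact: curve_division.
- exact: curve_nakayama.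
Qed.

End ResidualCurve.

(** * Intersection multiplicity *)

Section LocalColength.
Variables (K : closedFieldType) (N : nat).
Notation B := {mpoly K[N]}.
Let o : 'rV[K]_N := 0.
Variables (q J : set B) (s b : B) (m : nat) (V : nat -> set B).
Hypotheses (idq : ideal q) (idJ : ideal J) (qJ : q `<=` J) (Jb : J b).
Hypothesis div : forall f, f.@[o 0] = 0 -> exists g e, g.@[o 0] != 0 /\ q (g * f - s * e).
Hypotheses (idV : forall l, ideal (V l)) (V0 : forall w, V 0 w)
  (V_anti : forall k l, (k <= l)%N -> V l `<=` V k)
  (V1 : forall w, V 1 w <-> w.@[o 0] = 0)
  (VM : forall k l u w, V k u -> V l w -> V (k + l) (u * w))
  (V_cancel : forall k l u w, ~ V k.+1 u -> V (k + l) (u * w) -> V l w)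
  (qV : forall l, q `<=` V l) (JV : J `<=` V m).
Hypotheses (Vs : V 1 s) (nVs : ~ V 2 s) (Vb : V m b) (nVb : ~ V m.+1 b).

Let s0 : s.@[o 0] = 0. Proof. exact/V1. Qed.

Let nVsX j : ~ V j.+1 (s ^+ j).
Proof.
elim: j => [|j IHj]; first by rewrite expr0 V1 meval1 => /eqP; rewrite oner_eq0.
by rewrite exprS => /(V_cancel (k := 1) nVs).
Qed.

(** Otherwise the first nonzero [c i] would give the sum order exactly i, which is less than m. *)
Let independent (h : B) (c : 'I_m -> K) : h.@[o 0] != 0 ->
  V m (h * \sum_(i < m) (c i)%:MP * s ^+ i) -> forall i, c i = 0.
Proof.
move=> h0 Vsum i; have [k ik] := ubnP (i : nat); elim: k i ik => // k IHk i ik.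
pose R : B := \sum_(j < m) (if (i <= j)%N then (c j)%:MP * s ^+ (j - i) else 0).
have sE : \sum_(j < m) (c j)%:MP * s ^+ j = s ^+ i * R.
  rewrite mulr_sumr; apply: eq_bigr => j _; case: leqP => ij.
    by rewrite mulrCA -exprD subnKC.
  by rewrite mulr0 IHk ?mpolyC0 ?mul0r // (leq_trans ij).
have : V 1 (h * R).
  have H : V (i + 1) (s ^+ i * (h * R)).
    by rewrite addn1 mulrCA -sE; apply: V_anti Vsum.
  exact: V_cancel (nVsX (j := i)) H.
move/V1; rewrite mevalM meval_sum (bigD1 i) //= leqnn subnn expr0 mulr1 mevalC.
rewrite big1 ?addr0 => [/eqP|j ji]; first by rewrite mulf_eq0 (negPf h0) => /eqP.
case: ifP => ij; last by rewrite meval0.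
have [l ->] : exists l, (j - i)%N = l.+1.
  exists (j - i).-1; rewrite prednK // subn_gt0 ltn_neqAle ij andbT eq_sym.
  by move: ji; rewrite -val_eqE.
by rewrite exprS !mevalM s0 mul0r mulr0.
Qed.

(** Taylor expansion of [f / g] in the parameter [s] modulo [q]; [h] collects the multipliers met at
    each division, and the next coefficient is the value at the origin of the remainder over
    [g * h]. *)
Let expansion (f g : B) k : g.@[o 0] != 0 -> exists (c : nat -> K) (h e : B),
  h.@[o 0] != 0 /\ q (h * f - g * h * \sum_(i < k) (c i)%:MP * s ^+ i - s ^+ k * e).
Proof.
move=> g0; elim: k => [|k [c [h [e [h0 qe]]]]].
  exists (fun=> 0), 1, f; rewrite meval1 oner_neq0 big_ord0 mulr0 subr0 expr0.
  by rewrite subrr; split=> //; exact: (idl0 idq).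
pose ck := e.@[o 0] / (g * h).@[o 0].
have gh0 : (g * h).@[o 0] != 0 by rewrite mevalM mulf_neq0.
have [|g' [e' [g'0 qe']]] := div (f := e - ck%:MP * (g * h)).
  by rewrite mevalB [X in _ - X]mevalM mevalC /ck divfK // subrr.
exists (fun i => if i == k then ck else c i), (g' * h), e'; split.
  by rewrite mevalM mulf_neq0.
rewrite big_ord_recr /= eqxx.
rewrite (eq_bigr (fun i : 'I_k => (c i)%:MP * s ^+ i)) => [|i _]; last first.
  by rewrite ltn_eqF.
move: qe; set S := \sum_(i < k) _ => qe.
have -> : g' * h * f - g * (g' * h) * (S + ck%:MP * s ^+ k) - s ^+ k.+1 * e' =
    g' * (h * f - g * h * S - s ^+ k * e)
    + s ^+ k * (g' * (e - ck%:MP * (g * h)) - s * e').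
  by rewrite exprS; ring.
by apply: (idlD idq); apply: (idlMl idq).
Qed.

(** Expand [b]: its order is exactly m, so the first m coefficients vanish and the remainder [e] is
    a unit. Hence s^m lies in [J] locally. *)
Let uniformizer_power : exists e, e.@[o 0] != 0 /\ J (e * s ^+ m).
Proof.
have [|c [h [e [h0 qe]]]] := @expansion b 1 m; first by rewrite meval1 oner_neq0.
rewrite mul1r in qe.
have Vsm j : V j (s ^+ j).
  by elim: j => [|j IHj]; [exact: V0|rewrite exprS -add1n; exact: VM].
have c0 : forall i : 'I_m, c i = 0.
  apply: (independent (h := h)) => //; set S := \sum_(i < m) _ in qe *.
  have -> : h * S = h * b - s ^+ m * e - (h * b - h * S - s ^+ m * e) by ring.
  apply: (idlB (idV m)); last exact: qV.
  by apply: (idlB (idV m)); [exact: (idlMl (idV m))|apply: (idlMr (idV m))].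
rewrite big1 ?mulr0 ?subr0 in qe; last by move=> i _; rewrite c0 mpolyC0 mul0r.
exists e; split.
  apply/eqP => /V1 Ve; apply: nVb; apply: (V_cancel (k := 0) (u := h)).
    by move/V1/eqP; rewrite (negPf h0).
  rewrite add0n; apply: (idl_subr (idV m.+1) (@qV m.+1 _ qe)).
  by rewrite -addn1; exact: VM.
rewrite mulrC; apply: (idl_subl idJ (qJ qe)); exact: (idlMl idJ).
Qed.

Let fraction_scale (F : fieldType) (f g t w : F) : g != 0 -> w != 0 ->
  f / g - t = w * (f - g * t) / (w * g).
Proof. by move=> g0 w0; field; rewrite g0 w0. Qed.

Let fraction_cross (F : fieldType) (f g t a h : F) : g != 0 -> h != 0 ->
  f / g - t = a / h -> h * (f - g * t) = a * g.
Proof.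
move=> g0 h0 e; have -> : f - g * t = g * (f / g - t) by field.
by rewrite e; field.
Qed.

(** Modulo [q] the local ring has uniformizer [s], and [J] becomes the ideal generated by s^m, so
    the powers s^i with i < m form a basis of the quotient. *)
Lemma local_colength_chain : has_local_colength o J m.
Proof.
have tofrac_neq0 (g : B) : g.@[o 0] != 0 -> tofrac g != 0.
  by move=> g0; rewrite tofrac_eq0; apply: contra g0 => /eqP ->; rewrite meval0.
have one0 : (1 : B).@[o 0] != 0 by rewrite meval1 oner_neq0.
exists (fun i : 'I_m => tofrac (s ^+ i)) => [i|r [f [g [g0 ->]]]].
  by exists (s ^+ i), 1; rewrite tofrac1 divr1.
have [c [h [e [h0 qe]]]] := expansion f m g0.
have [e1 [e10 Je1]] := uniformizer_power.
have sumE (c' : 'I_m -> K) :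
  \sum_(i < m) tofrac (c' i)%:MP * tofrac (s ^+ i) = tofrac (\sum_(i < m) (c' i)%:MP * s ^+ i).
  by rewrite rmorph_sum; apply: eq_bigr => i _; rewrite -tofracM.
exists (\row_i c i); split.
  rewrite (sumE (fun i => (\row_i c i : 'rV[K]_m) 0 i)).
  set S := \sum_(i < m) _.
  have SE : S = \sum_(i < m) (c i)%:MP * s ^+ i by apply: eq_bigr => i _; rewrite mxE.
  exists (e1 * h * (f - g * S)), (e1 * h * g); split.
  - have -> : e1 * h * (f - g * S) =
        e1 * (h * f - g * h * S - s ^+ m * e) + e1 * s ^+ m * e by ring.
    by apply: (idlD idJ); [apply: (idlMl idJ); rewrite SE; exact: qJ|exact: (idlMr idJ)].
  - by rewrite !mevalM !mulf_neq0.
  - have n0 : tofrac (e1 * h) != 0 by apply: tofrac_neq0; rewrite mevalM mulf_neq0.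
    rewrite (tofracM (e1 * h) g) (tofracM (e1 * h) (f - g * S)) (tofracB f (g * S)) (tofracM g S).
    exact: fraction_scale (tofrac_neq0 _ g0) n0.
move=> c' [F [H [JF H0]]]; rewrite (sumE (fun i => c' 0 i)).
set S' := \sum_(i < m) _ => eF.
(* Once denominators are cleared, two expansions of the same fraction differ by an element of order
   at least m, so their coefficients agree. *)
have := independent (h := e1 * h * g * H) (c := fun i => c i - c' 0 i).
rewrite !mevalM !mulf_neq0 // => /(_ isT) ind.
apply/rowP => i; rewrite mxE; apply/eqP; rewrite -subr_eq0; apply/eqP.
apply: ind => //; set S := \sum_(i < m) (c i)%:MP * s ^+ i in qe.
have -> : \sum_(i < m) (c i - c' 0 i)%:MP * s ^+ i = S - S'.
  by rewrite -sumrB; apply: eq_bigr => j _; rewrite mpolyCB mulrBl.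
have eqF : H * (f - g * S') = F * g.
  apply/eqP; rewrite -tofrac_eq; apply/eqP.
  rewrite (tofracM H) (tofracB f) (tofracM g) (tofracM F).
  exact: fraction_cross (tofrac_neq0 _ g0) (tofrac_neq0 _ H0) eF.
have -> : e1 * h * g * H * (S - S') = e1 * h * F * g
   - e1 * H * (h * f - g * h * S - s ^+ m * e) - e1 * s ^+ m * e * H.
  have -> : e1 * h * F * g = e1 * h * (H * (f - g * S')) by rewrite eqF; ring.
  ring.
apply: (idlB (idV m)); last by apply: (idlMr (idV m)); apply: (idlMr (idV m)); exact: JV.
apply: (idlB (idV m)); last by apply: (idlMl (idV m)); exact: qV.
by apply: (idlMr (idV m)); apply: (idlMl (idV m)); exact: JV.
Qed.

End LocalColength.

(** * Construction of Psi and the local decomposition *)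

Section Assembly.
Variables (K : numClosedFieldType) (n : nat).
Hypothesis uncountableK : ~ countable [set: K].
Notation N := (n.+1 + n.+2)%N.
Notation B := {mpoly K[N]}.
Notation A := {mpoly K[n.+2]}.
Let o : 'rV[K]_N := 0.

(** Over the origin D is x^(2m), so all roots of q and of r are 0, which forces q = x^(m-1), c = 0
    and sigma = 0. *)
Lemma nu_point_eq0 (x : 'rV[K]_n.+2) : nu_point x = 0 <-> x = 0.
Proof.
have q0 : Wq ((0 : 'rV[K]_n.+2) 0) = 'X^(n.+1).
  rewrite WqE /Wc /Wsg !mxE !chebU_0 mulr0 polyC0 mul0r addr0 big_nat big1 ?addr0 // => k.
  move=> /andP[k0 kn]; rewrite /Wp !ltn_eqF ?kn ?mxE ?polyC0 ?mul0r //.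
  exact: ltnW.
have d0 : @disc K n.+2 (nu_point (0 : 'rV[K]_n.+2)) = 'X^(n.+2 + n.+2).
  rewrite disc_nu_point q0 /cheb_r /Wc /Wsg !mxE polyC0 mulr0 !subr0 -exprMn -exprSr -exprM.
  by congr ('X^_); lia.
have n0 : nu_point (0 : 'rV[K]_n.+2) = 0.
  apply: disc_inj; rewrite d0 discE.
  have -> : @fibre_b K n.+2 0 = 0.
    by apply/polyP => j; rewrite coef_fibre_b coef0; case: insubP => // i _ _; rewrite mxE.
  have -> : @fibre_a K n.+2 0 = 'X^(n.+2).
    apply/polyP => j; rewrite coef_fibre_a coefXn.
    by case: insubP => [i _ _|_]; rewrite ?mxE addr0.
  by rewrite mulr0 subr0 -exprM muln2 addnn.
split=> [nx|->//].
have dx : Wq (x 0) ^+ 2 * cheb_r (Wc (x 0)) (Wsg (x 0)) = 'X^(n.+2 + n.+2).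
  by rewrite -disc_nu_point nx -n0 d0.
have root0 (z : K) : (Wq (x 0)).[z] = 0 \/ (cheb_r (Wc (x 0)) (Wsg (x 0))).[z] = 0 -> z = 0.
  move=> H; have := congr1 (horner^~ z) dx; rewrite /= hornerM horner_exp hornerXn.
  have -> : (Wq (x 0)).[z] ^+ 2 * (cheb_r (Wc (x 0)) (Wsg (x 0))).[z] = 0.
    by case: H => ->; rewrite ?mulr0 // expr0n mul0r.
  by move/esym/eqP; rewrite expf_eq0 => /andP[_ /eqP].
have qx : Wq (x 0) = 'X^(n.+1).
  have [s sE] := closed_field_poly_normal (Wq (x 0)).
  have sq : size (Wq (x 0)) = n.+2.
    apply/eqP; rewrite eqn_leq size_Wq ltnNge; apply/negP => /leq_sizeP/(_ _ (leqnn _))/eqP.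
    by rewrite coef_Wq_top oner_eq0.
  have lq : lead_coef (Wq (x 0)) = 1 by rewrite /lead_coef sq coef_Wq_top.
  rewrite lq scale1r in sE.
  have ss : size s = n.+1 by move: sq; rewrite sE size_prod_XsubC => -[].
  have s0 z : z \in s -> z = 0.
    move=> zs; apply: root0; left; apply/eqP; rewrite sE -[_ == 0]/(root _ z).
    by rewrite root_prod_XsubC.
  rewrite sE -ss; elim: (s) s0 => [|z s' IHs] s0; first by rewrite big_nil.
  rewrite big_cons IHs => [|w ws]; last by apply: s0; rewrite inE ws orbT.
  by rewrite (s0 z) ?mem_head // subr0 -exprS.
have cx : Wc (x 0) = 0 by rewrite -coef_Wq_pred qx coefXn ltn_eqF.
have sx : Wsg (x 0) = 0.
  have : 2%:R * sqrtC (Wsg (x 0)) = 0.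
    apply: root0; right; rewrite cx /cheb_r polyC0 subr0 hornerD hornerN hornerXn.
    by rewrite -polyC_natr -polyCM hornerC exprMn sqrtCK -natrX subrr.
  by move/eqP; rewrite mulf_eq0 pnatr_eq0 /= sqrtC_eq0 => /eqP.
apply/rowP; apply: W_inj; last by rewrite qx q0.
  by rewrite cx /Wc mxE.
by rewrite sx /Wsg mxE.
Qed.

Lemma nu_point_sigma0 (x : 'rV[K]_n.+2) : x 0 ord0 = 0 ->
  @coordinate_plane K n.+1 n.+1 (nu_point x).
Proof.
move=> x0 j; rewrite mxE nu_r; have sg0 : Wsg (x 0) = 0 by [].
have -> : Wb (x 0) = 0; last by rewrite coef0.
have Wbd0 d : Wbd (x 0) d = 0.
  rewrite /Wbd big_nat big1 // => k /andP[k0 _].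
  by rewrite sg0 expr0n; case: k k0 => // k _; rewrite mulr0.
rewrite /Wb big1 => [|d _]; last by rewrite Wbd0 polyC0 mul0r.
rewrite addr0 /WB0 big_nat big1 ?polyC0 // => k /andP[k0 _].
by rewrite sg0 expr0n; case: k k0 => // k _; rewrite mulr0.
Qed.

Variable phi : {rmorphism B -> A}.
Hypotheses (phiX : forall i, phi 'X_i = nu (fun i => 'X_i : A) i)
  (phi_const : forall c : K, phi c%:MP = c%:MP)
  (phi_eval : forall (f : B) (x : 'rV[K]_n.+2), (phi f).@[x 0] = f.@[(nu_point x) 0])
  (integralX : forall i : 'I_n.+2, exists2 chi : {poly B},
     chi \is monic & (map_poly phi chi).['X_i] = 0)
  (nu_point_nodal' : forall x : 'rV[K]_n.+2, nodal_locus K n.+2 n.+1 (nu_point x))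
  (nodal_plane : nodal_locus K n.+2 n.+2 = @coordinate_plane K n.+1 n.+1).

(** The image of a finite map is closed: if [t] is not in it, [finite_fibre] for the zero ideal
    gives a polynomial with value 1 at [t] whose pullback is 0. *)
Let nodal_nu_point t : nodal_locus K n.+2 n.+1 t -> exists x : 'rV[K]_n.+2, t = nu_point x.
Proof.
move=> nt; apply: contrapT => /forallNP nx.
have id0 : ideal [set 0 : A].
  by split=> // [f g -> ->|a f ->]; rewrite ?addr0 ?mulr0.
have [|G [G1 G0]] := finite_fibre uncountableK phi_const phi_eval integralX (y := t) id0.
  by move=> x _ e; apply: (nx x).
have Gt : zero_locus [set G] t.
  apply: nt; first by exists [set G].
  move=> t' /has_nodes_nu_point[x ->] _ ->; rewrite -phi_eval (_ : phi G = 0) ?meval0 //.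
by have /eqP := Gt G erefl; rewrite G1 oner_eq0.
Qed.

Section Main.
Variable Lam : set 'rV[K]_N.
Notation plane := (@coordinate_plane K n.+1 n.+1).
Hypotheses (irrL : irreducible Lam) (lcL : locally_closed Lam)
  (dimT : has_linear_dimension (tangent_space Lam 0) n.+2) (planeL : plane `<=` Lam).
Variable v0 : 'rV[K]_N.
Hypotheses (Tv0 : tangent_space Lam 0 v0) (v0_neq0 : v0 0 (rshift n.+1 ord0) != 0).
Notation IL := (vanishing_ideal Lam).
Let prL : prime_ideal IL := irreducible_vanishing_prime irrL.
Let idL : ideal IL := prime_ideal_ideal prL.
Notation beta0 := ('X_(rshift n.+1 ord0) : B).
Notation s := ('X_(lshift n.+2 ord_max) : B).

Let nbeta0 : ~ IL beta0.
Proof.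
move=> Ib; move: v0_neq0; have := Tv0 Ib.
rewrite (bigD1 (rshift n.+1 ord0)) //= mderivU eqxx meval1 mul1r big1 ?addr0 => [->|i ne].
  by rewrite eqxx.
by rewrite mderivU eq_sym (negPf ne) meval0 mul0r.
Qed.

Theorem residual_intersection : exists U Psi : set 'rV[K]_N,
  [/\ zariski_open U, U 0,
      (Lam `&` nodal_locus K n.+2 n.+1) `&` U = (plane `|` Psi) `&` U,
      smooth_variety Psi 1
    & Psi 0 /\ intersection_multiplicity Lam Psi plane 0 n.+2].
Proof.
have [D [nl [D0 Ilam]]] := tangent_equations uncountableK planeL dimT Tv0 v0_neq0.
have n0 : nu_point (0 : 'rV[K]_n.+2) = 0 by exact/nu_point_eq0.
have phiD0 : (phi D).@[(0 : 'rV[K]_n.+2) 0] != 0 by rewrite phi_eval n0.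
have [y [ypos ystep [lamP betaV alphaV curve_div naka]]] := residual_arc phiX nl phiD0.
set pp := arc_ideal y in lamP curve_div naka.
have prp : prime_ideal pp by exact: arc_ideal_prime.
have idp := prime_ideal_ideal prp.
pose q : set B := phi @^-1` pp.
have prq : prime_ideal q by exact: prime_ideal_preim.
have idq := prime_ideal_ideal prq.
pose V l : set B := phi @^-1` (arcV y l).
have idV l : ideal (V l) by apply: ideal_preim; exact: arcV_ideal.
have V1 w : V 1 w <-> w.@[o 0] = 0 by rewrite /V /preimage /= (arcV1 ypos) phi_eval n0.
have VM k l u w : V k u -> V l w -> V (k + l)%N (u * w).
  by rewrite /V /preimage /= rmorphM; exact: arcVM.
have V_cancel k l u w : ~ V k.+1 u -> V (k + l)%N (u * w) -> V l w.
  by rewrite /V /preimage /= rmorphM; exact: arcV_cancel.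
have V_anti k l : (k <= l)%N -> V l `<=` V k by move=> kl w; exact: arcV_weak.
have qV l : q `<=` V l by move=> w qw; exact: qw.
have Vplane f : vanishing_ideal plane f -> V n.+2 f.
  move=> /(vanishing_coordinate_plane uncountableK)[C ->].
  by apply: (idl_sum (idV _)) => j _; apply: (idlMl (idV _)); exact: (betaV j).1.
have V_unit l u w : u.@[o 0] != 0 -> V l (u * w) -> V l w.
  by move=> /eqP u0; apply: (V_cancel 0%N) => /V1.
(* h in I(Lam) is beta_0 h' with h' in I(Lam) up to a unit, hence has infinite order. *)
have ILq : IL `<=` q.
  suff H k : forall h, IL h -> V (k * n.+2)%N h.
    by move=> h /(H _) Vh l; apply: (V_anti _ (l * n.+2)%N) => //; rewrite leq_pmulr.
  elim: k => [|k IHk] h Ih; first by rewrite /V /preimage /= mul0n; exact: arcV0.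
  have [C hE] : exists C : 'I_n.+2 -> B, h = \sum_j C j * 'X_(rshift n.+1 j).
    by apply: vanishing_coordinate_plane => //; exact: vanishing_ideal_anti planeL _ Ih.
  (* Replacing each beta_l by beta_0 nl_l / D in the expansion of [h] leaves beta_0 times [h1]. *)
  pose h1 := D * C ord0 + \sum_l nl l * C (lift ord0 l).
  have Dh : D * h = beta0 * h1 + \sum_l C (lift ord0 l) * lam_eq D nl l.
    rewrite hE big_ord_recl /h1 !mulrDr -addrA; congr (_ + _); first by ring.
    by rewrite !mulr_sumr -big_split; apply: eq_bigr => l _; rewrite /lam_eq /=; ring.
  have Isum : IL (\sum_l C (lift ord0 l) * lam_eq D nl l).
    by apply: (idl_sum idL) => l _; apply: (idlMl idL); exact: Ilam.
  have Ih1 : IL h1.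
    apply: (prime_idlMl prL nbeta0).
    rewrite -(addrK (\sum_l C (lift ord0 l) * lam_eq D nl l) (beta0 * h1)) -Dh.
    by apply: (idlB idL) => //; exact: (idlMl idL).
  apply: (V_unit _ D) => //; rewrite Dh; apply: (idlD (idV _)).
    by rewrite mulSn; apply: VM; [exact: (betaV ord0).1|exact: IHk].
  apply: (idl_sum (idV _)) => l _; apply: (idlMl (idV _)).
  exact: (lamP l).
have nqs : ~ q s by move=> qs; apply: alphaV.2; exact: qs.
have q0 f : q f -> f.@[o 0] = 0 by move=> qf; apply/V1; exact: qV.
have s0 : s.@[o 0] = 0 by apply/V1; exact: alphaV.1.
have divq f : f.@[o 0] = 0 -> exists g e, g.@[o 0] != 0 /\ q (g * f - s * e).
  exact: (local_division_descent uncountableK phi_const phi_eval integralX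
    nu_point_eq0 prp s0 curve_div).
have coord i : exists g (e : B), g.@[o 0] != 0 /\ q (g * 'X_i - s * e).
  by apply: divq; rewrite mevalXU mxE.
have [g /choice[e ge]] := choice coord.
have [d [d0 [smPsi IPsi Psi0]]] := @smooth_curve K (n + n.+2) uncountableK q
  (lshift n.+2 ord_max) prq nqs q0 g e (fun i => (ge i).1) (fun i => (ge i).2).
set Psi := _ `&` _ in smPsi IPsi Psi0.
have [dW [dW0 nakaW]] := naka.
have [G [g' [G0 GE]]] := norm_multiple uncountableK phi_const phi_eval integralX nu_point_eq0 dW0.
have [Z [U0 [clZ opU0 LamE]]] := lcL.
have Lam0 : Lam 0 by apply: planeL => j; rewrite mxE.
(* [U0] makes [Lam] closed, [d] is the denominator of the smooth curve, and [G] pulls back to a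
   multiple of [dW], so that [nakaW] applies at every point upstairs. *)
exists (U0 `&` [set x | (d * G).@[x 0] != 0]), Psi; split=> //.
- exact: zariski_openI_basic.
- split; first by move: Lam0; rewrite LamE => -[].
  by rewrite /= mevalM G0 mulr1.
- apply/seteqP; split=> t; case.
    move=> [Lt /nodal_nu_point[x tE]] [U0t dGt]; split; last by split.
    have [pt|npt] := pselect (plane t); [by left|right].
    move: dGt; rewrite /= mevalM mulf_eq0 negb_or => /andP[dt Gt].
    split=> // f qf; rewrite tE -phi_eval; apply: nakaW qf.
    + by move=> l; rewrite phi_eval -tE; exact: Ilam.
    + by apply/eqP => x0; apply: npt; rewrite tE; exact: nu_point_sigma0.
    + by move: Gt; rewrite tE -phi_eval GE mevalM mulf_eq0 negb_or => /andP[].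
  move=> Pt [U0t dGt]; split; last by split.
  case: Pt => [pt|[qt _]]; split.
  + exact: planeL.
  (* Fibres with m nodes are also of the form [nu_point x], hence limits of fibres with m - 1
     nodes. *)
  + move: pt; rewrite -nodal_plane => nt W clW subW; apply: nt => // t'.
    move=> /has_nodes_top_nu_point[x ->].
    exact: nu_point_nodal'.
  + rewrite LamE; split=> //; case: clZ LamE => F -> LamE f Ff.
    by apply: qt; apply: ILq => w; rewrite LamE => -[+ _]; apply.
  + move=> _ [F ->] sub f Ff; apply: qt.
    (* [f] vanishes on the image of the parametrization, so its pullback is the zero polynomial,
       which lies in every ideal. *)
    rewrite /q /preimage /= (_ : phi f = 0); first exact: (idl0 idp).
    apply: (mpoly_eval_eq0 uncountableK) => x; rewrite phi_eval.
    by have := nu_point_nodal' x (ex_intro _ F erefl) sub; apply.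
- split=> //; rewrite /intersection_multiplicity IPsi.
  set J := [set f | _].
  have idP : ideal (vanishing_ideal plane) := vanishing_ideal_ideal _.
  have idJ : ideal J.
    split.
    - exists 0, 0, 0; rewrite !addr0.
      by split; [exact: (idl0 idL)|exact: (idl0 idq)|exact: (idl0 idP)|].
    - move=> _ _ [a [b [c [Ia qb Ic ->]]]] [a' [b' [c' [Ia' qb' Ic' ->]]]].
      exists (a + a'), (b + b'), (c + c'); split; [exact: (idlD idL)|exact: (idlD idq)|
        exact: (idlD idP)|by ring].
    - move=> w _ [a [b [c [Ia qb Ic ->]]]]; exists (w * a), (w * b), (w * c).
      split; [exact: (idlMl idL)|exact: (idlMl idq)|exact: (idlMl idP)|by rewrite !mulrDr].
  apply: (@local_colength_chain K N q J s beta0 n.+2 V) => //.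
  + move=> f qf; exists 0, f, 0; rewrite add0r addr0; split=> //; first exact: (idl0 idL).
    exact: (idl0 idP).
  + exists 0, 0, beta0; rewrite !add0r; split=> //; [exact: (idl0 idL)|exact: (idl0 idq)|].
    by move=> t pt; rewrite mevalXU.
  + by move=> w; rewrite /V /preimage /=; exact: arcV0.
  + move=> _ [a [b [c [Ia qb Ic ->]]]]; apply: (idlD (idV _)); last exact: Vplane.
    by apply: (idlD (idV _)); apply: qV => //; exact: ILq.
  + exact: alphaV.1.
  + by move=> Vs; apply: alphaV.2.
  + exact: (betaV ord0).1.
  + by move=> Vb; apply: (betaV ord0).2.
Qed.

End Main.
End Assembly.

Lemma nodal_locus_top (K : numClosedFieldType) n : ~ countable [set: K] ->
  nodal_locus K n.+2 n.+2 = @coordinate_plane K n.+1 n.+1.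
Proof.
move=> uncK; have [theta [thc ths thq]] := exists_theta K n.
apply/seteqP; split=> t; last exact: (plane_nodal uncK thc ths thq).
move=> nt; apply: (nt _ _ (fun t' => @has_nodes_plane K n t')).
exists [set f | exists j, f = 'X_(rshift n.+1 j)].
apply/seteqP; split=> x H; first by move=> _ [j ->]; rewrite mevalXU; exact: H.
by move=> j; have := H _ (ex_intro _ j erefl); rewrite mevalXU.
Qed.

Theorem residual_intersection_closed_field (K : numClosedFieldType) n
    (Lam : set 'rV[K]_(n.+1 + n.+2)) :
    ~ countable [set: K] -> smooth_variety Lam n.+2 ->
    nodal_locus K n.+2 n.+2 `<=` Lam ->
    ~ (tangent_space Lam 0 `<=` [set v | v 0 (rshift n.+1 ord0) = 0]) ->
  exists U Psi : set 'rV[K]_(n.+1 + n.+2),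
    [/\ zariski_open U, U 0,
        (Lam `&` nodal_locus K n.+2 n.+1) `&` U
          = (nodal_locus K n.+2 n.+2 `|` Psi) `&` U,
        smooth_variety Psi 1
      & Psi 0 /\
        intersection_multiplicity Lam Psi (nodal_locus K n.+2 n.+2) 0 n.+2].
Proof.
move=> uncK [irrL lcL _ dimL] subL; rewrite nodal_locus_top // in subL *.
move=> /existsNP[v /not_implyP[Tv /eqP v0]].
have [theta [thc ths thq]] := exists_theta K n.
have dim0 : has_linear_dimension (tangent_space Lam 0) n.+2.
  by apply: dimL; apply: subL => j; rewrite mxE.
have phiX i : nu_pullback K n 'X_i = nu (fun i => 'X_i : {mpoly K[n.+2]}) i.
  by rewrite mmapX mmap1U.
have phiC (c : K) : nu_pullback K n c%:MP = c%:MP by exact: mmapC.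
exact: (@residual_intersection K n uncK (nu_pullback K n) phiX phiC (@nu_pullback_eval K n)
  (coordinate_integral uncK thc ths thq) (nu_point_nodal uncK thc ths thq) (nodal_locus_top n uncK)
  Lam irrL lcL dim0 subL v Tv v0).
Qed.

Theorem mainTheorem8 (R : realType) (m : nat) (hm : (2 <= m)%N)
    (Lam : set 'rV[R[i]]_(m.-1 + m))
    (hLam : smooth_variety Lam m)
    (hDelta : nodal_locus R[i] m m `<=` Lam)
    (hT : ~ (tangent_space Lam 0 `<=` [set v | beta v (Ordinal (ltnW hm)) = 0])) :
  exists U Psi : set 'rV[R[i]]_(m.-1 + m),
    [/\ zariski_open U, U 0,
        (Lam `&` nodal_locus R[i] m m.-1) `&` U
          = (nodal_locus R[i] m m `|` Psi) `&` U,
        smooth_variety Psi 1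
      & Psi 0 /\
        intersection_multiplicity Lam Psi (nodal_locus R[i] m m) 0 m].
Proof.
case: m hm Lam hLam hDelta hT => [|[|n]] // hm Lam hLam hDelta hT.
apply: (residual_intersection_closed_field (@complex_uncountable R) hLam hDelta).
move=> subH; apply: hT => v /subH; rewrite /= /beta => <-.
by congr (v 0 (rshift _ _)); apply: val_inj.
Qed.
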